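(* Fix $h\in\mathbb R^d$, $h\neq0$ (arbitrary), and consider testing $H_0:\Delta=0$ versus $H_1:\Delta=N^{-1/2}h$, where $f_2(\cdot)=f_1(\cdot-\Delta)$, with $m/N\to\lambda\in(0,1)$. Let $J(x)=x$ and $\nu=\mathcal N(0,I_d)$, and assume $\frac1N\sum_{i=1}^N\delta_{h_i^d}\xrightarrow{w}\nu$ and $\limsup_{N\to\infty}\frac1N\sum_{i=1}^N\|J(h_i^d)\|^2\le\int\|J(z)\|^2\,d\nu(z)$. Then $$\inf_{\mathcal F_{\mathrm{gen}}}\mathrm{ARE}(T^{\nu,J},T)\ge1 .$$ Further, equality (that is, $\mathrm{ARE}(T^{\nu,J},T)=1$) holds if and only if $X=AW$ where $A$ is a $d\times d$ orthogonal matrix and $W\sim\mathcal N(\theta,\Sigma)$ for some diagonal matrix $\Sigma$ with positive diagonal entries.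
   Context: $X_1,\dots,X_m$ i.i.d. with density $f_1$ and $Y_1,\dots,Y_n$ i.i.d. with density $f_2$ on $\mathbb R^d$, independent samples; $N=m+n$; $Z_1,\dots,Z_N$ is the pooled sample. $\{h_1^d,\dots,h_N^d\}\subset\mathbb R^d$ is a fixed set of $N$ vectors for each $N$. Empirical ranks: $\widehat R_{m,n}(Z_i):=h^d_{\widehat\sigma_i}$ with $\widehat\sigma\in\arg\min_{\sigma\in S_N}\sum_i\|Z_i-h^d_{\sigma_i}\|^2$ ($S_N$ = permutations of $\{1,\dots,N\}$). $\Sigma_{\mathrm{ERD}}$ is the covariance matrix of the push-forward $J\#\nu$. The rank Hotelling statistic is $T^{\nu,J}_{m,n}=\frac{mn}{m+n}D^\top\Sigma_{\mathrm{ERD}}^{-1}D$ with $D=\frac1m\sum_iJ(\widehat R_{m,n}(X_i))-\frac1n\sum_jJ(\widehat R_{m,n}(Y_j))$. The Hotelling statistic is $T_{m,n}=\frac{mn}{m+n}(\bar X-\bar Y)^\top S_{m,n}^{-1}(\bar X-\bar Y)$, $S_{m,n}$ the pooled sample covariance matrix. $\mathcal F_{\mathrm{gen}}$ (blind source separation model) is the class of distributions of $X=AW$, where $A$ is an (unknown) orthogonal $d\times d$ matrix and $W$ has independent components with Lebesgue density $\prod_{i=1}^d\tilde f_i(w_i)$, $\tilde f_1,\dots,\tilde f_d$ univariate densities; the density of $X$ is $f_1(x)=\prod_{i=1}^d\tilde f_i(\sum_{j=1}^da_{ji}x_j)$, $A=(a_{ij})$. The location family $\{f(x|\theta)=f_1(x-\theta)\}_{\theta\in\mathbb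 R^d}$ is assumed regular: with $\eta(x,\theta):=\nabla_\theta f(x|\theta)/f(x|\theta)$ and $\theta_0$ the true parameter under $H_0$, it is quadratic mean differentiable at $\theta_0$, $\mathbb E_{\theta_0}\|\eta(X,\theta_0)\|^2<\infty$, and the Fisher information $\mathbb E_{\theta_0}[\eta(X,\theta_0)\eta(X,\theta_0)^\top]$ exists and is invertible. $\mathrm{ARE}(T^{\nu,J},T)$ is the asymptotic (Pitman) relative efficiency of the test based on $T^{\nu,J}_{m,n}$ with respect to the Hotelling $T^2$ test (limit of the ratio of the sample size needed by the latter to that needed by the former to reach the same power at the same level). As both statistics have noncentral $\chi^2_d$ limits under these alternatives, it is the ratio of noncentrality parameters: $$\mathrm{ARE}(T^{\nu,J},T)=\frac{\big\|\Sigma_{\mathrm{ERD}}^{-1/2}\,\mathbb E_{H_0}[J(R^\nu_{H_0}(X))\,h^\top\eta(X,\theta_0)]\big\|^2}{\big\|(\mathbb E_{H_0}[(X-\mathbb EX)(X-\mathbb EX)^\top])^{-1/2}\,\mathbb E_{H_0}[X\,h^\top\eta(X,\theta_0)]\big\|^2},$$ where $X$ follows the $H_0$ law and $R^\nu_{H_0}$ is the a.e. unique gradient of a convex function pushing the law of $X$ forward to $\nu$; its value is $+\infty$ when $X$ does not have finite second moments. The infimum is over laws of $X$ in $\mathcal F_{\mathrm{gen}}$.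
   Formalization: For d≥2 the equality clause fails for a fixed h (A=I, h=e_1, W_1 normal, W_2 logistic gives ARE=1); it is stated instead as ARE=1 for all nonzero h iff X is AW with W normal, and for the fixed h when no coordinate of A^T h is zero. *)

(* Defs.v *)
From HB Require Import structures.
From mathcomp Require Import all_boot all_order all_algebra.
From mathcomp Require Import all_classical all_reals all_analysis.
From mathcomp Require Import measurable_realfun.

Set Implicit Arguments.
Unset Strict Implicit.
Unset Printing Implicit Defensive.

Import Order.TTheory GRing.Theory Num.Theory.
Import numFieldNormedType.Exports.

Local Open Scope classical_set_scope.
Local Open Scope ring_scope.

(* R^d is 'cV[R]_d, with its library topology.  Its Borel sets are generated by
   the coordinates, as the library does for n.-tuple. *)
Section measurable_matrix.
Context (R : realType) (m n : nat).

Definition mx_cylinders : set (set 'M[R]_(m, n)) :=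
  [set A | exists i j, preimage_set_system setT (fun M : 'M[R]_(m, n) => M i j)
             measurable A].

HB.instance Definition _ := @isMeasurable.Build (sigma_display mx_cylinders)
  'M[R]_(m, n) <<s mx_cylinders >>
  (@sigma_algebra0 _ setT mx_cylinders) (@sigma_algebraC _ mx_cylinders)
  (@sigma_algebra_bigcup _ setT mx_cylinders).
End measurable_matrix.

Section measurable_coordinates.
Context (R : realType).

Lemma measurable_mx_coord m n (i : 'I_m) (j : 'I_n) :
  measurable_fun setT (fun M : 'M[R]_(m, n) => M i j).
Proof.
move=> _ B mB; rewrite setTI; apply: sub_sigma_algebra.
by exists i, j, B => //; rewrite setTI.
Qed.

Lemma measurable_fun_mxP disp (T : measurableType disp) m n
    (f : T -> 'M[R]_(m, n)) :
  (forall i j, measurable_fun setT (fun x => f x i j)) -> measurable_fun setT f.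
Proof.
move=> mf; refine (@measurability _ _ T 'M[R]_(m, n) setT f (@mx_cylinders R m n) erefl _).
move=> _ [B [i [j [C mC <-]] <-]].
by rewrite !setTI; rewrite -[X in measurable X]setTI; exact: mf.
Qed.

Lemma measurable_cons_cV d : measurable_fun setT
  (fun p : R * 'cV[R]_d => col_mx (p.1%:M : 'cV_1) p.2 : 'cV[R]_d.+1).
Proof.
apply: measurable_fun_mxP => i j; rewrite ord1.
under eq_fun do rewrite mxE.
case: (@splitP 1 d i) => k _.
- under eq_fun do rewrite ord1 mxE eqxx mulr1n; exact: measurable_fst.
- apply: (measurableT_comp (f := fun v : 'cV[R]_d => v k 0)) => //.
  exact: measurable_mx_coord.
Qed.

Lemma measurable_uncons_cV d : measurable_fun setT
  (fun v : 'cV[R]_d.+1 => (v ord0 ord0, dsubmx (v : 'cV[R]_(1 + d)))).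
Proof.
apply: measurable_fun_pair; first exact: measurable_mx_coord.
apply: measurable_fun_mxP => i j; under eq_fun do rewrite mxE.
exact: measurable_mx_coord.
Qed.

End measurable_coordinates.

(* Lebesgue measure on R^d, by R^(d+1) = R x R^d. *)
Section Lebesgue.
Context (R : realType).

Definition cons_cV d (p : R * 'cV[R]_d) : 'cV[R]_d.+1 :=
  col_mx (p.1%:M : 'cV_1) p.2.

Section step.
Context d (mu : {sigma_finite_measure set 'cV[R]_d -> \bar R}).

Definition lebesgue_cons : set 'cV[R]_d.+1 -> \bar R :=
  pushforward (lebesgue_measure \x mu)%E (@cons_cV d).

Let lebesgue_cons0 : lebesgue_cons set0 = 0%E.
Proof. by rewrite /lebesgue_cons /pushforward preimage_set0 measure0. Qed.

Let lebesgue_cons_ge0 A : (0 <= lebesgue_cons A)%E.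
Proof. by rewrite /lebesgue_cons /pushforward measure_ge0. Qed.

Let lebesgue_cons_additive : semi_sigma_additive lebesgue_cons.
Proof.
exact: (@measure_semi_sigma_additive _ _ _
  (measure_function_pushforward__canonical__measure_function_Measure
     (lebesgue_measure \x mu)%E (@measurable_cons_cV R d))).
Qed.

HB.instance Definition _ := isMeasure.Build _ _ _ lebesgue_cons
  lebesgue_cons0 lebesgue_cons_ge0 lebesgue_cons_additive.

Let lebesgue_cons_sigma_finite : sigma_finite setT lebesgue_cons.
Proof.
have /sigma_finiteP[F [TF ndF Foo]] := sigma_finiteT (@lebesgue_measure R).
have /sigma_finiteP[G [TG ndG Goo]] := sigma_finiteT mu.
pose u (v : 'cV[R]_d.+1) := (v ord0 ord0, dsubmx (v : 'cV[R]_(1 + d))).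
exists (fun n => u @^-1` (F n `*` G n)).
  apply/seteqP; split=> // v _.
  have [i _ Fi] : (\bigcup_i F i) (u v).1 by rewrite -TF.
  have [j _ Gj] : (\bigcup_i G i) (u v).2 by rewrite -TG.
  exists (maxn i j) => //; split.
  - by move: (u v).1 Fi; exact/subsetPset/ndF/leq_maxl.
  - by move: (u v).2 Gj; exact/subsetPset/ndG/leq_maxr.
move=> n; have [mF Fn] := Foo n; have [mG Gn] := Goo n; split.
  rewrite -[X in measurable X]setTI.
  by apply: measurable_uncons_cV => //; exact: measurableX.
rewrite /lebesgue_cons /pushforward -comp_preimage (_ : u \o _ = idfun).
  by rewrite preimage_id product_measure1E// lte_mul_pinfty// ge0_fin_numE.
apply/funext => -[x v] /=; rewrite /u /cons_cV; congr pair; last first.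
  by rewrite col_mxKd.
transitivity (col_mx (x%:M : 'cV[R]_1) v (lshift d ord0) ord0).
  by apply: (congr1 (fun k => col_mx (x%:M : 'cV[R]_1) v k ord0)); exact: val_inj.
by rewrite col_mxEu mxE eqxx mulr1n.
Qed.

HB.instance Definition _ := Measure_isSigmaFinite.Build _ _ _ lebesgue_cons
  lebesgue_cons_sigma_finite.
End step.

Fixpoint lebesgue_cV d : {sigma_finite_measure set 'cV[R]_d -> \bar R} :=
  match d with
  | 0 => \d_(0 : 'cV[R]_0)
  | d'.+1 => lebesgue_cons (lebesgue_cV d')
  end.
End Lebesgue.

Section euclidean.
Context (R : realType) (d : nat).

Definition dotv (u v : 'cV[R]_d) : R := (u^T *m v) ord0 ord0.

(* The squared Euclidean norm; `|v| is the sup norm. *)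
Definition sqnorm (v : 'cV[R]_d) : R := dotv v v.

Definition orthogonal_mx (A : 'M[R]_d) : Prop := A^T *m A = 1%:M.

(* A symmetric positive semidefinite square root of S, 0 if there is none. *)
Definition sqrtmx (S : 'M[R]_d) : 'M[R]_d :=
  xget 0 [set B | [/\ B^T = B, forall v, 0 <= dotv v (B *m v) & B *m B = S]].

End euclidean.

Record density {disp} {T : measurableType disp} {R : realType}
    (mu : {measure set T -> \bar R}) := Density {
  pdf :> T -> R;
  measurable_pdf : measurable_fun setT pdf;
  pdf_ge0 : forall x, 0 <= pdf x;
  integral_pdf : (\int[mu]_x (pdf x)%:E = 1)%E
}.

Section law.
Context disp (T : measurableType disp) (R : realType).
Context (mu : {measure set T -> \bar R}) (f : density mu).

Definition law : set T -> \bar R := fun B => (\int[mu]_(x in B) (f x)%:E)%E.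

Let law0 : law set0 = 0%E.
Proof. by rewrite /law integral_set0. Qed.

Let law_ge0 B : (0 <= law B)%E.
Proof. by apply: integral_ge0 => x _; rewrite lee_fin pdf_ge0. Qed.

Let law_additive : semi_sigma_additive law.
Proof.
apply: semi_sigma_additive_nng_induced => [|x]; last by rewrite lee_fin pdf_ge0.
by apply/measurable_EFinP; exact: measurable_pdf.
Qed.

HB.instance Definition _ := isMeasure.Build _ _ _ law law0 law_ge0 law_additive.

Let law_setT : law setT = 1%E.
Proof. exact: integral_pdf. Qed.

HB.instance Definition _ := Measure_isProbability.Build _ _ _ law law_setT.
End law.

Section moments.
Context disp (T : measurableType disp) (R : realType) (d : nat).
Implicit Types (P : probability T R) (g : T -> 'cV[R]_d).

Definition mean P g : 'cV[R]_d := \col_i \int[P]_x (g x i ord0).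

Definition covmx P g : 'M[R]_d :=
  \matrix_(i, j) \int[P]_x ((g x i ord0 - mean P g i ord0) *
                            (g x j ord0 - mean P g j ord0)).
End moments.

Section normal.
Context (R : realType) (d : nat).

Definition mvnormal_pdf (theta : 'cV[R]_d) (S : 'M[R]_d) (x : 'cV[R]_d) : R :=
  expR (- dotv (x - theta) (invmx S *m (x - theta)) / 2) /
  Num.sqrt ((2 * pi) ^+ d * \det S).

(* P = N(theta, S), for S symmetric positive definite *)
Definition is_mvnormal theta S (P : probability 'cV[R]_d R) : Prop :=
  forall B, measurable B ->
    P B = (\int[lebesgue_cV R d]_(x in B) (mvnormal_pdf theta S x)%:E)%E.
End normal.

Section rank_map.
Context (R : realType) (d : nat).

Definition econvex (phi : 'cV[R]_d -> \bar R) : Prop :=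
  (forall x, phi x != -oo%E) /\
  forall (x y : 'cV[R]_d) (t : R), 0 <= t <= 1 ->
    (phi (t *: x + (1 - t) *: y)%R <= t%:E * phi x + (1 - t)%:E * phi y)%E.

Definition is_gradient (phi : 'cV[R]_d -> \bar R) (x g : 'cV[R]_d) : Prop :=
  [/\ \forall y \near x, phi y \is a fin_num,
      differentiable (fine \o phi) x &
      forall v, 'd (fine \o phi) x v = dotv g v].

(* The convex potential may take the value +oo: an optimal map onto a normal
   law has no finite potential on R^d when P has bounded support. *)
Definition is_rank_map (P nu : probability 'cV[R]_d R)
    (T : 'cV[R]_d -> 'cV[R]_d) : Prop :=
  [/\ measurable_fun setT T,
      forall B, measurable B -> P (T @^-1` B) = nu B &
      exists2 phi, econvex phi & {ae P, forall x, is_gradient phi x (T x)}].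

Definition rank_map (P nu : probability 'cV[R]_d R) : 'cV[R]_d -> 'cV[R]_d :=
  xget (cst 0) [set T | is_rank_map P nu T].
End rank_map.

Section location_family.
Context (R : realType) (d : nat).
Notation lebesgue := (lebesgue_cV R d).
Implicit Types f : density lebesgue.

Definition location f (theta x : 'cV[R]_d) : R := f (x - theta).

(* eta(x, theta) = grad_theta f(x | theta) / f(x | theta) *)
Definition score f (theta x : 'cV[R]_d) : 'cV[R]_d :=
  \col_i ('D_(delta_mx i ord0) (fun t => location f t x) theta /
          location f theta x).

Definition fisher_info f : 'M[R]_d :=
  \matrix_(i, j) \int[law f]_x (score f 0 x i ord0 * score f 0 x j ord0).

Definition qmd f : Prop :=
  (\int[lebesgue]_x
     ((Num.sqrt (location f t x) - Num.sqrt (location f 0 x)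
       - 2^-1 * dotv t (score f 0 x) * Num.sqrt (location f 0 x)) ^+ 2
      / sqnorm t)%:E)%E
  @[t --> (0 : 'cV[R]_d)^'] --> 0%E.

(* Regularity at theta_0 = 0, the parameter of the law f itself.  The first two
   conditions say that the gradient and the expectations make sense. *)
Definition regular f : Prop :=
  [/\ {ae law f, forall x, differentiable (fun t => location f t x) 0},
      measurable_fun setT (score f 0),
      qmd f,
      (law f).-integrable setT (fun x => (sqnorm (score f 0 x))%:E) &
      fisher_info f \in unitmx].

(* The density of A W, for A orthogonal and W with independent components of
   densities g i: it is prod_i g i ((A^T x)_i), as A^-1 = A^T. *)
Definition bss_pdf (A : 'M[R]_d) (g : 'I_d -> density (@lebesgue_measure R))
    (x : 'cV[R]_d) : R :=
  \prod_i g i (\sum_j A j i * x j ord0).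

Definition Fgen : set (density lebesgue) :=
  [set f | regular f /\ exists A g, orthogonal_mx A /\ f =1 bss_pdf A g].

(* The law f is that of A W, where PW = N(theta, S) is the law of W. *)
Definition rotated_normal f : Prop :=
  exists (A : 'M[R]_d) (theta : 'cV[R]_d) (S : 'M[R]_d)
         (PW : probability 'cV[R]_d R),
    [/\ orthogonal_mx A, is_diag_mx S, forall i, 0 < S i i,
        is_mvnormal theta S PW &
        forall B, measurable B -> law f B = PW [set w | B (A *m w)]].

(* Pitman efficiency of the rank Hotelling test relative to the Hotelling test
   under Delta = N^(-1/2) h: the ratio of the noncentrality parameters of the
   limiting chi^2_d laws, at X ~ f.  Sigma_ERD = covmx nu J. *)
Definition ARE (nu : probability 'cV[R]_d R) (J : 'cV[R]_d -> 'cV[R]_d)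
    (h : 'cV[R]_d) f : \bar R :=
  if (law f).-integrable setT (fun x => (sqnorm x)%:E) then
    (sqnorm (invmx (sqrtmx (covmx nu J)) *m
       mean (law f)
         (fun x => dotv h (score f 0 x) *: J (rank_map (law f) nu x)))
     / sqnorm (invmx (sqrtmx (covmx (law f) id)) *m
       mean (law f) (fun x => dotv h (score f 0 x) *: x)))%:E
  else +oo%E.

End location_family.

(* N^-1 sum_i delta_(h_i) converges weakly to nu *)
Definition empirical_weak_cvg (R : realType) (d : nat)
    (hd : forall N, 'I_N -> 'cV[R]_d) (nu : probability 'cV[R]_d R) : Prop :=
  forall g : 'cV[R]_d -> R, continuous g -> (exists M, forall x, `|g x| <= M) ->
    (N%:R^-1 * \sum_(i < N) g (hd N i)) @[N --> \oo] --> \int[nu]_x g x.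

(* Main.v *)
From HB Require Import structures.
Require Import Defs.
From mathcomp Require Import all_boot all_order all_algebra.
From mathcomp Require Import all_classical all_reals all_analysis.
From mathcomp Require Import measurable_realfun.
From mathcomp Require Import ring lra.

Set Implicit Arguments.
Unset Strict Implicit.
Unset Printing Implicit Defensive.

Import Order.TTheory GRing.Theory Num.Theory.
Import numFieldNormedType.Exports.

Local Open Scope classical_set_scope.
Local Open Scope ring_scope.

(* In the coordinates w = A^T x the components W_j are independent with densities
   g_j, and the rank map onto N(0, I) acts coordinatewise by the increasing
   transport R_j = Phi^-1 o G_j, G_j the distribution function of g_j: its
   potential is a sum of one-variable convex functions.  It is unique a.e.: if
   S and T are gradients of convex functions pushing the law of X to the same
   nu, and theta is the conjugate of the potential of T, then
   theta(S x) - theta(T x) - x . (S x - T x) >= 0 has nonpositive mean.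

   Quadratic mean differentiability gives d/dt E[b(X + t v)] = E[b(X) v . eta]
   at t = 0 for bounded b.  With k = A^T h, independence then turns the
   efficiency into (sum_j k_j^2 I_j^2) / (sum_j k_j^2 / sigma_j^2), where I_j is
   the limit of the derivatives at t = 0 of E[c(W_j + t)] as c runs through
   truncations of R_j.

   By Fatou, I_j >= E[R_j'(W_j)] = E[g_j / phi(R_j)] >= 2 c - c^2 E[phi(R_j) / g_j]
   for every c > 0, and E[phi(R_j) / g_j] = int phi(R_j) <= E[W_j R_j(W_j)] by
   Tonelli.  Hence I_j >= 1 / E[W_j R_j(W_j)] >= 1 / sigma_j, by Cauchy-Schwarz;
   equality forces W_j = mu_j + sigma_j R_j(W_j), so W_j is normal. *)

(** * Push-forwards and laws given by densities *)

(** The component densities carry no smoothness and the transports R_j may be unbounded, whereas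
    differentiation along a shift is available only for bounded observables. Hence the truncations,
    and Fatou in place of an identity: it gives only a one-sided estimate, but a lower bound on I_j
    is all that the efficiency requires. The parameter c linearizes the inequality E[1/Z] >= 1/E[Z],
    so that only integrals of nonnegative functions occur; its final value 1 / E[W_j R_j(W_j)] is
    the maximizer. The same derivative taken for the identity instead of R_j is 1, so that
    E[X (h . eta)] = h and the denominator is h measured by the inverse covariance.

    A component with k_j = 0 enters neither sum, so equality at a single h tells nothing about it.
    This is why the equality case is stated for all directions at once, or for one h without zero
    coordinates in the frame A. Uniqueness of the rank map is proved under finite second moments,
    which is the case where the efficiency is a ratio and not +oo. *)

Section transfer.
Local Open Scope ereal_scope.
Context d1 d2 (X : measurableType d1) (Y : measurableType d2) (R : realType).

(** A relation between two given measures rather than the measure [pushforward Q phi]: the target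
    usually comes with its own density, and agreement on measurable sets is all that integrals
    see. *)
Definition pushes (phi : X -> Y) (Q : {measure set X -> \bar R})
    (P : {measure set Y -> \bar R}) : Prop :=
  measurable_fun setT phi /\
  forall B, measurable B -> P B = Q (phi @^-1` B).

Variables (phi : X -> Y) (Q : {measure set X -> \bar R})
  (P : {measure set Y -> \bar R}).
Hypothesis QP : pushes phi Q P.

Lemma ge0_integral_pushes (F : Y -> \bar R) : measurable_fun setT F ->
  (forall y, 0 <= F y) -> \int[P]_y F y = \int[Q]_x F (phi x).
Proof.
case: QP => mphi PQ mF F0.
transitivity (\int[pushforward Q phi]_y F y); last first.
  by rewrite ge0_integral_pushforward//= preimage_setT.
by apply: eq_measure_integral => A mA _; exact: PQ.
Qed.

Lemma integral_pushes (F : Y -> \bar R) : measurable_fun setT F ->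
  \int[P]_y F y = \int[Q]_x F (phi x).
Proof.
move=> mF; rewrite integralE [RHS]integralE.
congr (_ - _).
- rewrite ge0_integral_pushes//; last exact: measurable_funepos.
  by rewrite (funepos_comp F phi).
- rewrite ge0_integral_pushes//; last exact: measurable_funeneg.
  by rewrite (funeneg_comp F phi).
Qed.

Lemma Rintegral_pushes (F : Y -> R) : measurable_fun setT F ->
  (\int[P]_y F y = \int[Q]_x F (phi x))%R.
Proof.
by move=> mF; rewrite /Rintegral integral_pushes//; exact/measurable_EFinP.
Qed.

Lemma integrable_pushes (F : Y -> \bar R) : measurable_fun setT F ->
  P.-integrable setT F <-> Q.-integrable setT (F \o phi).
Proof.
move=> mF; have mF' : measurable_fun setT (F \o phi).
  by apply: measurableT_comp => //; case: QP.
have E : \int[P]_x `|F x| = \int[Q]_x `|(F \o phi) x|.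
  by rewrite integral_pushes//; exact: measurableT_comp.
by split=> /integrableP[_ h]; apply/integrableP; split; rewrite // -?E// E.
Qed.

Lemma ae_pushes (C : set Y) : {ae P, forall y, C y} ->
  {ae Q, forall x, C (phi x)}.
Proof.
case: QP => mphi PQ [N [mN N0 sub]]; exists (phi @^-1` N); split.
- by rewrite -[X in measurable X]setTI; exact: mphi.
- by rewrite -PQ.
- by move=> x /= Cx; exact: sub.
Qed.

End transfer.

Section law_integral.
Local Open Scope ereal_scope.
Context disp (T : measurableType disp) (R : realType).
Context (mu : {measure set T -> \bar R}) (f : density mu).
Import HBNNSimple.

(** For an indicator this is the definition of [law]. Linearity gives simple functions, and monotone
    convergence on both sides gives their increasing limits. *)
Lemma ge0_integral_law (F : T -> \bar R) : measurable_fun setT F ->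
  (forall x, 0 <= F x) -> \int[law f]_x F x = \int[mu]_x (F x * (f x)%:E).
Proof.
move=> mF F0; have mf := measurable_pdf f; have f0 := pdf_ge0 f.
pose F_ := nnsfun_approx (@measurableT _ T) mF.
have mFf n : measurable_fun setT (fun x => (F_ n x)%:E * (f x)%:E).
  by apply: emeasurable_funM; exact/measurable_EFinP.
transitivity (limn (fun n => \int[law f]_x (F_ n x)%:E)).
  rewrite -monotone_convergence//=.
  - apply: eq_integral => y yD; apply/esym/cvg_lim => //.
    by apply: cvg_nnsfun_approx=> // *; apply: f0; rewrite inE.
  - by move=> n; exact/measurable_EFinP/measurable_funP.
  - by move=> n y _; rewrite lee_fin.
  - by move=> y _ m n mn; rewrite lee_fin; exact/lefP/nd_nnsfun_approx.
transitivity (limn (fun n => \int[mu]_x ((F_ n x)%:E * (f x)%:E))); last first.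
  rewrite -monotone_convergence//=; last 2 first.
  - by move=> n y _; rewrite mule_ge0// lee_fin.
  - move=> y _ m n mn; rewrite lee_pmul ?lee_fin//.
    exact/lefP/nd_nnsfun_approx.
  apply: eq_integral => y yD; apply/cvg_lim => //.
  by apply: cvgeZr => //; exact: cvg_nnsfun_approx.
congr (limn _); apply/funext => n.
transitivity (\sum_(k \in range (F_ n))
    \int[law f]_x (k * \1_(F_ n @^-1` [set k]) x)%:E).
  under eq_integral do rewrite fimfunE -fsumEFin//.
  rewrite ge0_integral_fsum//.
  - by move=> y; exact/measurable_EFinP/measurable_funM.
  - by move=> y x _; rewrite nnfun_muleindic_ge0.
transitivity (\sum_(k \in range (F_ n))
    \int[mu]_x ((k * \1_(F_ n @^-1` [set k]) x)%:E * (f x)%:E)); last first.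
  rewrite -ge0_integral_fsum//; last 2 first.
  - move=> y; apply: emeasurable_funM; last exact/measurable_EFinP.
    exact/measurable_EFinP/measurable_funM.
  - move=> y x _; apply: mule_ge0; first by rewrite EFinM nnfun_muleindic_ge0.
    by rewrite lee_fin pdf_ge0.
  apply: eq_integral => x _; rewrite fimfunE -fsumEFin// ge0_mule_fsuml//.
  by move=> y; rewrite EFinM nnfun_muleindic_ge0.
apply: eq_fsbigr => r; rewrite inE => -[t _ Ft].
have r0 : (0 <= r)%R by rewrite -Ft.
under [LHS]eq_integral do rewrite EFinM.
rewrite ge0_integralZl//=; last exact/measurable_EFinP.
under [RHS]eq_integral do rewrite EFinM -muleA.
rewrite ge0_integralZl//=; last first.
- by move=> x _; rewrite mule_ge0// lee_fin.
- by apply: emeasurable_funM; apply/measurable_EFinP.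
congr (_ * _); rewrite integral_indic//= setIT /law integral_mkcond.
apply: eq_integral => x _ /=; rewrite patchE indicE.
by case: ifPn => _; rewrite ?mul1e ?mul0e.
Qed.

Lemma integral_law (F : T -> \bar R) : measurable_fun setT F ->
  \int[law f]_x F x = \int[mu]_x (F x * (f x)%:E).
Proof.
move=> mF; have f0 := pdf_ge0 f.
rewrite [LHS]integralE [RHS]integralE ge0_integral_law//; last first.
  exact: measurable_funepos.
rewrite ge0_integral_law//; last exact: measurable_funeneg.
congr (_ - _); apply: eq_integral => x _.
- by rewrite !funeposE maxe_pMl ?lee_fin// mul0e.
- by rewrite !funenegE maxe_pMl ?lee_fin// mul0e mulNe.
Qed.

Lemma integrable_law (F : T -> \bar R) : measurable_fun setT F ->
  (law f).-integrable setT F <->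
  mu.-integrable setT (fun x => F x * (f x)%:E).
Proof.
move=> mF; have mf : measurable_fun setT (fun x => F x * (f x)%:E).
  by apply: emeasurable_funM => //; exact/measurable_EFinP/measurable_pdf.
have E : \int[law f]_x `|F x| = \int[mu]_x `|F x * (f x)%:E|.
  rewrite integral_law//; last exact: measurableT_comp.
  by apply: eq_integral => x _; rewrite abseM [X in _ = _ * X]gee0_abs// lee_fin pdf_ge0.
by split=> /integrableP[_ h]; apply/integrableP; split; rewrite // -?E// E.
Qed.

Lemma Rintegral_law (F : T -> R) : measurable_fun setT F ->
  (\int[law f]_x F x = \int[mu]_x (F x * f x))%R.
Proof.
by move=> mF; rewrite /Rintegral integral_law//; exact/measurable_EFinP.
Qed.

Lemma law_dominates : law f `<< mu.
Proof.
apply/null_content_dominatesP => A mA muA0; rewrite /law.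
apply: null_set_integral => //.
by apply/measurable_funTS/measurable_EFinP/measurable_pdf.
Qed.

End law_integral.

(** * Lebesgue measure on column vectors *)

Section mx_measurable.
Context (R : realType).

Lemma measurable_mulmx m n (A : 'M[R]_(m, n)) :
  measurable_fun setT (fun x : 'cV[R]_n => A *m x).
Proof.
apply: measurable_fun_mxP => i j.
under eq_fun do rewrite mxE.
apply: measurable_sum => k; apply: measurable_funM => //.
exact: measurable_mx_coord.
Qed.

Lemma measurable_mulmx_comp disp (T : measurableType disp) m n (A : 'M[R]_(m, n))
    (f : T -> 'cV[R]_n) : measurable_fun setT f ->
  measurable_fun setT (fun x => A *m f x).
Proof. by move=> mf; apply: (measurableT_comp (@measurable_mulmx m n A)). Qed.

Lemma measurable_coord disp (T : measurableType disp) n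
    (f : T -> 'cV[R]_n) i : measurable_fun setT f ->
  measurable_fun setT (fun x => f x i ord0).
Proof. by move=> mf; apply: (measurableT_comp (measurable_mx_coord i ord0)). Qed.

Lemma measurable_addv disp (T : measurableType disp) n (f g : T -> 'cV[R]_n) :
  measurable_fun setT f -> measurable_fun setT g ->
  measurable_fun setT (fun x => f x + g x).
Proof.
move=> mf mg; apply: measurable_fun_mxP => i j; rewrite ord1.
under eq_fun do rewrite mxE.
by apply: measurable_funD; exact: measurable_coord.
Qed.

Lemma measurable_scalev disp (T : measurableType disp) n (f : T -> R)
    (g : T -> 'cV[R]_n) :
  measurable_fun setT f -> measurable_fun setT g ->
  measurable_fun setT (fun x => f x *: g x).
Proof.
move=> mf mg; apply: measurable_fun_mxP => i j; rewrite ord1.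
under eq_fun do rewrite mxE.
by apply: measurable_funM => //; exact: measurable_coord.
Qed.

Lemma dotvE n (u v : 'cV[R]_n) : dotv u v = \sum_i u i ord0 * v i ord0.
Proof. by rewrite /dotv mxE; apply: eq_bigr => i _; rewrite mxE. Qed.

Lemma measurable_dotv disp (T : measurableType disp) n (f g : T -> 'cV[R]_n) :
  measurable_fun setT f -> measurable_fun setT g ->
  measurable_fun setT (fun x => dotv (f x) (g x)).
Proof.
move=> mf mg; under eq_fun do rewrite dotvE.
by apply: measurable_sum => i; apply: measurable_funM; exact: measurable_coord.
Qed.

End mx_measurable.

Section scales.
Local Open Scope ereal_scope.
Context (R : realType).

(** Change of variables with constant Jacobian [c]. On nonnegative integrands it is stable under
    composition and under Tonelli, so linear maps can be assembled from elementary ones. *)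
Definition scales disp (T : measurableType disp)
    (mu : {measure set T -> \bar R}) (phi : T -> T) (c : R) : Prop :=
  measurable_fun setT phi /\
  forall F : T -> \bar R, measurable_fun setT F -> (forall x, 0 <= F x) ->
    \int[mu]_x F x = c%:E * \int[mu]_x F (phi x).

Lemma scales_comp disp (T : measurableType disp)
    (mu : {measure set T -> \bar R}) (phi psi : T -> T) (c c' : R) :
  scales mu phi c -> scales mu psi c' -> scales mu (phi \o psi) (c * c').
Proof.
move=> [mphi hphi] [mpsi hpsi]; split; first exact: measurableT_comp.
move=> F mF F0; rewrite hphi// EFinM -muleA; congr (_ * _).
by apply: (hpsi (F \o phi)) => [|x]; [exact: (measurableT_comp mF)|exact: F0].
Qed.

Lemma affine_preimage_ocitv (a b s t : R) : a != 0%R ->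
  lebesgue_measure `]s, t] =
  `|a|%:E * lebesgue_measure ((fun x => a * x + b)%R @^-1` `]s, t]).
Proof.
move=> a0; case: (ltrgtP a 0%R) a0 => // a0 _.
- have -> : (fun x => a * x + b)%R @^-1` `]s, t] =
      [set` `[((t - b) / a)%R, ((s - b) / a)%R[].
    apply/seteqP; split=> x /=; rewrite !in_itv/= ler_ndivrMr// ltr_ndivlMr//;
      by rewrite lerBrDr ltrBlDr (mulrC x) andbC.
  rewrite !lebesgue_measure_itv/= !lte_fin ltr_ndivrMr// divfK ?lt_eqF//.
  rewrite ltrD2r ltr0_norm//; case: ifPn => _; last by rewrite mule0.
  rewrite -!EFinD -EFinM; congr (_%:E); field; lra.
- have -> : (fun x => a * x + b)%R @^-1` `]s, t] =
      [set` `]((s - b) / a)%R, ((t - b) / a)%R]].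
    by apply/seteqP; split=> x /=;
      rewrite !in_itv/= ler_pdivlMr// ltr_pdivrMr// lerBrDr ltrBlDr (mulrC x).
  rewrite !lebesgue_measure_itv/= !lte_fin ltr_pdivrMr// divfK ?gt_eqF//.
  rewrite ltrD2r gtr0_norm//; case: ifPn => _; last by rewrite mule0.
  rewrite -!EFinD -EFinM; congr (_%:E); field; lra.
Qed.

(** Lebesgue measure pushed forward and multiplied by |a| agrees with Lebesgue measure on half-open
    intervals, hence everywhere by uniqueness. *)
Lemma scales_affine (a b : R) : a != 0%R ->
  scales (@lebesgue_measure R) (fun x => a * x + b)%R `|a|%R.
Proof.
move=> a0; have mphi : measurable_fun setT (fun x : R => a * x + b)%R.
  by apply: measurable_funD => //; exact: measurable_funM.
split=> // F mF F0.
have c0 : (0 <= `|a|)%R by [].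
pose m : {measure set (measurableTypeR R) -> \bar R} := mscale (NngNum c0)
  (measure_function_pushforward__canonical__measure_function_Measure
    (@lebesgue_measure R) (mphi : measurable_fun _ (_ : _ -> measurableTypeR R))).
rewrite (eq_measure_integral m); last first.
  move=> A mA _; apply/lebesgue_measure_unique => // _ [[s t] _ <-].
  exact: affine_preimage_ocitv.
by rewrite ge0_integral_mscale//= ge0_integral_pushforward//= preimage_setT.
Qed.

(** Tonelli is kept in both orders: the head innermost for maps that move the head with the tail
    frozen, the tail innermost in [ge0_integral_lebesgue_cVSr] for the opposite case. *)
Lemma ge0_integral_lebesgue_cVS d (F : 'cV[R]_d.+1 -> \bar R) :
  measurable_fun setT F -> (forall x, 0 <= F x) ->
  \int[lebesgue_cV R d.+1]_x F x =
  \int[lebesgue_cV R d]_y \int[lebesgue_measure]_x F (cons_cV (x, y)).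
Proof.
move=> mF F0; have mc := @measurable_cons_cV R d.
rewrite /= [LHS]ge0_integral_pushforward//= preimage_setT.
by rewrite fubini_tonelli2//; exact: measurableT_comp.
Qed.

Lemma ge0_integral_lebesgue_cVSr d (F : 'cV[R]_d.+1 -> \bar R) :
  measurable_fun setT F -> (forall x, 0 <= F x) ->
  \int[lebesgue_cV R d.+1]_x F x =
  \int[lebesgue_measure]_x \int[lebesgue_cV R d]_y F (cons_cV (x, y)).
Proof.
move=> mF F0; have mc := @measurable_cons_cV R d.
rewrite /= [LHS]ge0_integral_pushforward//= preimage_setT.
by rewrite fubini_tonelli1//; exact: measurableT_comp.
Qed.

Lemma cons_cVK d (x : 'cV[R]_d.+1) :
  cons_cV (x ord0 ord0, dsubmx (x : 'cV[R]_(1 + d))) = x.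
Proof.
rewrite -[RHS](@vsubmxK _ 1 d); congr (@col_mx R 1 d 1 _ _).
apply/matrixP => i j; rewrite !ord1 !mxE eqxx mulr1n.
by congr (x _ _); exact: val_inj.
Qed.

Lemma cons_cV0 d (p : R * 'cV[R]_d) : cons_cV p ord0 ord0 = p.1.
Proof.
transitivity (col_mx (p.1%:M : 'cV[R]_1) p.2 (lshift d ord0) ord0).
  by apply: (congr1 (fun k => col_mx _ p.2 k ord0)); exact: val_inj.
by rewrite col_mxEu mxE eqxx mulr1n.
Qed.

Lemma cons_cVS d (p : R * 'cV[R]_d) i : cons_cV p (lift ord0 i) ord0 = p.2 i ord0.
Proof.
transitivity (col_mx (p.1%:M : 'cV[R]_1) p.2 (rshift 1 i) ord0).
  by apply: (congr1 (fun k => col_mx _ p.2 k ord0)); exact: val_inj.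
by rewrite col_mxEd.
Qed.

Lemma dsubmx_cons_cV d (p : R * 'cV[R]_d) :
  dsubmx (cons_cV p : 'cV[R]_(1 + d)) = p.2.
Proof. by rewrite /cons_cV col_mxKd. Qed.

Definition on_head d (phi : R * 'cV[R]_d -> R * 'cV[R]_d) (x : 'cV[R]_d.+1) :=
  cons_cV (phi (x ord0 ord0, dsubmx (x : 'cV[R]_(1 + d)))).

Lemma measurable_on_head d phi : measurable_fun setT phi ->
  measurable_fun setT (@on_head d phi).
Proof.
move=> mphi; apply: (measurableT_comp (@measurable_cons_cV R d)).
by apply: (measurableT_comp mphi); exact: measurable_uncons_cV.
Qed.

Lemma on_head_cons d phi p : @on_head d phi (cons_cV p) = cons_cV (phi p).
Proof. by rewrite /on_head cons_cV0 dsubmx_cons_cV -surjective_pairing. Qed.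

(** With the tail frozen the map is affine in the head, whatever the measurable shift [g], so each
    inner integral scales by |a|. *)
Lemma scales_head d (a : R) (g : 'cV[R]_d -> R) : a != 0%R ->
  measurable_fun setT g ->
  scales (lebesgue_cV R d.+1) (on_head (fun p => (a * p.1 + g p.2, p.2)))%R `|a|%R.
Proof.
move=> a0 mg.
have mphi : measurable_fun setT
    (on_head (fun p : R * 'cV[R]_d => (a * p.1 + g p.2, p.2)))%R.
  apply: measurable_on_head; apply: measurable_fun_pair => //.
  apply: measurable_funD; first exact: measurable_funM.
  exact: (measurableT_comp mg).
split=> // F mF F0; rewrite ge0_integral_lebesgue_cVS//.
rewrite ge0_integral_lebesgue_cVS//; last exact: (measurableT_comp mF).
have mFc : measurable_fun setT (F \o @cons_cV R d).
  by apply: (measurableT_comp mF); exact: measurable_cons_cV.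
rewrite -ge0_integralZl//=; last 2 first.
- apply: (@measurable_fun_fubini_tonelli_G _ _ _ _ _ lebesgue_measure
    (fun p => F (on_head _ (cons_cV p)))) => //.
  apply: (measurableT_comp mF); apply: (measurableT_comp mphi).
  exact: measurable_cons_cV.
- by move=> x _; exact: integral_ge0.
apply: eq_integral => y _.
rewrite (scales_affine (g y) a0).2//; last first.
  by apply: (measurableT_comp mFc); exact: measurable_fun_pair.
by congr (_ * _); apply: eq_integral => x _; rewrite on_head_cons.
Qed.

Lemma scales_tail d (c : R) (g : R -> 'cV[R]_d -> 'cV[R]_d) : (0 <= c)%R ->
  measurable_fun setT (fun p => g p.1 p.2) ->
  (forall x, scales (lebesgue_cV R d) (g x) c) ->
  scales (lebesgue_cV R d.+1) (on_head (fun p => (p.1, g p.1 p.2)))%R c.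
Proof.
move=> c0 mg hg.
have mphi : measurable_fun setT (on_head (fun p => (p.1, g p.1 p.2))).
  by apply: measurable_on_head; apply: measurable_fun_pair.
split=> // F mF F0; rewrite ge0_integral_lebesgue_cVSr//.
rewrite ge0_integral_lebesgue_cVSr//; last exact: (measurableT_comp mF).
have mFc : measurable_fun setT (F \o @cons_cV R d).
  by apply: (measurableT_comp mF); exact: measurable_cons_cV.
rewrite -ge0_integralZl//=; last 2 first.
- apply: (@measurable_fun_fubini_tonelli_F _ _ _ _ _ (lebesgue_cV R d)
    (fun p => F (on_head _ (cons_cV p)))) => //.
  apply: (measurableT_comp mF); apply: (measurableT_comp mphi).
  exact: measurable_cons_cV.
- by move=> x _; exact: integral_ge0.
apply: eq_integral => x _.
rewrite ((hg x).2 (fun y => F (cons_cV (x, y))))//; last first.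
  by apply: (measurableT_comp mFc); exact: measurable_fun_pair.
by congr (_ * _); apply: eq_integral => y _; rewrite on_head_cons.
Qed.

Lemma scales_eq disp (T : measurableType disp)
    (mu : {measure set T -> \bar R}) (phi psi : T -> T) (c c' : R) :
  phi =1 psi -> c = c' -> scales mu phi c -> scales mu psi c'.
Proof. by move=> /funext -> ->. Qed.

Lemma scales_id disp (T : measurableType disp) (mu : {measure set T -> \bar R}) :
  scales mu id 1%R.
Proof. by split=> [|F mF F0]; [exact: measurable_id|rewrite mul1e]. Qed.

Lemma scales_translation d (v : 'cV[R]_d) :
  scales (lebesgue_cV R d) (fun x => x + v)%R 1%R.
Proof.
elim: d v => [v|d IH v].
  apply: scales_eq (scales_id _) => // x.
  by apply/matrixP => -[].
apply: (@scales_eq _ _ _ (on_head (fun p => (1 * p.1 + v ord0 ord0, p.2)) \o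
  on_head (fun p => (p.1, p.2 + dsubmx (v : 'cV[R]_(1 + d)))))%R _ (`|1| * 1)%R).
- move=> x /=; rewrite on_head_cons/= mul1r.
  rewrite -[RHS]cons_cVK; congr cons_cV; congr pair.
    by rewrite !mxE.
  by rewrite linearD.
- by rewrite normr1 mulr1.
apply: scales_comp.
- by apply: (@scales_head d 1%R (fun _ => v ord0 ord0)); rewrite ?oner_neq0.
- apply: (@scales_tail _ 1%R (fun _ y => y + dsubmx (v : 'cV[R]_(1 + d)))%R) => //.
  by apply: measurable_addv => //; exact: measurable_snd.
Qed.

End scales.

Section linear_maps.
Context (R : realType).

Lemma on_head_mulmx d (A : 'M[R]_(1 + d)) (x : 'cV[R]_d.+1) :
  A *m x = on_head (fun p => (A ord0 ord0 * p.1 + (ursubmx A *m p.2) ord0 ord0,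
                              p.1 *: dlsubmx A + drsubmx A *m p.2)) x.
Proof.
rewrite -[x in LHS]cons_cVK /on_head; set p := (_, _).
rewrite -[A in LHS]submxK /cons_cV (@mul_block_col _ 1 d 1 d).
congr (@col_mx R 1 d 1 _ _).
- apply/matrixP => i j; rewrite !ord1 !mxE/= big_ord1 !mxE !eqxx !mulr1n.
  by congr (A _ _ * _ + _); exact: val_inj.
- by rewrite mul_mx_scalar.
Qed.

Lemma det0_col d (A : 'M[R]_(1 + d)) : \det A != 0 ->
  A ord0 ord0 = 0 -> exists i, dlsubmx A i ord0 != 0.
Proof.
move=> dA A0; apply: contrapT => h; move/negP: dA; apply; apply/eqP.
have c0 i : A i ord0 = 0.
  case: (unliftP ord0 i) => [j ->|->//].
  apply: contrapT => Aj; apply: h; exists j; apply/eqP => e; apply: Aj.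
  by rewrite -[RHS]e !mxE; congr (A _ _); exact: val_inj.
by rewrite (expand_det_col A ord0) big1// => i _; rewrite c0 mul0r.
Qed.

(** Gaussian elimination, by induction on d. A nonzero corner entry factors [A] into a map that
    moves the head, the Schur complement acting on the tail and a shear of the tail; a zero corner
    is first repaired by a row operation of determinant 1. *)
Lemma scales_mulmx d (A : 'M[R]_d) : \det A != 0 ->
  scales (lebesgue_cV R d) (mulmx A) `|\det A|.
Proof.
elim: d A => [A _|d IH].
  apply: scales_eq (scales_id _) => [x|]; last by rewrite det_mx00 normr1.
  by apply/matrixP => -[].
have pivot (A : 'M[R]_(1 + d)) : \det A != 0 -> A ord0 ord0 != 0 ->
    scales (lebesgue_cV R d.+1) (mulmx A) `|\det A|.
  move=> dA a0; set a := A ord0 ord0 in a0.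
  pose u := ursubmx A; pose v := dlsubmx A.
  (* Schur complement of the pivot: [\det A = a * \det S], so the induction hypothesis applies to
     [S]. *)
  pose S := drsubmx A - a^-1 *: (v *m u).
  have aE : ulsubmx A = a%:M.
    apply/matrixP => i j; rewrite !ord1 !mxE eqxx mulr1n.
    by congr (A _ _); exact: val_inj.
  have AE : A = block_mx (1%:M : 'M[R]_1) 0 (a^-1 *: v) 1%:M *m block_mx a%:M u 0 S.
    rewrite mulmx_block !mul1mx !mul0mx !addr0.
    rewrite -[LHS]submxK aE; congr block_mx.
    - by rewrite mul_mx_scalar scalerA mulfV// scale1r.
    - by rewrite -scalemxAl addrC subrK.
  have dE : \det A = a * \det S.
    by rewrite AE det_mulmx det_lblock det_ublock !det1 !mul1r det_scalar1.
  have dS : \det S != 0 by move: dA; rewrite dE mulf_eq0 negb_or => /andP[].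
  apply: (@scales_eq _ _ _ _ (
    on_head (fun p => (p.1, p.2 + p.1 *: (a^-1 *: v))) \o
    (on_head (fun p => (p.1, S *m p.2)) \o
     on_head (fun p => (a * p.1 + (u *m p.2) ord0 ord0, p.2)))) _
    (1 * (`|\det S| * `|a|))).
  - move=> x; rewrite on_head_mulmx -[x]cons_cVK; set p := (x ord0 ord0, _).
    rewrite /comp !on_head_cons/=; congr cons_cV; congr pair.
    rewrite -/a -/u; set x' := dsubmx _; set x0 := x _ _.
    rewrite /S mulmxBl scalerA mulrDl (mulrC a) mulfK// scalerDl -/v.
    have -> : (a^-1 *: (v *m u)) *m x' = ((u *m x') ord0 ord0 / a) *: v.
      rewrite -scalemxAl -mulmxA; set M := u *m x'.
      by rewrite [in LHS](mx11_scalar M) mul_mx_scalar scalerA mulrC.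
    by rewrite [X in _ + X = _]addrC addrA subrK addrC.
  - by rewrite mul1r dE normrM mulrC.
  apply: scales_comp; last apply: scales_comp.
  - apply: (@scales_tail R d 1 (fun x y => y + x *: (a^-1 *: v))) => //.
      by apply: measurable_addv => //; apply: measurable_scalev.
    by move=> x; exact: scales_translation.
  - apply: (@scales_tail R d `|\det S| (fun _ y => S *m y)) => //.
      by apply: measurable_mulmx_comp; exact: measurable_snd.
    by move=> _; exact: IH.
  - apply: (@scales_head R d a (fun y => (u *m y) ord0 ord0)) => //.
    apply: (@measurable_coord R _ _ 1 (fun y => u *m y) ord0).
    exact: measurable_mulmx.
move=> A dA; have [a0|a0] := eqVneq (A ord0 ord0) 0; last exact: pivot.
have [i vi] := det0_col dA a0.
(* [shear 1] adds to the top row a lower row whose first entry is nonzero. Both [shear (-1)] and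
   [shear 1 *m A] then have a nonzero corner, so the pivot case covers the two factors of [A]. *)
pose shear (s : R) : 'M[R]_(1 + d) := block_mx 1%:M (s *: delta_mx ord0 i) 0 1%:M.
have dsh s : \det (shear s) = 1 by rewrite det_ublock !det1 mul1r.
have shK : shear (-1) *m shear 1 = 1%:M.
  rewrite mulmx_block !mul1mx !mul0mx !mulmx1 !mulmx0 !addr0 !add0r.
  by rewrite scaleN1r scale1r subrr -scalar_mx_block.
have blk (B : 'M[R]_1) u v (C : 'M[R]_d) :
    block_mx B u v C ord0 ord0 = B ord0 ord0.
  by rewrite -(block_mxEul B u v C); congr (block_mx _ _ _ _ _ _); exact: val_inj.
apply: (@scales_eq _ _ _ _ (mulmx (shear (-1)) \o mulmx (shear 1 *m A)) _
   (`|\det (shear (-1))| * `|\det (shear 1 *m A)|)).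
- by move=> x /=; rewrite !mulmxA shK mul1mx.
- by rewrite det_mulmx !dsh normr1 !mul1r.
apply: scales_comp; apply: pivot; rewrite ?det_mulmx ?dsh ?mul1r ?oner_neq0//.
  by rewrite blk mxE oner_neq0.
rewrite -[A](@submxK R 1 d 1 d) /shear (@mulmx_block R 1 d 1 d 1 d) blk !mul1mx scale1r mxE.
rewrite -rowE [X in _ + X]mxE [X in X + _](_ : _ = 0) ?add0r//.
by rewrite -[RHS]a0 !mxE; congr (A _ _); exact: val_inj.
Qed.

Lemma orthogonal_mx_unit d (A : 'M[R]_d) : orthogonal_mx A -> `|\det A| = 1.
Proof.
move=> /(congr1 determinant); rewrite det_mulmx det_tr det1 => dA.
by apply/eqP; rewrite -(@eqrXn2 _ 2)// expr1n real_normK ?num_real// expr2 dA.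
Qed.

Lemma orthogonal_mxC d (A : 'M[R]_d) : orthogonal_mx A -> A *m A^T = 1%:M.
Proof. exact: mulmx1C. Qed.

Lemma ge0_integral_orthogonal d (A : 'M[R]_d) (F : 'cV[R]_d -> \bar R) :
  orthogonal_mx A -> measurable_fun setT F -> (forall x, 0 <= F x)%E ->
  (\int[lebesgue_cV R d]_x F x = \int[lebesgue_cV R d]_x F (A *m x))%E.
Proof.
move=> oA mF F0; have dA := orthogonal_mx_unit oA.
have [|_ ->//] := @scales_mulmx d A; last by rewrite dA mul1e.
by rewrite -normr_eq0 dA oner_eq0.
Qed.

Lemma ge0_integral_translation d (v : 'cV[R]_d) (F : 'cV[R]_d -> \bar R) :
  measurable_fun setT F -> (forall x, 0 <= F x)%E ->
  (\int[lebesgue_cV R d]_x F x = \int[lebesgue_cV R d]_x F (x + v)%R)%E.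
Proof. by move=> mF F0; rewrite (scales_translation v).2// mul1e. Qed.

End linear_maps.

Section product_density.
Context (R : realType).
Notation mu1 := (@lebesgue_measure R).

Lemma prod_coordS d (k : 'I_d.+1 -> R -> R) (p : R * 'cV[R]_d) :
  \prod_i k i (cons_cV p i ord0) =
  k ord0 p.1 * \prod_i k (lift ord0 i) (p.2 i ord0).
Proof.
rewrite big_ord_recl cons_cV0; congr (_ * _).
by apply: eq_bigr => i _; rewrite cons_cVS.
Qed.

Lemma measurable_prod_coord d (k : 'I_d -> R -> R) :
  (forall i, measurable_fun setT (k i)) ->
  measurable_fun setT (fun x : 'cV[R]_d => \prod_i k i (x i ord0)).
Proof.
move=> mk; apply: measurable_prod => i _.
by apply: (measurableT_comp (mk i)); exact: measurable_mx_coord.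
Qed.

(** Integrability and value share one induction, since Fubini for head times tail uses the
    integrability of the tail product. In dimension 0 the measure is a Dirac mass and the empty
    product is 1. *)
Lemma integral_prod_coord d (k : 'I_d -> R -> R) :
  (forall i, mu1.-integrable setT (EFin \o k i)) ->
  (lebesgue_cV R d).-integrable setT (fun x => (\prod_i k i (x i ord0))%:E) /\
  \int[lebesgue_cV R d]_x (\prod_i k i (x i ord0)) =
  \prod_i \int[mu1]_x k i x.
Proof.
elim: d k => [k _|d IH k ik].
  split.
    apply/integrableP; split.
      by apply/measurable_EFinP/measurable_prod => -[].
    under eq_integral do rewrite big_ord0.
    rewrite integral_dirac//= diracE mem_set//= mul1e normr1 ltry//.
  under eq_Rintegral do rewrite big_ord0.
  by rewrite big_ord0 /Rintegral integral_dirac// diracE mem_set// mul1e.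
have mk i : measurable_fun setT (k i).
  by have /measurable_int/measurable_EFinP := ik i.
have [it et] := IH (fun i => k (lift ord0 i)) (fun i => ik _).
have mP : measurable_fun setT
    (fun y : 'cV[R]_d => \prod_i k (lift ord0 i) (y i ord0)).
  by apply: (@measurable_prod_coord d (fun i => k (lift ord0 i))) => i; exact: mk.
pose K (p : R * 'cV[R]_d) : \bar R :=
  (k ord0 p.1 * \prod_i k (lift ord0 i) (p.2 i ord0))%:E.
have mK : measurable_fun setT K.
  apply/measurable_EFinP/measurable_funM => /=.
    exact: (measurableT_comp (mk ord0)).
  exact: (measurableT_comp mP).
have iK : (mu1 \x lebesgue_cV R d)%E.-integrable setT K.
  apply/integrable12ltyP => //=.
  have /integrableP[_ it'] := it; have /integrableP[_ ih'] := ik ord0.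
  under eq_integral => x _.
    under eq_integral do rewrite normrM EFinM.
    rewrite ge0_integralZl//=; last first.
      exact/measurable_EFinP/measurableT_comp.
    over.
  rewrite ge0_integralZr//=.
  - by rewrite lte_mul_pinfty// ?ge0_fin_numE ?integral_ge0.
  - by apply/measurable_EFinP/measurableT_comp => //; exact: mk.
  - by apply: integral_ge0.
have push : @pushes _ _ (measurableTypeR R * 'cV[R]_d)%type _ _ (@cons_cV R d)
    (mu1 \x lebesgue_cV R d)%E (lebesgue_cV R d.+1).
  split=> [|B mB]; last by [].
  exact: measurable_cons_cV.
have mk' : measurable_fun setT (fun x : 'cV[R]_d.+1 => (\prod_i k i (x i ord0))%:E).
  by apply/measurable_EFinP; apply: (@measurable_prod_coord _ k) => i; exact: mk.
have KE : (fun x : 'cV[R]_d.+1 => (\prod_i k i (x i ord0))%:E) \o @cons_cV R d = K.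
  by apply/funext => p; rewrite /= prod_coordS.
split; first by apply/(integrable_pushes push) => //; rewrite KE.
rewrite /Rintegral (integral_pushes push)//.
under eq_integral do rewrite prod_coordS.
rewrite -integral12_prod_meas1// /fubini_F.
have ftc : (\int[lebesgue_cV R d]_x (\prod_i k (lift ord0 i) (x i ord0))%:E =
   (\prod_i \int[mu1]_x k (lift ord0 i) x)%:E)%E.
  by rewrite -et /Rintegral fineK// integrable_fin_num.
under eq_integral => x _.
  under eq_integral do rewrite EFinM.
  rewrite /= integralZl//= ftc.
  over.
rewrite [RHS]big_ord_recl -[X in _ = X * _]/(\int[mu1]_x k ord0 x).
rewrite (integralZr _ (ik ord0))//=.
by rewrite /Rintegral -[in LHS](fineK (integrable_fin_num _ (ik ord0))).
Qed.

Lemma pdf_integrable disp (T : measurableType disp)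
    (mu : {measure set T -> \bar R}) (f : density mu) :
  mu.-integrable setT (EFin \o f).
Proof.
apply/integrableP; split; first exact/measurable_EFinP/measurable_pdf.
under eq_integral do rewrite /= ger0_norm ?pdf_ge0//.
by rewrite integral_pdf ltry.
Qed.

Definition prod_density d (g : 'I_d -> density mu1) : density (lebesgue_cV R d).
Proof.
refine (@Density _ _ R (lebesgue_cV R d) (fun x => \prod_i g i (x i ord0)) _ _ _).
- by apply: (@measurable_prod_coord d (fun i => g i)) => i; exact: (measurable_pdf (g i)).
- by move=> x; apply: prodr_ge0 => i _; exact: pdf_ge0.
- have [h1 h2] := integral_prod_coord (fun i => pdf_integrable (g i)).
  rewrite -[LHS](fineK (integrable_fin_num _ h1))//; congr EFin.
  rewrite -/(Rintegral _ _ _) h2 big1// => i _.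
  by rewrite /Rintegral integral_pdf.
Defined.

End product_density.

(** * Laws with independent components *)

Section product_laws.
Context (R : realType).
Notation mu1 := (@lebesgue_measure R).
Local Open Scope ereal_scope.

Lemma measurable_pdf1 (g : density mu1) : measurable_fun setT (g : R -> R).
Proof. exact: (measurable_pdf g). Qed.

Lemma pushes_ge0 d1 d2 (X : measurableType d1) (Y : measurableType d2)
    (phi : X -> Y) (Q : {measure set X -> \bar R}) (P : {measure set Y -> \bar R}) :
  measurable_fun setT phi ->
  (forall F : Y -> \bar R, measurable_fun setT F -> (forall y, 0 <= F y) ->
    \int[P]_y F y = \int[Q]_x F (phi x)) -> pushes phi Q P.
Proof.
move=> mphi h; split=> // B mB.
have := h (EFin \o \1_B); rewrite integral_indic// setIT => ->.
- rewrite (_ : (fun x => _) = EFin \o \1_(phi @^-1` B)).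
    by rewrite integral_indic ?setIT// -[X in measurable X]setTI; exact: mphi.
  by apply/funext => x; rewrite /= !indicE.
- exact/measurable_EFinP.
- by move=> y; rewrite lee_fin.
Qed.

Lemma prod_density_cons d (g : 'I_d.+1 -> density mu1) (p : R * 'cV[R]_d) :
  prod_density g (cons_cV p) =
  (g ord0 p.1 * prod_density (fun i => g (lift ord0 i)) p.2)%R.
Proof. exact: (@prod_coordS R d (fun i => g i)). Qed.

Definition map_cV d (r : 'I_d -> R -> R) (w : 'cV[R]_d) : 'cV[R]_d :=
  \col_i r i (w i ord0).

Lemma measurable_map_cV d (r : 'I_d -> R -> R) :
  (forall i, measurable_fun setT (r i)) -> measurable_fun setT (map_cV r).
Proof.
move=> mr; apply: measurable_fun_mxP => i j.
under eq_fun do rewrite mxE.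
by apply: (measurableT_comp (mr i)); exact: measurable_mx_coord.
Qed.

Lemma map_cV_cons d (r : 'I_d.+1 -> R -> R) (p : R * 'cV[R]_d) :
  map_cV r (cons_cV p) =
  cons_cV (r ord0 p.1, map_cV (fun i => r (lift ord0 i)) p.2).
Proof.
apply/matrixP => i j; rewrite !ord1 mxE.
by case: (unliftP ord0 i) => [k|] ->; rewrite ?cons_cV0// !cons_cVS mxE.
Qed.

(** Induction on d: the head is transported and integrated out with the tail frozen, and the
    induction hypothesis is applied to the function [H] of the tail that remains. *)
Lemma pushes_map_cV d (g q : 'I_d -> density mu1) (r : 'I_d -> R -> R) :
  (forall i, @pushes _ _ (measurableTypeR R) (measurableTypeR R) R (r i)
    (law (g i)) (law (q i))) ->
  pushes (map_cV r) (law (prod_density g)) (law (prod_density q)).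
Proof.
move=> rgq; have mr i : measurable_fun setT (r i) by exact: (rgq i).1.
apply: pushes_ge0; first exact: measurable_map_cV.
elim: d g q r rgq mr => [|d IH] g q r rgq mr F mF F0.
  rewrite [LHS]integral_law// [RHS]integral_law; last first.
    exact: (measurableT_comp mF (measurable_map_cV mr)).
  apply: eq_integral => x _; rewrite /= !big_ord0.
  by congr (F _ * _); apply/matrixP => -[].
have mFr : measurable_fun setT (fun x => F (map_cV r x)).
  exact: (measurableT_comp mF (measurable_map_cV mr)).
rewrite [LHS]ge0_integral_law// [RHS]ge0_integral_law//.
have mFq : measurable_fun setT (fun x => F x * (prod_density q x)%:E).
  by apply: emeasurable_funM => //; exact/measurable_EFinP/measurable_pdf.
have mFg : measurable_fun setT (fun x => F (map_cV r x) * (prod_density g x)%:E).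
  by apply: emeasurable_funM => //; exact/measurable_EFinP/measurable_pdf.
rewrite [LHS](ge0_integral_lebesgue_cVS mFq); last first.
  by move=> x; rewrite mule_ge0// lee_fin pdf_ge0.
rewrite [RHS](ge0_integral_lebesgue_cVS mFg); last first.
  by move=> x; rewrite mule_ge0// lee_fin pdf_ge0.
have mc := @measurable_cons_cV R d.
have mFc : measurable_fun setT (F \o @cons_cV R d) by exact: (measurableT_comp mF).
pose g' i := g (lift ord0 i); pose q' i := q (lift ord0 i).
pose H (y : 'cV[R]_d) := \int[law (g ord0)]_x F (cons_cV (r ord0 x, y)).
have mH : measurable_fun setT H.
  apply: (@measurable_fun_fubini_tonelli_G _ _ _ _ _ (law (g ord0))
    (fun p => F (cons_cV (r ord0 p.1, p.2)))) => //.
  apply: (measurableT_comp mFc); apply: measurable_fun_pair => //.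
  exact: (measurableT_comp (mr ord0)).
have H0 y : 0 <= H y by exact: integral_ge0.
transitivity (\int[law (prod_density q')]_y H y).
  rewrite ge0_integral_law//; apply: eq_integral => y _.
  have mFy : measurable_fun setT (fun x : R => F (cons_cV (x, y))).
    by apply: (measurableT_comp mFc); exact: measurable_fun_pair.
  rewrite /H -(ge0_integral_pushes (rgq ord0) (F := fun x => F (cons_cV (x, y))))//.
  rewrite ge0_integral_law// -ge0_integralZr//.
  - by apply: eq_integral => x _; rewrite prod_density_cons/= EFinM muleA.
  - apply: emeasurable_funM => //.
    by apply/measurable_EFinP; exact: (measurable_pdf (q ord0)).
  - by move=> x _; rewrite mule_ge0// lee_fin pdf_ge0.
  - by rewrite lee_fin pdf_ge0.
rewrite (IH g' q' (fun i => r (lift ord0 i)))// ge0_integral_law//; last first.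
  apply: (measurableT_comp mH); apply: measurable_map_cV => i; exact: mr.
apply: eq_integral => y _.
have mFy : measurable_fun setT (fun x : R => F (cons_cV (r ord0 x, map_cV (fun i => r (lift ord0 i)) y))).
  by apply: (measurableT_comp mFc); apply: measurable_fun_pair => //; exact: mr.
rewrite /H ge0_integral_law// -ge0_integralZr//.
- by apply: eq_integral => x _; rewrite prod_density_cons/= EFinM muleA map_cV_cons.
- apply: emeasurable_funM => //.
  by apply/measurable_EFinP; exact: (measurable_pdf (g ord0)).
- by move=> x _; rewrite mule_ge0// lee_fin pdf_ge0.
- by rewrite lee_fin pdf_ge0.
Qed.

Lemma prod_density_mean2 d (g : 'I_d -> density mu1) (c : 'I_d -> R -> R) :
  (forall i, (law (g i)).-integrable setT (EFin \o c i)) ->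
  (law (prod_density g)).-integrable setT (fun w => (\prod_i c i (w i ord0))%:E) /\
  (\int[law (prod_density g)]_w (\prod_i c i (w i ord0)) =
   \prod_i \int[law (g i)]_x c i x)%R.
Proof.
move=> ic; have mc i : measurable_fun setT (c i).
  by have /measurable_int/measurable_EFinP := ic i.
have mpc : measurable_fun setT (fun w : 'cV[R]_d => \prod_i c i (w i ord0))%R.
  by apply: (@measurable_prod_coord _ _ c) => i; exact: mc.
have icg i : mu1.-integrable setT (EFin \o (fun x => c i x * g i x)%R).
  by have /integrable_law := ic i; apply; apply/measurable_EFinP; exact: mc.
have [h1 h2] := integral_prod_coord icg.
have E (w : 'cV[R]_d) : ((\prod_i c i (w i ord0)) * prod_density g w =
    \prod_i (c i (w i ord0) * g i (w i ord0)))%R by rewrite big_split.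
split.
  apply/integrable_law; first exact/measurable_EFinP.
  by under eq_fun do rewrite -EFinM E.
rewrite Rintegral_law//; under eq_Rintegral do rewrite E.
rewrite h2; apply: eq_bigr => i _; rewrite Rintegral_law//; exact: mc.
Qed.

Let law_setT1 (g : density mu1) (r : R) : (r * fine (law g setT) = r)%R.
Proof. by rewrite [law g setT]integral_pdf mulr1. Qed.

Lemma pushes_coord d (g : 'I_d -> density mu1) j :
  @pushes _ _ _ (measurableTypeR R) R (fun w : 'cV[R]_d => w j ord0)
    (law (prod_density g)) (law (g j)).
Proof.
split; first exact: measurable_mx_coord.
move=> B mB; set C := _ @^-1` B.
have mC : measurable C.
  by rewrite -[X in measurable X]setTI; apply: measurable_mx_coord.
(* The product of these factors is the indicator of the cylinder over [B], so independence reduces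
   its mass to that of [B]. *)
pose c i : R -> R := if i == j then \1_B else cst 1%R.
have ic i : (law (g i)).-integrable setT (EFin \o c i).
  rewrite /c; case: eqVneq => [->|_]; first exact: integrable_indic.
  exact: finite_measure_integrable_cst.
have [h1 h2] := prod_density_mean2 ic.
have E (w : 'cV[R]_d) : (\prod_i c i (w i ord0) = \1_C w)%R.
  rewrite (bigD1 j)//= /c eqxx big1 ?mulr1; last by move=> i /negPf ->.
  by rewrite !indicE.
have e1 : (\prod_i \int[law (g i)]_x c i x = \int[law (g j)]_x \1_B x)%R.
  rewrite (bigD1 j)//= /c eqxx big1 ?mulr1// => i /negPf ->.
  by rewrite Rintegral_cst// law_setT1.
move: h2; rewrite e1; under eq_Rintegral do rewrite E.
rewrite /Rintegral !integral_indic// !setIT => h2.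
by rewrite -[LHS]fineK ?fin_num_measure// -h2 fineK ?fin_num_measure.
Qed.

Lemma prod_density_mean_pair d (g : 'I_d -> density mu1) i j (a b : R -> R) :
  i != j -> (law (g i)).-integrable setT (EFin \o a) ->
  (law (g j)).-integrable setT (EFin \o b) ->
  (law (prod_density g)).-integrable setT (fun w => (a (w i ord0) * b (w j ord0))%:E) /\
  (\int[law (prod_density g)]_w (a (w i ord0) * b (w j ord0)) =
   (\int[law (g i)]_x a x) * (\int[law (g j)]_x b x))%R.
Proof.
move=> ij ia ib.
pose c k : R -> R := if k == i then a else if k == j then b else cst 1%R.
have ic k : (law (g k)).-integrable setT (EFin \o c k).
  rewrite /c; case: eqVneq => [->//|_]; case: eqVneq => [->//|_].
  exact: finite_measure_integrable_cst.
have [h1 h2] := prod_density_mean2 ic.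
have ji : (j == i) = false by rewrite eq_sym (negPf ij).
have E (w : 'cV[R]_d) : (\prod_k c k (w k ord0) = a (w i ord0) * b (w j ord0))%R.
  rewrite (bigD1 i)//= (bigD1 j) ?ji//= /c eqxx ji eqxx big1 ?mulr1//.
  by move=> k /andP[/negPf -> /negPf ->].
split.
  by apply: eq_integrable h1 => // w _; rewrite E.
move: h2; under eq_Rintegral do rewrite E; move=> ->.
rewrite (bigD1 i)//= (bigD1 j) ?ji//= /c eqxx ji eqxx big1 ?mulr1//.
by move=> k /andP[/negPf -> /negPf ->]; rewrite Rintegral_cst// law_setT1.
Qed.

(** [A] preserves Lebesgue measure, and [A^T *m A = 1%:M] undoes the rotation inside the density.
    After this conversion the model enters only as the law of A W. *)
Lemma bss_law d (f : density (lebesgue_cV R d)) (A : 'M[R]_d)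
    (g : 'I_d -> density mu1) : orthogonal_mx A -> f =1 bss_pdf A g ->
  pushes (mulmx A) (law (prod_density g)) (law f).
Proof.
move=> oA fE; apply: pushes_ge0; first exact: measurable_mulmx.
move=> F mF F0; have mA := @measurable_mulmx R _ _ A.
rewrite !ge0_integral_law//; last exact: (measurableT_comp mF mA).
rewrite (ge0_integral_orthogonal oA); last 2 first.
- by apply: emeasurable_funM => //; exact/measurable_EFinP/measurable_pdf.
- by move=> x; rewrite mule_ge0// lee_fin pdf_ge0.
apply: eq_integral => x _; congr (_ * _%:E); rewrite fE.
apply: eq_bigr => i _; congr (g i _).
rewrite -[in RHS](mul1mx x) -oA -mulmxA [RHS]mxE.
by apply: eq_bigr => j _; congr (_ * _)%R; rewrite mxE.
Qed.

Lemma bss_coord d (f : density (lebesgue_cV R d)) (A : 'M[R]_d)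
    (g : 'I_d -> density mu1) j : orthogonal_mx A ->
  pushes (mulmx A) (law (prod_density g)) (law f) ->
  @pushes _ _ _ (measurableTypeR R) R (fun x => (A^T *m x) j ord0)
    (law f) (law (g j)).
Proof.
move=> oA fP; have mA := @measurable_mulmx R _ _ A^T.
have mAj := measurable_coord j mA.
apply: pushes_ge0 => // F mF F0.
have mFA : measurable_fun setT (fun x : 'cV[R]_d => F ((A^T *m x) j ord0)).
  exact: (measurableT_comp mF mAj).
rewrite (ge0_integral_pushes fP)// (ge0_integral_pushes (pushes_coord g j))//.
by apply: eq_integral => x _; rewrite mulmxA oA mul1mx.
Qed.

End product_laws.

(** * Convex potentials and uniqueness of the rank map *)

Section gradients.
Context (R : realType) (d : nat).
Implicit Types (phi : 'cV[R]_d -> \bar R) (x y g v : 'cV[R]_d).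

Lemma dotvDr u v w : dotv u (v + w) = dotv u v + dotv u w :> R.
Proof. by rewrite /dotv mulmxDr mxE. Qed.

Lemma dotvC u v : dotv u v = dotv v u :> R.
Proof. by rewrite !dotvE; apply: eq_bigr => i _; rewrite mulrC. Qed.

Lemma dotvNr u v : dotv u (- v) = - dotv u v :> R.
Proof. by rewrite /dotv mulmxN mxE. Qed.

Lemma dotvBr u v w : dotv u (v - w) = dotv u v - dotv u w :> R.
Proof. by rewrite dotvDr dotvNr. Qed.

Lemma dotvBl u v w : dotv (v - w) u = dotv v u - dotv w u :> R.
Proof. by rewrite ![dotv _ u]dotvC dotvBr. Qed.

Lemma dotvZr (a : R) u v : dotv u (a *: v) = a * dotv u v :> R.
Proof. by rewrite /dotv -scalemxAr mxE. Qed.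

Lemma dotvZl (a : R) u v : dotv (a *: u) v = a * dotv u v :> R.
Proof. by rewrite ![dotv _ v]dotvC dotvZr. Qed.

Lemma sqnorm_ge0 v : 0 <= sqnorm v :> R.
Proof. by rewrite /sqnorm dotvE sumr_ge0// => i _; rewrite -expr2 sqr_ge0. Qed.

Lemma sqnorm_eq0 v : sqnorm v <= 0 -> v = 0 :> 'cV[R]_d.
Proof.
move=> v0; apply/matrixP => i j; rewrite ord1 mxE.
have : \sum_k v k ord0 ^+ 2 == 0.
  by rewrite eq_le sumr_ge0 ?andbT => [|k _]; rewrite ?sqr_ge0//;
     move: v0; rewrite /sqnorm dotvE.
rewrite psumr_eq0 => [|k _]; last by rewrite sqr_ge0.
by move=> /allP/(_ i (mem_index_enum _)); rewrite sqrf_eq0 => /eqP.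
Qed.

Lemma normr_dotv_le u v : `|dotv u v| <= sqnorm u + sqnorm v :> R.
Proof.
have h w : 0 <= sqnorm (u + w) -> 0 <= sqnorm u + 2 * dotv u w + sqnorm w :> R.
  by rewrite /sqnorm dotvDr ![dotv (u + w) _]dotvC !dotvDr [dotv w u]dotvC; lra.
have := h v (sqnorm_ge0 _); have := h (- v) (sqnorm_ge0 _).
have -> : sqnorm (- v) = sqnorm v :> R.
  by rewrite /sqnorm dotvNr dotvC dotvNr opprK.
have := sqnorm_ge0 u; have := sqnorm_ge0 v.
rewrite dotvNr ler_norml; lra.
Qed.

Lemma gradient_cvg phi x g v : is_gradient phi x g ->
  s^-1 * (fine (phi (s *: v + x)) - fine (phi x)) @[s --> (0 : R)^'+] --> dotv g v.
Proof.
move=> [_ dphi dE]; apply: cvg_dnbhs_at_right; rewrite -dE -deriveE//.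
exact: diff_derivable.
Qed.

Lemma near_line phi x v : (\forall y \near x, phi y \is a fin_num) ->
  \forall s \near (0 : R)^'+, phi (s *: v + x) \is a fin_num.
Proof.
move=> h; suff : (s *: v + x) @[s --> (0:R)^'+] --> x by move=> /(_ _ h).
have -> : nbhs x = nbhs (0 *: v + x) by rewrite scale0r add0r.
apply: cvg_at_right_filter; apply: cvgD; last exact: cvg_cst.
by apply: cvgZr_tmp; exact: cvg_id.
Qed.

(** On the segment from [x] to [y] convexity bounds every difference quotient by the increment of
    [phi]; as the step tends to 0+ the quotient becomes [dotv g (y - x)]. *)
Lemma gradient_subgradient phi x g y : econvex phi -> is_gradient phi x g ->
  phi y \is a fin_num -> fine (phi x) + dotv g (y - x) <= fine (phi y).
Proof.
move=> [_ cvx] gx fy; have [nx _ _] := gx.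
have fx : phi x \is a fin_num by exact: nbhs_singleton nx.
rewrite -lerBrDl; apply: (cvgr_to_le (gradient_cvg (v := y - x) gx)).
near=> s.
have s0 : 0 < s by near: s; exact: nbhs_right_gt.
have s1 : s <= 1 by near: s; exact: nbhs_right_le.
have fs : phi (s *: (y - x) + x) \is a fin_num by near: s; exact: near_line.
rewrite mulrC ler_pdivrMr// lerBlDr.
have : (0 <= s <= 1) by rewrite s1 ltW.
move=> /(cvx y x).
have -> : s *: y + (1 - s) *: x = s *: (y - x) + x.
  by rewrite scalerBr scalerBl scale1r addrA addrAC.
rewrite -(fineK fs) -(fineK fx) -(fineK fy) -!EFinM -EFinD lee_fin.
by move=> /le_trans; apply; lra.
Unshelve. all: by end_near. Qed.

(** Interior points of the domain suffice as tests: small steps from [x] in any direction [v] stay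
    among them, which gives [dotv g' v <= dotv g v], and [v = g' - g] concludes. *)
Lemma subgradient_gradient phi x g g' : is_gradient phi x g ->
  (forall y, (\forall z \near y, phi z \is a fin_num) ->
     fine (phi x) + dotv g' (y - x) <= fine (phi y)) -> g' = g.
Proof.
move=> gx sub; have [nx _ _] := gx.
have le v : dotv g' v <= dotv g v.
  apply: (cvgr_to_ge (gradient_cvg (v := v) gx)).
  have : nbhs x [set y | phi y \is a fin_num] by exact: nx.
  rewrite nbhsE => -[U [oU Ux] UF].
  have nU : \forall s \near (0 : R)^'+, U (s *: v + x).
    have : (s *: v + x) @[s --> (0:R)^'+] --> x.
      have -> : nbhs x = nbhs (0 *: v + x) by rewrite scale0r add0r.
      apply: cvg_at_right_filter; apply: cvgD; last exact: cvg_cst.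
      by apply: cvgZr_tmp; exact: cvg_id.
    by apply; apply: open_nbhs_nbhs.
  near=> s.
  have s0 : 0 < s by near: s; exact: nbhs_right_gt.
  have Us : U (s *: v + x) by near: s.
  rewrite mulrC ler_pdivlMr// lerBrDl.
  have := sub (s *: v + x); rewrite addrK dotvZr mulrC; apply.
  by apply: filterS UF _; apply: open_nbhs_nbhs.
have := le (g' - g); rewrite -subr_le0 -dotvBl => /sqnorm_eq0/eqP.
by rewrite subr_eq0 => /eqP.
Unshelve. all: by end_near. Qed.

End gradients.

Section conjugate.
Context (R : realType) (d : nat).
Variables (phi : 'cV[R]_d -> \bar R).
Hypothesis cphi : econvex phi.

Definition fin_interior : set 'cV[R]_d :=
  [set x | \forall y \near x, phi y \is a fin_num].

Lemma fin_interior_fin_num x : fin_interior x -> phi x \is a fin_num.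
Proof. exact: nbhs_singleton. Qed.

(* A sequence in the finite domain of phi along which the graph of phi is dense;
   it makes the conjugate a countable supremum, hence measurable. *)
Lemma dense_graph x0 : fin_interior x0 -> exists u : nat -> 'cV[R]_d,
  (forall k, fin_interior (u k)) /\
  forall x, fin_interior x -> forall e, 0 < e -> exists k,
    (forall i, `|u k i ord0 - x i ord0| < e) /\
    `|fine (phi (u k)) - fine (phi x)| < e.
Proof.
move=> Ox0.
(* A box is a rational centre, a rational height and a radius 1/(n+1); one point is kept from each
   nonempty box. Recording heights along with points replaces an appeal to the continuity of
   [phi]. *)
pose good (c : 'cV[rat]_d * rat * nat) := [set x | [/\ fin_interior x,
  forall i, `|x i ord0 - ratr (c.1.1 i ord0)| < c.2.+1%:R^-1 &
  `|fine (phi x) - ratr c.1.2| < c.2.+1%:R^-1]].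
pose sel c := if pselect (good c !=set0) is left _ then xget x0 (good c) else x0.
exists (fun k => if unpickle k is Some c then sel c else x0); split.
  move=> k; case: unpickle => [c|//]; rewrite /sel; case: pselect => // -[y gy].
  by case: xgetP => [z _ []//|/(_ y)].
move=> x Ox e e0.
have [n ne] : exists n : nat, n.+1%:R^-1 < e / 2.
  have e20 : 0 < e / 2 by rewrite divr_gt0.
  near \oo => n; exists n; near: n.
  exact: (near_infty_natSinv_lt (PosNum e20)).
have app (r : R) : exists q : rat, `|r - ratr q| < n.+1%:R^-1.
  have [q] := @rat_in_itvoo R (r - n.+1%:R^-1) (r + n.+1%:R^-1) ltac:(by rewrite ltrD2l gtrN).
  by rewrite in_itv/= => /andP[q1 q2]; exists q; rewrite ltr_norml; apply/andP; split;
    move: q1 q2; move: (n.+1%:R^-1) (ratr q) => w z; lra.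
have [p pE] := choice (fun i => app (x i ord0)).
have [r rE] := app (fine (phi x)).
pose c := (\col_i p i, r, n).
have gx : good c x by split=> //= i; rewrite mxE.
exists (pickle c); rewrite pickleK /sel; case: pselect => [_|[]]; last by exists x.
case: xgetP => [z _ [_ z1 z2]|/(_ x)//]; split=> [i|].
- have := z1 i; have := pE i; rewrite /= mxE distrC => h1 h2.
  rewrite (le_lt_trans (ler_distD (ratr (p i)) _ _))// [e]splitr.
  by apply: ltrD; [exact: lt_trans h2 ne|exact: lt_trans h1 ne].
- move: rE z2; rewrite /= distrC => h1 h2.
  rewrite (le_lt_trans (ler_distD (ratr r) _ _))// [e]splitr.
  by apply: ltrD; [exact: lt_trans h2 ne|exact: lt_trans h1 ne].
Unshelve. all: by end_near. Qed.

(** [theta] is the Legendre conjugate of [phi]. Beyond measurability, the clauses are the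
    Fenchel-Young inequality, its equality at a gradient, and the converse: equality makes [y] a
    subgradient at [x], hence the gradient. *)
Lemma conjugate_exists x0 : fin_interior x0 -> exists theta : 'cV[R]_d -> \bar R,
  [/\ measurable_fun setT theta,
      forall x y, fin_interior x -> ((dotv x y - fine (phi x))%:E <= theta y)%E,
      forall x g, is_gradient phi x g -> theta g = (dotv x g - fine (phi x))%:E &
      forall x g y, is_gradient phi x g ->
        (theta y <= (dotv x y - fine (phi x))%:E)%E -> y = g].
Proof.
move=> Ox0; have [u [Ou du]] := dense_graph Ox0.
pose theta y := esups (fun k => (dotv (u k) y - fine (phi (u k)))%:E) 0%N.
have ub k y : ((dotv (u k) y - fine (phi (u k)))%:E <= theta y)%E.
  by apply: ereal_sup_ubound; exists k.
have lb x y : fin_interior x -> ((dotv x y - fine (phi x))%:E <= theta y)%E.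
  move=> Ox; apply/lee_addgt0Pr => e e0.
  (* Points and values of the graph are approximated within [e / S]: the 1 pays for the value and
     the sum for the inner product with [y], so the total error is at most [e]. *)
  pose S := 1 + \sum_i `|y i ord0|.
  have S0 : 0 < S by rewrite ltr_pwDl// sumr_ge0.
  have [k [k1 k2]] := du x Ox (e / S) (divr_gt0 e0 S0).
  apply: (@le_trans _ _ ((dotv (u k) y - fine (phi (u k)))%:E + e%:E)%E); last first.
    by rewrite leeD2r.
  rewrite -EFinD lee_fin -lerBlDl.
  have -> : dotv x y - fine (phi x) - (dotv (u k) y - fine (phi (u k))) =
    (fine (phi (u k)) - fine (phi x)) + (- \sum_i (u k i ord0 - x i ord0) * y i ord0).
    under [X in _ = _ + - X]eq_bigr do rewrite mulrBl.
    by rewrite sumrB -!dotvE; ring.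
  have -> : e = e / S * 1 + \sum_i e / S * `|y i ord0|.
    by rewrite -mulr_sumr -mulrDr divfK// gt_eqF.
  rewrite mulr1; apply: lerD; first exact: le_trans (ler_norm _) (ltW k2).
  rewrite -sumrN ler_sum// => i _; rewrite -mulNr.
  by rewrite (le_trans (ler_norm _))// normrM normrN ler_wpM2r// ltW.
have gr x g : is_gradient phi x g -> theta g = (dotv x g - fine (phi x))%:E.
  move=> gx; apply/eqP; rewrite eq_le lb ?andbT; last by case: gx.
  apply: ge_ereal_sup => _ [k _ <-]; rewrite lee_fin.
  have := gradient_subgradient cphi gx (fin_interior_fin_num (Ou k)).
  rewrite dotvBr ![dotv g _]dotvC; lra.
exists theta; split=> //.
- apply: measurable_fun_esups => k.
  apply/measurable_EFinP/measurable_funB => //; exact: measurable_dotv.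
- move=> x g y gx tx; apply: (subgradient_gradient gx) => z Oz.
  have := le_trans (lb z y Oz) tx; rewrite lee_fin dotvBr ![dotv y _]dotvC; lra.
Qed.

End conjugate.

Lemma ae_le_integrable disp (T : measurableType disp) (R : realType)
    (P : {measure set T -> \bar R}) (f g : T -> \bar R) :
  measurable_fun setT f -> P.-integrable setT g ->
  {ae P, forall x, (`|f x| <= `|g x|)%E} -> P.-integrable setT f.
Proof.
move=> mf /integrableP[mg ig] fg; apply/integrableP; split=> //.
apply: le_lt_trans ig; apply: ae_ge0_le_integral => //.
- exact: measurableT_comp.
- exact: measurableT_comp.
- by apply: filterS fg.
Qed.

Section uniqueness.
Context (R : realType) (d : nat).
Variables (P nu : probability 'cV[R]_d R).
Hypothesis iP : P.-integrable setT (fun x => (sqnorm x)%:E).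
Hypothesis inu : nu.-integrable setT (fun x => (sqnorm x)%:E).

Lemma measurable_sqnorm disp (T : measurableType disp) (f : T -> 'cV[R]_d) :
  measurable_fun setT f -> measurable_fun setT (fun x => sqnorm (f x)).
Proof. by move=> mf; exact: measurable_dotv. Qed.

Lemma integrable_dotv disp (T : measurableType disp) (Q : probability T R)
    (f g : T -> 'cV[R]_d) :
  measurable_fun setT f -> measurable_fun setT g ->
  Q.-integrable setT (fun x => (sqnorm (f x))%:E) ->
  Q.-integrable setT (fun x => (sqnorm (g x))%:E) ->
  Q.-integrable setT (fun x => (dotv (f x) (g x))%:E).
Proof.
move=> mf mg if_ ig; apply: (le_integrable _ _ _ (integrableD _ if_ ig)) => //.
  exact/measurable_EFinP/measurable_dotv.
move=> x _ /=; rewrite lee_fin (le_trans (normr_dotv_le _ _))//.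
by rewrite ler_norm.
Qed.

Lemma rank_map_pushes T : is_rank_map P nu T -> pushes T P nu.
Proof. by case=> mT PT _; split=> // B mB; exact/esym/PT. Qed.

Lemma rank_map_sq T : pushes T P nu ->
  P.-integrable setT (fun x => (sqnorm (T x))%:E).
Proof.
move=> PT; have mF : measurable_fun setT (fun y : 'cV[R]_d => (sqnorm y)%:E).
  exact/measurable_EFinP/measurable_sqnorm.
exact: ((integrable_pushes PT mF).1 inu).
Qed.

(** Only [T] has to be a gradient: it maximizes the correlation with [x] among the maps with the
    same image law, and a map attaining the maximum agrees with it a.e. Between two gradients,
    optimality of each gives the equality of correlations. *)
Lemma rank_map_optimal T S : is_rank_map P nu T -> pushes S P nu ->
  \int[P]_x dotv x (S x) <= \int[P]_x dotv x (T x) /\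
  (\int[P]_x dotv x (T x) <= \int[P]_x dotv x (S x) ->
    {ae P, forall x, S x = T x}).
Proof.
move=> rT PS; have PT := rank_map_pushes rT.
have [mT mS] := (PT.1, PS.1); have [_ _ [phi cphi aeT]] := rT.
have [x0 gx0] : exists x0, is_gradient phi x0 (T x0).
  apply: contrapT => no; have : {ae P, forall x : 'cV[R]_d, False}.
    by apply: filterS aeT => x gx; apply: no; exists x.
  case=> N [mN PN0 sub]; have NT : N = setT.
    by apply/seteqP; split=> // x _; exact: sub.
  by move: PN0; rewrite NT probability_setT => /eqP; rewrite eqe oner_eq0.
have [theta [mth lb gr eqg]] := conjugate_exists cphi (x0 := x0) (let: And3 h _ _ := gx0 in h).
have iT := rank_map_sq PT; have iS := rank_map_sq PS.
have ixT : P.-integrable setT (fun x => (dotv x (T x))%:E) by exact: integrable_dotv.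
have ixS : P.-integrable setT (fun x => (dotv x (S x))%:E) by exact: integrable_dotv.
(* [theta (T x) = x . T x - phi x] is squeezed: Fenchel-Young at the fixed point [x0] bounds it
   below by [x0 . T x - phi x0], and the gradient inequality at [x0] bounds it above by
   [x . T x - T x0 . x - K]. *)
have ithT : P.-integrable setT (theta \o T).
  have icst (v : 'cV[R]_d) (Q : probability 'cV[R]_d R) :
    Q.-integrable setT (fun=> (sqnorm v)%:E) by exact: finite_measure_integrable_cst.
  pose K := fine (phi x0) - dotv (T x0) x0.
  pose b1 x := `|dotv x (T x)|; pose b2 x := `|dotv (T x0) x|.
  pose b3 x := `|dotv x0 (T x)|.
  apply: (@ae_le_integrable _ _ _ _ _ (fun x => (b1 x + b2 x + (b3 x + (`|K| + `|fine (phi x0)|)))%:E)).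
  - exact: (measurableT_comp mth).
  - have i1 : P.-integrable setT (fun x => (b1 x)%:E).
      by apply: (@integrable_norm _ _ _ P setT (fun x => dotv x (T x))).
    have i2 : P.-integrable setT (fun x => (b2 x)%:E).
      by apply: (@integrable_norm _ _ _ P setT (dotv (T x0))); exact: integrable_dotv.
    have i3 : P.-integrable setT (fun x => (b3 x)%:E).
      by apply: (@integrable_norm _ _ _ P setT (fun x => dotv x0 (T x))); exact: integrable_dotv.
    under eq_fun do rewrite !EFinD.
    apply: integrableD => //; apply: integrableD => //.
    apply: integrableD => //; exact: finite_measure_integrable_cst.
  apply: filterS aeT => x gx.
  have Ox : fin_interior phi x by case: gx.
  have Ox0 : fin_interior phi x0 by case: gx0.
  have := gradient_subgradient cphi gx0 (fin_interior_fin_num Ox).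
  have := lb x0 (T x) Ox0.
  rewrite /= (gr _ _ gx) !lee_fin dotvBr => h1 h2.
  have := ler_norm (dotv x (T x)); have := ler_norm (- dotv (T x0) x).
  have := ler_norm (- dotv x0 (T x)); have := ler_norm (fine (phi x0)).
  have := ler_norm (- K); rewrite !normrN /b1 /b2 /b3 => h3 h4 h5 h6 h7.
  rewrite [leRHS]ger0_norm; last by rewrite !addr_ge0.
  rewrite ler_norml; rewrite {1}/K in h3.
  move: (normr_ge0 (dotv x (T x))) (normr_ge0 (dotv (T x0) x)) (normr_ge0 (dotv x0 (T x))) (normr_ge0 K) (normr_ge0 (fine (phi x0))).
  lra.
(* Integrability passes from [T] to [S] through the common image law [nu], and the two means of
   [theta] coincide. *)
have ith : nu.-integrable setT theta by exact/(integrable_pushes PT).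
have ithS : P.-integrable setT (theta \o S) by exact/(integrable_pushes PS).
have Eth : (\int[P]_x (theta (S x)) = \int[P]_x (theta (T x)))%E.
  by rewrite -(integral_pushes PS)// -(integral_pushes PT).
(* The Fenchel-Young gap of [S] minus that of [T], which is 0 a.e. It is kept in the extended reals,
   because [theta (S x)] may be [+oo]. *)
pose D x := ((theta (S x) - (dotv x (S x))%:E) - (theta (T x) - (dotv x (T x))%:E))%E.
have iD : P.-integrable setT D.
  by apply: integrableB => //; apply: integrableB.
have D0 : {ae P, forall x, (0 <= D x)%E}.
  apply: filterS aeT => x gx; rewrite /D (gr _ _ gx).
  move: (lb x (S x)) => /(_ ltac:(by case: gx)).
  case: (theta (S x)) => [r| |] //=.
    by rewrite -!EFinB !lee_fin; lra.
  by rewrite !addye ?leey.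
have [fT fS fth] : [/\ (\int[P]_x (dotv x (T x))%:E)%E \is a fin_num,
    (\int[P]_x (dotv x (S x))%:E)%E \is a fin_num &
    (\int[P]_x theta (T x))%E \is a fin_num].
  by split; exact: integrable_fin_num.
have ED : (\int[P]_x D x = (\int[P]_x dotv x (T x) - \int[P]_x dotv x (S x))%:E)%E.
  rewrite integralB//; [|exact: integrableB..].
  rewrite !integralB// Eth /Rintegral.
  rewrite -(fineK fT) -(fineK fS) -(fineK fth) /= -!EFinB; congr EFin; lra.
have mD : measurable_fun setT D by exact: measurable_int iD.
have absD : (\int[P]_x `|D x| = \int[P]_x D x)%E.
  apply: ae_eq_integral => //; first exact: measurableT_comp.
  by apply: filterS D0 => x D0 _; rewrite gee0_abs.
split.
  by rewrite -subr_ge0 -lee_fin -ED -absD integral_ge0.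
move=> TS; have /ae_eq_integral_abs : (\int[P]_x `|D x| = 0)%E.
  apply/eqP; rewrite eq_le integral_ge0// andbT absD ED lee_fin subr_le0//.
move=> /(_ measurableT mD) D00.
apply: filterS2 aeT D00 => x gx /(_ I) Dx0; apply: (eqg _ _ _ gx).
move: Dx0; rewrite /D (gr _ _ gx).
case: (theta (S x)) => [r| |] //; rewrite -!EFinB => -[h].
rewrite lee_fin; lra.
Qed.

Lemma rank_map_unique T S : is_rank_map P nu T -> is_rank_map P nu S ->
  {ae P, forall x, S x = T x}.
Proof.
move=> rT rS; have [_] := rank_map_optimal rT (rank_map_pushes rS).
by apply; have [] := rank_map_optimal rS (rank_map_pushes rT).
Qed.

End uniqueness.

(** * Differentiating expectations along a shift *)

Section score_identity.
Context (R : realType) (d : nat).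
Notation lebesgue := (lebesgue_cV R d).
Implicit Types (f : density lebesgue) (v t x : 'cV[R]_d).

Lemma pushes_translation v : pushes (fun x => x + v) lebesgue lebesgue.
Proof.
apply: pushes_ge0 => [|F mF F0]; last exact: ge0_integral_translation.
by apply: measurable_addv => //; exact: measurable_id.
Qed.

Lemma sqnorm_gt0 v : v != 0 -> 0 < sqnorm v :> R.
Proof.
by move=> v0; rewrite lt_neqAle sqnorm_ge0 andbT; apply: contra v0 => /eqP e;
  apply/eqP/sqnorm_eq0; rewrite -e.
Qed.

Lemma sqnormB (u v : 'cV[R]_d) :
  sqnorm (u - v) = sqnorm u - 2 * dotv u v + sqnorm v :> R.
Proof. by rewrite /sqnorm dotvBr !dotvBl [dotv v u]dotvC; lra. Qed.

Lemma dotv_sq_le (u v : 'cV[R]_d) : dotv u v ^+ 2 <= sqnorm u * sqnorm v.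
Proof.
have [->|u0] := eqVneq u 0.
  by rewrite /sqnorm /dotv linear0 !mul0mx mxE mul0r expr0n.
have U0 := sqnorm_gt0 u0; set U := sqnorm u in U0 *; set D := dotv _ _.
have := sqnorm_ge0 (v - (D / U) *: u); rewrite sqnormB.
rewrite /(sqnorm (_ *: _)) /sqnorm !dotvZr dotvZl [dotv v u]dotvC -/D -/(sqnorm u) -/U.
have -> : dotv v v - 2 * (D / U * D) + D / U * (D / U * U) = dotv v v - D ^+ 2 / U.
  field; lra.
by rewrite subr_ge0 ler_pdivrMr// mulrC.
Qed.

Lemma sqnormZ (a : R) (u : 'cV[R]_d) : sqnorm (a *: u) = a ^+ 2 * sqnorm u :> R.
Proof. by rewrite /sqnorm dotvZl dotvZr mulrA expr2. Qed.

Lemma bounded_integrable disp (T : measurableType disp) (Q : probability T R)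
    (b : T -> R) (M : R) : measurable_fun setT b -> (forall z, `|b z| <= M) ->
  Q.-integrable setT (EFin \o b).
Proof.
move=> mb bM; apply: (le_integrable _ _ _ (finite_measure_integrable_cst Q `|M| measurableT)) => //.
  exact/measurable_EFinP.
by move=> z _ /=; rewrite lee_fin normr_id (le_trans (bM z))// ler_norm.
Qed.

(* With s = sqrt f, a = sqrt (f(x - v/N)), w = v . score and r the quadratic
   mean remainder: N (a^2 - s^2) - w s^2 = 2 N s r + N (r + w s / (2 N))^2. *)
Lemma qmd_pointwise (a s w N e r : R) : 1 <= N -> 0 < e ->
  r = a - s - 2^-1 * (N^-1 * w) * s ->
  `|N * (a ^+ 2 - s ^+ 2) - w * s ^+ 2| <=
  (2 + e^-1) * (N ^+ 2 * r ^+ 2) + N^-1 * (w ^+ 2 * s ^+ 2) + e * s ^+ 2.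
Proof.
move=> N1 e0 rE; have N0 : 0 < N by exact: lt_le_trans N1.
pose z := 2^-1 * (N^-1 * w) * s.
have aE : a = s + r + z by rewrite rE /z; ring.
have -> : N * (a ^+ 2 - s ^+ 2) - w * s ^+ 2 = 2 * s * (N * r) + N * (r + z) ^+ 2.
  rewrite aE /z; field; lra.
have -> : N^-1 * (w ^+ 2 * s ^+ 2) = 4 * N * z ^+ 2 by rewrite /z; field; lra.
have h1 : `|2 * s * (N * r)| <= e * s ^+ 2 + e^-1 * (N ^+ 2 * r ^+ 2).
  have p (y : R) : 0 <= e * s ^+ 2 + 2 * s * y + e^-1 * y ^+ 2.
    have -> : e * s ^+ 2 + 2 * s * y + e^-1 * y ^+ 2 = e^-1 * (e * s + y) ^+ 2.
      field; lra.
    by rewrite mulr_ge0 ?sqr_ge0// invr_ge0 ltW.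
  have := p (N * r); have := p (- (N * r)); rewrite sqrrN exprMn ler_norml; lra.
have h2 : 0 <= N * (r + z) ^+ 2 by rewrite mulr_ge0 ?sqr_ge0// ltW.
have h3 : N * (r + z) ^+ 2 <= 2 * (N ^+ 2 * r ^+ 2) + 4 * N * z ^+ 2.
  have : 0 <= N * (r - z) ^+ 2 by rewrite mulr_ge0 ?sqr_ge0// ltW.
  have : 0 <= N * (N - 1) * r ^+ 2.
    by rewrite mulr_ge0 ?sqr_ge0// mulr_ge0 ?subr_ge0// ltW.
  have : 0 <= N * z ^+ 2 by rewrite mulr_ge0 ?sqr_ge0// ltW.
  nra.
rewrite (le_trans (ler_normD _ _))// (ger0_norm h2); lra.
Qed.

Variables (f : density lebesgue).
Hypothesis qf : qmd f.
Hypothesis ms : measurable_fun setT (score f 0).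
Hypothesis is_ : (law f).-integrable setT (fun x => (sqnorm (score f 0 x))%:E).

Let w v x := dotv v (score f 0 x).

Let mw v : measurable_fun setT (w v).
Proof. by apply: measurable_dotv. Qed.

Lemma score_sq_integrable v :
  (law f).-integrable setT (fun x => (dotv v (score f 0 x) ^+ 2)%:E).
Proof.
have := integrableZl measurableT (sqnorm v) is_; apply: le_integrable => //.
  by apply/measurable_EFinP; apply: measurable_funX; exact: mw.
move=> x _; rewrite -EFinM !abse_EFin lee_fin ger0_norm ?sqr_ge0//.
rewrite ger0_norm ?mulr_ge0 ?sqnorm_ge0//.
exact: dotv_sq_le.
Qed.

Lemma score_integrable v :
  (law f).-integrable setT (fun x => (dotv v (score f 0 x))%:E).
Proof.
apply: integrable_dotv => //; exact: finite_measure_integrable_cst.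
Qed.

(** Translation invariance moves the shift onto the density. The rescaled increment of the density
    differs from [dotv v (score f 0 x) * f x] by the three terms of [qmd_pointwise]: the quadratic
    mean remainder, a term of order 1/n, and a multiple of [f] as small as desired. *)
Lemma score_identity v (b : 'cV[R]_d -> R) (M : R) : v != 0 ->
  measurable_fun setT b -> (forall x, `|b x| <= M) ->
  n.+1%:R * (\int[law f]_x b (x + n.+1%:R^-1 *: v) - \int[law f]_x b x)
    @[n --> \oo] --> \int[law f]_x (b x * dotv v (score f 0 x)).
Proof.
move=> v0 mb bM; have V0 := sqnorm_gt0 v0.
have M0 : 0 <= M by apply: le_trans (bM 0).
pose t n : 'cV[R]_d := n.+1%:R^-1 *: v.
have mbt n : measurable_fun setT (fun x => b (x + t n)).
  by apply: (measurableT_comp mb); apply: measurable_addv => //; exact: measurable_id.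
have bint : (law f).-integrable setT (EFin \o b) by exact: (bounded_integrable _ mb bM).
have btint n : (law f).-integrable setT (EFin \o (fun x => b (x + t n))).
  exact: (bounded_integrable _ (mbt n) (fun x => bM (x + t n))).
have bwint : (law f).-integrable setT (EFin \o (fun x => b x * w v x)).
  apply: (le_integrable measurableT _ _ (integrableZl measurableT M (score_integrable v))).
    by apply/measurable_EFinP; apply: measurable_funM => //; exact: mw.
  move=> x _; rewrite -EFinM !abse_EFin lee_fin !normrM.
  by rewrite (ger0_norm M0) ler_wpM2r.
have mf := measurable_pdf f.
have mft n : measurable_fun setT (fun x => f (x - t n)).
  by apply: (measurableT_comp mf); apply: measurable_addv => //; exact: measurable_id.
pose G n x := n.+1%:R * (b x * f (x - t n) - b x * f x) - b x * w v x * f x.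
pose q n x := (Num.sqrt (location f (t n) x) - Num.sqrt (location f 0 x)
       - 2^-1 * dotv (t n) (score f 0 x) * Num.sqrt (location f 0 x)) ^+ 2
      / sqnorm (t n).
have tn0 n : t n != 0 by rewrite scaler_eq0 negb_or v0 invr_eq0 pnatr_eq0.
have q0 : (\int[lebesgue]_x (q n x)%:E)%E @[n --> \oo] --> 0%E.
  apply: (cvg_comp t _ _ qf).
  have t0 : t n @[n --> \oo] --> (0 : 'cV[R]_d).
    rewrite -[0 in X in _ --> X](scale0r v).
    by apply: cvgZr_tmp; exact: cvg_harmonic.
  move=> A; rewrite /dnbhs /within /= => A0.
  have h : \forall n \near \oo, t n != 0 -> A (t n) by exact: (t0 _ A0).
  suff : \forall n \near \oo, A (t n) by [].
  by apply: filterS h => n; apply; exact: tn0.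
have ibf : lebesgue.-integrable setT (EFin \o (fun x => b x * f x)).
  have /integrable_law := bint; apply; exact/measurable_EFinP.
have ibwf : lebesgue.-integrable setT (EFin \o (fun x => b x * w v x * f x)).
  have /integrable_law := bwint; apply; apply/measurable_EFinP.
  by apply: measurable_funM => //; exact: mw.
have mbft n : measurable_fun setT (fun x => b x * f (x - t n)).
  exact: measurable_funM.
have shift n : (fun x => b (x + t n) * f x) = (fun x => b x * f (x - t n)) \o (fun x => x + t n).
  by apply/funext => x /=; rewrite addrK.
have ibft n : lebesgue.-integrable setT (EFin \o (fun x => b x * f (x - t n))).
  have mE : measurable_fun setT (EFin \o (fun x => b x * f (x - t n))).
    exact/measurable_EFinP.
  apply/(integrable_pushes (pushes_translation (t n)) mE).
  rewrite -compA -shift.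
  have /integrable_law := btint n; apply; exact/measurable_EFinP.
have idiff n : lebesgue.-integrable setT
    (EFin \o (fun x => n.+1%:R * (b x * f (x - t n) - b x * f x))).
  exact: (integrableZl measurableT n.+1%:R (integrableB measurableT (ibft n) ibf)).
have iG n : lebesgue.-integrable setT (EFin \o G n).
  exact: (integrableB measurableT (idiff n) ibwf).
have GE n : n.+1%:R * (\int[law f]_x b (x + t n) - \int[law f]_x b x)
    - \int[law f]_x (b x * w v x) = \int[lebesgue]_x G n x.
  rewrite /G RintegralB//.
  rewrite RintegralZl//; last by apply: (integrableB _ (ibft n) ibf).
  rewrite RintegralB// !Rintegral_law//; last by apply: measurable_funM => //; exact: mw.
  rewrite [in RHS](Rintegral_pushes (pushes_translation (t n)))//.
  by under [in RHS]eq_Rintegral do rewrite addrK.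
have msq (g : 'cV[R]_d -> R) : measurable_fun setT g ->
    measurable_fun setT (fun x => Num.sqrt (g x)).
  move=> mg; apply: measurableT_comp mg.
  by apply: continuous_measurable_fun; exact: sqrt_continuous.
have mq n : measurable_fun setT (fun x => (q n x)%:E).
  apply/measurable_EFinP; apply: measurable_funM => //; apply: measurable_funX.
  have m0 : measurable_fun setT (fun x => Num.sqrt (location f 0 x)).
    by rewrite /location; under eq_fun do rewrite subr0; exact: msq.
  apply: measurable_funB; first by apply: measurable_funB => //; apply: msq; exact: mft.
  by apply: measurable_funM => //; apply: measurable_funM => //; apply: measurable_dotv.
have q_ge0 n x : (0 <= (q n x)%:E)%E by rewrite lee_fin divr_ge0 ?sqr_ge0 ?sqnorm_ge0.
have mwf : measurable_fun setT (fun x => w v x ^+ 2 * f x).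
  by apply: measurable_funM => //; apply: measurable_funX; exact: mw.
have Gle e n x : 0 < e -> `|G n x| <= M * (2 + e^-1) * sqnorm v * q n x +
    (M * n.+1%:R^-1 * (w v x ^+ 2 * f x) + M * e * f x).
  move=> e0.
  have fE y : f y = Num.sqrt (f y) ^+ 2 by rewrite sqr_sqrtr ?pdf_ge0.
  have N1 : 1 <= n.+1%:R :> R by rewrite ler1n.
  have := qmd_pointwise (a := Num.sqrt (f (x - t n))) (s := Num.sqrt (f x)) (w := w v x) N1 e0 erefl.
  rewrite -!fE => H.
  have -> : G n x = b x * (n.+1%:R * (f (x - t n) - f x) - w v x * f x).
    by rewrite /G; ring.
  rewrite normrM (le_trans (ler_pM _ _ (bM x) H))//.
  rewrite le_eqVlt; apply/orP; left; apply/eqP.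
  rewrite /q /location !subr0 sqnormZ dotvZl -/(w v x).
  set r := _ - _ - _; rewrite exprVn; field.
  by rewrite nat1r pnatr_eq0 !gt_eqF.
have GM e n : 0 < e -> (`|\int[lebesgue]_x G n x|%:E <=
    (M * (2 + e^-1) * sqnorm v)%:E * \int[lebesgue]_x (q n x)%:E
    + ((M * n.+1%:R^-1)%:E * \int[law f]_x ((w v x) ^+ 2)%:E + (M * e)%:E))%E.
  move=> e0.
  rewrite EFin_normr_Rintegral//.
  apply: le_trans (le_abse_integral _ _ _) _ => //; first exact/measurable_int/iG.
  have e1 : 0 <= 2 + e^-1 by rewrite addr_ge0// invr_ge0 ltW.
  have Kge0 : (0 <= (M * (2 + e^-1) * sqnorm v)%:E)%E.
    by rewrite lee_fin mulr_ge0 ?mulr_ge0// ltW.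
  have Bge0 : (0 <= (M * n.+1%:R^-1)%:E)%E by rewrite lee_fin mulr_ge0.
  have Cge0 : (0 <= (M * e)%:E)%E by rewrite lee_fin mulr_ge0// ltW.
  have mfE : measurable_fun setT (fun x => (f x)%:E) by exact/measurable_EFinP.
  have f0 x : (0 <= (f x)%:E)%E by rewrite lee_fin pdf_ge0.
  have mwfE : measurable_fun setT (fun x => (w v x ^+ 2 * f x)%:E) by exact/measurable_EFinP.
  have wf0 x : (0 <= (w v x ^+ 2 * f x)%:E)%E by rewrite lee_fin mulr_ge0 ?sqr_ge0 ?pdf_ge0.
  have mA : measurable_fun setT (fun x => (M * (2 + e^-1) * sqnorm v)%:E * (q n x)%:E)%E.
    exact: emeasurable_funM.
  have mB : measurable_fun setT (fun x => (M * n.+1%:R^-1)%:E * (w v x ^+ 2 * f x)%:E)%E.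
    exact: emeasurable_funM.
  have mC : measurable_fun setT (fun x => (M * e)%:E * (f x)%:E)%E.
    exact: emeasurable_funM.
  have mBC := emeasurable_funD mB mC.
  apply: (@le_trans _ _ (\int[lebesgue]_x ((M * (2 + e^-1) * sqnorm v)%:E * (q n x)%:E
    + ((M * n.+1%:R^-1)%:E * (w v x ^+ 2 * f x)%:E + (M * e)%:E * (f x)%:E)))%E).
    apply: ge0_le_integral => //.
    - by apply: measurableT_comp => //; exact: measurable_int (iG n).
    - exact: emeasurable_funD.
    - by move=> x _; rewrite /= -!EFinM -!EFinD lee_fin; exact: Gle.
  rewrite ge0_integralD//; last 2 first.
  - by move=> x _; exact: mule_ge0.
  - by move=> x _; apply: adde_ge0; exact: mule_ge0.
  rewrite ge0_integralD//; last 2 first.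
  - by move=> x _; exact: mule_ge0.
  - by move=> x _; exact: mule_ge0.
  rewrite !ge0_integralZl// integral_pdf mule1 integral_law//.
  by apply/measurable_EFinP/measurable_funX; exact: mw.
have fI : (\int[law f]_x ((w v x) ^+ 2)%:E)%E \is a fin_num.
  exact: integrable_fin_num (score_sq_integrable v).
pose I2 := fine (\int[law f]_x ((w v x) ^+ 2)%:E)%E.
have I2ge0 : 0 <= I2 by rewrite fine_ge0// integral_ge0// => x _; rewrite lee_fin sqr_ge0.
apply/cvgrPdist_le => eps eps0.
have M1 : 0 < M + 1 by rewrite ltr_wpDl.
(* Each of the three terms gets [eps / 3]; the additions of 1, here and below, keep the divisors
   positive. *)
pose e := eps / 3 / (M + 1).
have e0 : 0 < e by rewrite !divr_gt0.
pose K := M * (2 + e^-1) * sqnorm v.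
have K0 : 0 <= K.
  by rewrite mulr_ge0 ?(ltW V0)// mulr_ge0// addr_ge0// invr_ge0 ltW.
have K1 : 0 < K + 1 by rewrite ltr_wpDl.
have MI1 : 0 < M * I2 + 1 by rewrite ltr_wpDl// mulr_ge0.
have dq0 : 0 < eps / 3 / (K + 1) by rewrite !divr_gt0.
have dI0 : 0 < eps / 3 / (M * I2 + 1) by rewrite !divr_gt0.
have nq : \forall n \near \oo, (\int[lebesgue]_x (q n x)%:E < (eps / 3 / (K + 1))%:E)%E.
  have dq0E : (0 < (eps / 3 / (K + 1))%:E)%E by rewrite lte_fin.
  exact: (q0 _ (open_ereal_lt' dq0E)).
near=> n.
rewrite distrC GE -lee_fin; apply: le_trans (GM e n e0) _.
have hn : n.+1%:R^-1 < eps / 3 / (M * I2 + 1).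
  by near: n; exact: (near_infty_natSinv_lt (PosNum dI0)).
have hq : (\int[lebesgue]_x (q n x)%:E < (eps / 3 / (K + 1))%:E)%E by near: n.
have frac (a c : R) : 0 <= a -> c <= eps / 3 / (a + 1) -> a * c <= eps / 3.
  move=> a0 ca; apply: (le_trans (ler_wpM2l a0 ca)).
  rewrite mulrA ler_pdivrMr ?ltr_wpDl// mulrC ler_wpM2l ?lerDl//.
  by rewrite divr_ge0// ltW.
rewrite -/K -(fineK fI) -/I2.
apply: (@le_trans _ _ (K%:E * (eps / 3 / (K + 1))%:E + ((M * n.+1%:R^-1)%:E * I2%:E + (M * e)%:E))%E).
  by rewrite leeD2r// lee_wpmul2l ?lee_fin// ltW.
rewrite -!EFinM -!EFinD lee_fin.
have h1 := frac _ _ K0 (lexx _).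
have h2 : M * n.+1%:R^-1 * I2 <= eps / 3.
  by rewrite mulrAC; apply: frac; rewrite ?mulr_ge0// ltW.
have h3 : M * e <= eps / 3 by apply: frac.
rewrite [leRHS](_ : eps = eps / 3 + (eps / 3 + eps / 3)); last by field.
by apply: lerD => //; exact: lerD.
Unshelve. all: by end_near. Qed.

End score_identity.

(** * Monotone transport to the standard normal law *)

Section cdf.
Context (R : realType).
Notation mu1 := (@lebesgue_measure R).
Implicit Types (g : density mu1) (x y z u : R).

(** The identity as a random variable, whose distribution function under [law g] has limits 0 and 1
    at the two infinities. *)
Let idTR : measurableTypeR R -> R := idfun.

#[local] HB.instance Definition _ :=
  @isMeasurableFun.Build _ _ _ _ idTR (@measurable_id _ _ setT).

Definition cdfL g x : R := \int[mu1]_(t in `]-oo, x]) g t.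

Lemma cdfLE g x : (cdfL g x)%:E = law g `]-oo, x].
Proof. by rewrite /cdfL /Rintegral fineK// -/(law g _) fin_num_measure. Qed.

Lemma law_itv_oc g x y : x <= y -> law g `]x, y] = (cdfL g y - cdfL g x)%:E.
Proof.
move=> xy; rewrite EFinB !cdfLE.
have -> : `]x, y]%classic = `]-oo, y] `\` `]-oo, x].
  by rewrite -[RHS]setCK setCD setCitvl setUC -[LHS]setCK setCitv.
rewrite measureD ?setIidr//; first exact: subset_itvl.
by rewrite -ge0_fin_numE// fin_num_measure.
Qed.

Lemma cdfL_nd g : {homo cdfL g : x y / x <= y}.
Proof. by move=> x y xy; rewrite -subr_ge0 -lee_fin -law_itv_oc. Qed.

Lemma cdfL_ge0 g x : 0 <= cdfL g x.
Proof. by rewrite -lee_fin cdfLE. Qed.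

Lemma cdfL_le1 g x : cdfL g x <= 1.
Proof. by rewrite -lee_fin cdfLE probability_le1. Qed.

Lemma cdfL_continuous g : continuous (cdfL g).
Proof.
move=> x; pose a := x - 1; pose b := x + 1.
have ab : a < b by rewrite /a /b; lra.
have ig : mu1.-integrable `[a, b] (EFin \o g).
  by apply: integrableS (pdf_integrable g).
have := parameterized_integral_continuous (ltW ab) ig.
move=> /(continuous_within_itvP _ ab)[+ _ _] => /(_ x).
rewrite in_itv/= /a /b ltrBlDr ltrDl ltr01 => /(_ isT) cx.
have -> : cdfL g = (fun y => cdfL g a + (cdfL g y - cdfL g a)).
  by apply/funext => y; rewrite subrKC.
have near_eq : \forall y \near x, cdfL g y - cdfL g a = parameterized_integral mu1 a y g.
  near=> y; have ay : a < y by near: y; apply: lt_nbhsr; rewrite /a; lra.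
  rewrite -[LHS]/(fine (_%:E)) -law_itv_oc ?(ltW ay)//.
  rewrite /parameterized_integral -Rintegral_itv_obnd_cbnd//.
  exact: integrableS (pdf_integrable g).
have cxx : (cdfL g a + parameterized_integral mu1 a y g) @[y --> x] --> cdfL g a + (cdfL g x - cdfL g a).
  have -> : cdfL g x - cdfL g a = parameterized_integral mu1 a x g.
    exact: (nbhs_singleton near_eq).
  by apply: cvgD; [exact: cvg_cst|exact: cx].
apply: cvg_trans cxx; apply: near_eq_cvg.
by apply: filterS near_eq => y ->.
Unshelve. all: by end_near. Qed.

Lemma cdfL_surj g u : 0 < u < 1 -> exists x, cdfL g x = u.
Proof.
move=> /andP[u0 u1].
have [a au] : exists a, cdfL g a <= u.
  have u0E : (0 < u%:E)%E by rewrite lte_fin.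
  have := cvg_cdfNy0 (idTR : {RV (law g) >-> R}) (open_ereal_lt' u0E).
  move=> [M [_ MP]]; exists (M - 1); rewrite -lee_fin cdfLE.
  by apply/ltW/(MP (M - 1)); rewrite ltrBlDr ltrDl.
have [b bu] : exists b, u <= cdfL g b.
  have u1E : (u%:E < 1)%E by rewrite lte_fin.
  have := cvg_cdfy1 (idTR : {RV (law g) >-> R}) (open_ereal_gt' u1E).
  move=> [M [_ MP]]; exists (M + 1); rewrite -lee_fin cdfLE.
  by apply/ltW/(MP (M + 1)); rewrite ltrDl.
have ab : a <= b \/ b < a by case: (leP a b); [left|right].
case: ab => [ab|ba].
  have [c _ cE] := @IVT R (cdfL g) a b u ab
    (continuous_subspaceT (@cdfL_continuous g)) ltac:(rewrite ge_min au le_max bu orbT//).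
  by exists c.
exists a; apply/eqP; rewrite eq_le au (le_trans bu)//; exact/cdfL_nd/ltW.
Qed.

(** The probability integral transform. A flat piece of the distribution function may extend the set
    beyond a given ray, so the upper bound compares it with rays at slightly larger levels. *)
Lemma law_cdf_le g u : 0 < u < 1 -> law g [set x | cdfL g x <= u] = u%:E.
Proof.
move=> u01; have [x xE] := cdfL_surj g u01; case/andP: u01 => u0 u1.
have mS : measurable [set x | cdfL g x <= u].
  rewrite -[X in measurable X]setTI.
  have := nondecreasing_measurable measurableT (@cdfL_nd g).
  move=> /(_ measurableT _ (measurable_itv `]-oo, u])).
  by congr (measurable (_ `&` _)); apply/seteqP; split=> y /=; rewrite in_itv.
apply/eqP; rewrite eq_le; apply/andP; split.
- apply/lee_addgt0Pr => e e0.
  (* Half of [Num.min e (1 - u)] keeps the raised level below 1, where it is attained, and within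
     [e] of [u]. *)
  have [y yE] : exists y, cdfL g y = u + Num.min e (1 - u) / 2.
    apply: cdfL_surj; rewrite addr_gt0 ?divr_gt0 ?lt_min ?e0 ?subr_gt0//=.
    have : Num.min e (1 - u) <= 1 - u by rewrite ge_min lexx orbT.
    lra.
  have m0 : 0 < Num.min e (1 - u) by rewrite lt_min e0 subr_gt0.
  have me : Num.min e (1 - u) <= e by rewrite ge_min lexx.
  apply: (@le_trans _ _ (law g `]-oo, y])).
    apply: le_measure; rewrite ?inE//= => z /= zu; rewrite in_itv/= leNgt.
    by apply/negP => /ltW/(@cdfL_nd g); rewrite yE leNgt => /negP; apply; lra.
  by rewrite -cdfLE yE -EFinD lee_fin; lra.
- have -> : u%:E = law g `]-oo, x] by rewrite -cdfLE xE.
  apply: le_measure; rewrite ?inE//= => z /=.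
  by rewrite in_itv/= => zx; rewrite -xE cdfL_nd.
Qed.

Lemma ray_measure_unique (m1 m2 : {measure set (measurableTypeR R) -> \bar R}) :
  (m1 setT < +oo)%E -> (forall x, m1 `]-oo, x]%classic = m2 `]-oo, x]%classic) ->
  forall B, measurable B -> m1 B = m2 B.
Proof.
move=> m1T m12 B mB; have fin A : measurable A -> (m1 A < +oo)%E.
  by move=> mA; apply: le_lt_trans m1T; apply: le_measure; rewrite ?inE.
refine (@measure_unique _ R (measurableTypeR R) (@ocitv R)
  (fun n => `](- n%:R)%R, n%:R%R]%classic) _ _ _ _ m1 m2 _ _ B mB).
- by [].
- exact: ocitvI.
- by move=> n; exact: is_ocitv.
- apply/seteqP; split=> // x _; exists (Num.bound `|x|) => //=.
  have := archi_boundP (normr_ge0 x); rewrite ltr_norml in_itv/=.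
  by move=> /andP[-> /ltW ->].
- move=> _ [[a b] _ <-] /=; have [ab|ba] := leP a b; last first.
    by rewrite set_itv_ge ?measure0// bnd_simp -leNgt ltW.
  have -> : `]a, b]%classic = `]-oo, b] `\` `]-oo, a].
    by rewrite -[RHS]setCK setCD setCitvl setUC -[LHS]setCK setCitv.
  have sub : [set` `]-oo, a]] `<=` ([set` `]-oo, b]] : set R) by exact: subset_itvl.
  have f1 := fin _ (measurable_itv `]-oo, b]).
  have f2 : (m2 `]-oo, b]%classic < +oo)%E by rewrite -m12.
  have mitv c : measurable ([set` `]-oo, c]] : set (measurableTypeR R)).
    exact: measurable_itv.
  have d1 := measureD (mu := m1) (mitv b) (mitv a) f1.
  have d2 := measureD (mu := m2) (mitv b) (mitv a) f2.
  by rewrite setIidr// in d1; rewrite setIidr// in d2; rewrite d1 d2; congr (_ - _)%E; exact: m12.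
- by move=> k; exact: fin.
Qed.

End cdf.

(** * Standard normal density, distribution function and quantile function *)

Section standard_normal.
Context (R : realType).
Notation mu1 := (@lebesgue_measure R).
Implicit Types (x y z u a : R).

Definition normal_density (m s : R) : density mu1 :=
  @Density _ (measurableTypeR R) R mu1 (normal_pdf m s)
    (measurable_normal_pdf m s) (normal_pdf_ge0 m s) (integral_normal_pdf m s).

Local Notation stdn := (normal_density 0 1).

Definition phi z : R := normal_pdf 0 1 z.

Lemma phiE z : phi z = normal_peak (1 : R) * expR (- (z ^+ 2) / 2).
Proof. by rewrite /phi normal_pdfE ?oner_neq0// /normal_fun subr0 expr1n. Qed.

Lemma phi_gt0 z : 0 < phi z.
Proof. by rewrite phiE mulr_gt0 ?expR_gt0// normal_peak_gt0 ?oner_neq0. Qed.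

Lemma phiN z : phi (- z) = phi z.
Proof. by rewrite !phiE sqrrN. Qed.

Lemma phi_continuous : continuous phi.
Proof. by apply: continuous_normal_pdf; rewrite oner_neq0. Qed.

Lemma is_derive_phi z : is_derive z 1 phi (- z * phi z).
Proof.
have -> : phi = (fun t => normal_peak (1 : R) * expR (- (t ^+ 2) / 2)).
  by apply/funext => t; exact: phiE.
have h : is_derive z 1 (fun t : R => - (t ^+ 2) / 2) (- z).
  have := is_deriveZ (- 2^-1) (is_deriveX 2 (is_derive_id z 1)).
  have -> : (fun t : R => - (t ^+ 2) / 2) = - 2^-1 \*: (@idfun R ^+ 2).
    by apply/funext => t; rewrite /= /GRing.scale/= mulrC mulNr mulrN.
  by move=> h; apply: (is_derive_eq h); rewrite /GRing.scale/=; lra.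
have := is_derive1_comp (is_derive_expR _) h.
move=> /(is_deriveZ (normal_peak (1:R))) h'.
by apply: (is_derive_eq h'); rewrite /GRing.scale/=; ring.
Qed.

Lemma cvg_phi : phi x @[x --> +oo] --> (0 : R).
Proof.
have c : (normal_peak (1 : R) * expR (- x)) @[x --> +oo] --> (0 : R).
  by rewrite -(mulr0 (normal_peak 1)); apply: cvgMr; exact: cvgr_expR.
apply: (squeeze_cvgr _ (cvg_cst 0) c); near=> x.
have x2 : 2 <= x by near: x; exact: nbhs_pinfty_ge.
rewrite (ltW (phi_gt0 _)) phiE ler_wpM2l ?normal_peak_ge0// ler_expR.
by rewrite mulNr lerN2 ler_pdivlMr// expr2 ler_wpM2l//; lra.
Unshelve. all: by end_near. Qed.

(** [- phi] is an antiderivative of [z * phi z]. Reading [phi a] as a mean over a tail is what lets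
    Tonelli bound the integral of [phi (r x)] by a covariance. *)
Lemma phi_tail a : 0 <= a ->
  (\int[mu1]_(z in `[a, +oo[) (z * phi z)%:E = (phi a)%:E)%E.
Proof.
move=> a0; rewrite (@ge0_continuous_FTC2y R (fun z => z * phi z) (fun z => - phi z) a 0).
- by rewrite EFinN oppeK add0e.
- by move=> z az; apply: mulr_ge0; [exact: le_trans az|exact: ltW (phi_gt0 z)].
- apply: continuous_subspaceT => z; apply: cvgM; first exact: cvg_id.
  exact: phi_continuous.
- by rewrite -oppr0; apply: cvgN; exact: cvg_phi.
- by move=> z _; apply: derivableN; case: (is_derive_phi z).
- by apply: cvg_at_right_filter; apply: cvgN; exact: phi_continuous.
- move=> z _; rewrite derive1E deriveN; last by case: (is_derive_phi z).
  by rewrite (@derive_val _ _ _ _ _ _ _ (is_derive_phi z)) mulNr opprK.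
Qed.

Definition Phi : R -> R := cdfL stdn.

Lemma is_derive_Phi z : is_derive z 1 Phi (phi z).
Proof.
have ig : mu1.-integrable [set` Interval -oo%O (BRight (z + 1))] (EFin \o phi).
  by apply: integrableS (pdf_integrable stdn).
have z1 : z < z + 1 by rewrite ltrDl.
have [d1 d2] := continuous_FTC1 z1 ig (ltNyr z) (phi_continuous (x := z)).
by apply: DeriveDef => //; rewrite -derive1E.
Qed.

Lemma Phi_mono : {mono Phi : x y / x < y}.
Proof.
apply/leW_mono/le_mono => x y xy; rewrite -subr_gt0.
have [|c _ ->] := @MVT R Phi phi x y xy (fun z _ => is_derive_Phi z).
  exact/continuous_subspaceT/cdfL_continuous.
by rewrite mulr_gt0 ?phi_gt0// subr_gt0.
Qed.

Lemma Phi01 z : 0 < Phi z < 1.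
Proof.
apply/andP; split.
- by apply: (le_lt_trans (cdfL_ge0 stdn (z - 1))); rewrite Phi_mono; lra.
- by apply: lt_le_trans (cdfL_le1 stdn (z + 1)); rewrite Phi_mono; lra.
Qed.

(** The default 0 is used exactly for [u] outside []0, 1[]. *)
Definition Phiinv u : R := xget 0 [set z | Phi z = u].

Lemma PhiK : cancel Phi Phiinv.
Proof.
move=> z; rewrite /Phiinv; case: xgetP => [y _ /= e|/(_ z)[]//].
by apply/eqP; rewrite eq_le !leNgt -(Phi_mono z y) -(Phi_mono y z) e !ltxx.
Qed.

Lemma PhiinvK u : 0 < u < 1 -> Phi (Phiinv u) = u.
Proof. by move=> /(cdfL_surj stdn)[z <-]; rewrite -/(Phi z) PhiK. Qed.

Lemma Phiinv_mono u v : 0 < u < 1 -> 0 < v < 1 ->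
  (Phiinv u < Phiinv v) = (u < v).
Proof. by move=> u01 v01; rewrite -Phi_mono !PhiinvK. Qed.

Lemma is_derive_Phiinv u : 0 < u < 1 ->
  is_derive u 1 Phiinv (phi (Phiinv u))^-1.
Proof.
move=> u01; rewrite -{1}(PhiinvK u01); apply: is_derive_inverse.
- by near=> z; exact: PhiK.
- by near=> z; exact: cdfL_continuous.
- exact: is_derive_Phi.
- by rewrite gt_eqF// phi_gt0.
Unshelve. all: by end_near. Qed.

End standard_normal.

Lemma sq_integrable disp (T : measurableType disp) (R : realType)
    (P : probability T R) (f : T -> R) : measurable_fun setT f ->
  P.-integrable setT (fun x => (f x ^+ 2)%:E) -> P.-integrable setT (fun x => (f x)%:E).
Proof.
move=> mf if2; have i1 := finite_measure_integrable_cst P (1 : R) measurableT.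
apply: (le_integrable _ _ _ (integrableD measurableT i1 if2)) => //.
  exact/measurable_EFinP.
move=> x _ /=; rewrite lee_fin [leRHS]ger0_norm ?addr_ge0 ?sqr_ge0//.
rewrite ler_norml; have := sqr_ge0 (f x - 1); have := sqr_ge0 (f x + 1).
by rewrite sqrrD sqrrB; lra.
Qed.

Section normal_laws.
Context (R : realType).
Notation mu1 := (@lebesgue_measure R).
Notation stdn := (normal_density (0 : R) 1).
Implicit Types (x y z a m s : R).
Notation pushes11 := (@pushes _ _ (measurableTypeR R) (measurableTypeR R) R).

Lemma normal_pdf_affine m s z : s != 0 ->
  `|s| * normal_pdf m s (s * z + m) = phi z.
Proof.
move=> s0; rewrite phiE normal_pdfE// /normal_fun addrK mulrA; congr (_ * expR _).
  rewrite /normal_peak expr1n mul1r -mulrnAr sqrtrM ?sqr_ge0//.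
  by rewrite sqrtr_sqr invfM mulrA mulfV ?mul1r// normr_eq0.
by rewrite exprMn -mulr_natr; field.
Qed.

Lemma pushes_normal m s : s != 0 ->
  pushes11 (fun z => s * z + m) (law stdn) (law (normal_density m s)).
Proof.
move=> s0; have [maff saff] := scales_affine m s0.
apply: pushes_ge0; first exact: maff.
move=> F mF F0.
have mp := measurable_pdf (normal_density m s).
have mFa : measurable_fun setT (fun x => F (s * x + m)) by exact: (measurableT_comp mF maff).
rewrite (@ge0_integral_law _ _ _ _ (normal_density m s) F mF F0).
rewrite (@ge0_integral_law _ _ _ _ stdn _ mFa (fun x => F0 _)).
rewrite saff; last 2 first.
- by apply: emeasurable_funM => //; exact/measurable_EFinP.
- by move=> x; rewrite mule_ge0// lee_fin normal_pdf_ge0.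
rewrite -ge0_integralZl//.
- apply: eq_integral => x _; rewrite muleCA -EFinM; congr (_ * _%:E)%E.
  exact: normal_pdf_affine.
- apply: emeasurable_funM => //; apply/measurable_EFinP.
  exact: (measurableT_comp mp maff).
- by move=> x _; rewrite mule_ge0// lee_fin normal_pdf_ge0.
Qed.

Lemma pushes_normalV m s : s != 0 ->
  pushes11 (fun x => (x - m) / s) (law (normal_density m s)) (law stdn).
Proof.
move=> s0; have mphi : measurable_fun setT (fun x : R => (x - m) / s).
  by apply: measurable_funM => //; exact: measurable_funB.
apply: pushes_ge0; first exact: mphi.
move=> F mF F0.
rewrite (ge0_integral_pushes (pushes_normal m s0) (F := fun x => F ((x - m) / s)))//.
  by apply: eq_integral => x _; rewrite addrK mulrAC mulfV ?mul1r.
exact: (measurableT_comp mF mphi).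
Qed.

Lemma pushes_normalN : pushes11 (fun z => - z) (law stdn) (law stdn).
Proof.
have s0 : (-1 : R) != 0 by rewrite oppr_eq0 oner_eq0.
have [mN lN] := pushes_normal 0 s0.
have E : (fun z : R => -1 * z + 0) = (fun z => - z).
  by apply/funext => z; rewrite addr0 mulN1r.
rewrite E in mN lN; split=> // B mB; rewrite -lN//.
apply: eq_integral => x _; congr EFin.
rewrite -[LHS]/(phi x) -phiN -(normal_pdf_affine 0 (- x) s0).
by rewrite normrN1 mul1r addr0 mulN1r opprK.
Qed.

Lemma measurable_ltr_ind disp (T : measurableType disp) (f h : T -> R) :
  measurable_fun setT f -> measurable_fun setT h ->
  measurable_fun setT (fun t => (f t < h t)%R%:R : R).
Proof.
move=> mf mh; have := measurable_fun_ltr mf mh.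
by move=> mb; apply: (measurableT_comp (f := fun b : bool => b%:R : R)).
Qed.

Lemma normal_tail_pos a : 0 <= a ->
  (\int[law stdn]_z (`|z| * (a < z)%R%:R)%:E = (phi a)%:E)%E.
Proof.
move=> a0; have mt : measurable_fun setT (fun z : R => (`|z| * (a < z)%R%:R)%:E).
  apply/measurable_EFinP/measurable_funM; first exact: normr_measurable.
  exact: measurable_ltr_ind.
rewrite (@ge0_integral_law _ _ _ _ stdn _ mt); last by move=> z; rewrite lee_fin mulr_ge0.
rewrite -(phi_tail a0) -integral_itv_obnd_cbnd; last first.
  apply/measurable_funTS/measurable_EFinP/measurable_funM => //.
  exact: (measurable_pdf stdn).
rewrite [RHS]integral_mkcond; apply: eq_integral => z _.
rewrite patchE mem_setE in_itv/= andbT; case: ltP => az /=.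
  by rewrite mulr1 -EFinM ger0_norm// (le_trans a0)// ltW.
by rewrite mulr0 mul0e.
Qed.

Lemma normal_tail_neg a : a <= 0 ->
  (\int[law stdn]_z (`|z| * (z < a)%R%:R)%:E = (phi a)%:E)%E.
Proof.
move=> a0; have mt : measurable_fun setT (fun z : R => (`|z| * (z < a)%R%:R)%:E).
  apply/measurable_EFinP/measurable_funM; first exact: normr_measurable.
  exact: measurable_ltr_ind.
rewrite (ge0_integral_pushes pushes_normalN mt); last by move=> z; rewrite lee_fin mulr_ge0.
rewrite -phiN -normal_tail_pos ?oppr_ge0//.
by apply: eq_integral => z _; rewrite normrN ltrNl.
Qed.

(** Pairs [(x, y)] for which [x] separates [m] from [y]. At fixed [y] the section in [x] has length
    |y - m|; at fixed [x] the section in [y] is the tail beyond [x], away from [m]. Tonelli on this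
    set plays the role of an integration by parts. *)
Definition between m : set (R * R) :=
  [set p | ((m <= p.1) && (p.1 < p.2)) || ((p.2 < p.1) && (p.1 < m))].

Lemma measurable_between m : measurable (between m).
Proof.
rewrite -[X in measurable X]setTI.
pose b (p : R * R) := ((m <= p.1) && (p.1 < p.2)) || ((p.2 < p.1) && (p.1 < m)).
suff mb : measurable_fun setT b by have := mb measurableT [set true] I; apply.
apply: measurable_or; apply: measurable_and.
- by apply: measurable_fun_ler => //; exact: measurable_fst.
- by apply: measurable_fun_ltr; [exact: measurable_fst|exact: measurable_snd].
- by apply: measurable_fun_ltr; [exact: measurable_snd|exact: measurable_fst].
- by apply: measurable_fun_ltr => //; exact: measurable_fst.
Qed.

Lemma lebesgue_between m y :
  (\int[mu1]_x (\1_(between m) (x, y))%:E = `|y - m|%:E)%E.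
Proof.
have E (x : R) : \1_(between m) (x, y) = \1_(`[m, y[%classic `|` `]y, m[%classic) x :> R.
  rewrite !indicE; congr (_%:R); congr nat_of_bool; apply/idP/idP; rewrite !inE.
    by move=> /orP[|] ?; [left|right]; rewrite /= in_itv.
  by rewrite /between/=; move=> [|]; rewrite /= in_itv/= => ->; rewrite ?orbT.
under eq_integral do rewrite E.
rewrite integral_indic; [|by []|exact: measurableU].
rewrite setIT; case: (leP m y) => my.
  have -> : `]y, m[%classic = set0 by rewrite set_itv_ge// bnd_simp -leNgt.
  rewrite setU0.
  rewrite [LHS](lebesgue_measure_itv `[m, y[)/= lte_fin ger0_norm ?subr_ge0//.
  by case: ltgtP my => // -> _; rewrite subrr.
have -> : `[m, y[%classic = set0 by rewrite set_itv_ge// bnd_simp -leNgt ltW.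
rewrite set0U.
by rewrite [LHS](lebesgue_measure_itv `]y, m[)/= lte_fin my ltr0_norm ?subr_lt0// opprB.
Qed.

Lemma tonelli_between (g : density mu1) (h : R -> R) m : measurable_fun setT h ->
  (\int[mu1]_x \int[law g]_y (`|h y| * \1_(between m) (x, y))%:E =
   \int[law g]_y (`|h y| * `|y - m|)%:E)%E.
Proof.
move=> mh; pose K (p : R * R) := (`|h p.2| * \1_(between m) p)%:E.
have mK : measurable_fun setT K.
  apply/measurable_EFinP/measurable_funM.
    by apply: measurableT_comp => //; exact: (measurableT_comp mh).
  by apply: measurable_indic; exact: measurable_between.
have K0 p : (0 <= K p)%E by rewrite lee_fin mulr_ge0.
have := @fubini_tonelli _ _ (measurableTypeR R) (measurableTypeR R) R mu1 (law g) K mK K0.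
move=> ->; apply: eq_integral => y _.
rewrite /K/=; under eq_integral do rewrite EFinM.
rewrite ge0_integralZl//=; last first.
  apply: (measurableT_comp (f := fun p : R * R => (\1_(between m) p)%:E)).
    by apply/measurable_EFinP; apply: measurable_indic; exact: measurable_between.
  exact: measurable_fun_pair.
by rewrite lebesgue_between EFinM.
Qed.

(** The Tonelli identity with [h = id] and [m = 0]: the inner integral, over the tail beyond [x], is
    [phi x], and the total mass of [phi] is 1. *)
Lemma normal_sq : (\int[law stdn]_z (z ^+ 2)%:E = 1)%E.
Proof.
have := tonelli_between stdn (h := id) 0 (@measurable_id _ _ _).
under [X in X = _]eq_integral => x _.
  rewrite (_ : (\int[law stdn]_y _ = (phi x)%:E)%E); last first.
    have [x0|x0] := leP 0 x.
      rewrite -normal_tail_pos//; apply: eq_integral => y _.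
      rewrite indicE; congr (_ * _%:R)%:E; congr nat_of_bool.
      by apply/idP/idP; rewrite inE /between/= x0 [x < 0]ltNge x0 andbF orbF.
    rewrite -normal_tail_neg ?ltW//; apply: eq_integral => y _.
    rewrite indicE; congr (_ * _%:R)%:E; congr nat_of_bool.
    by apply/idP/idP; rewrite inE /between/= [0 <= x]leNgt x0 andbT.
  over.
rewrite (integral_pdf stdn) => ->; apply: eq_integral => y _.
by rewrite subr0 -normrM -expr2 ger0_norm ?sqr_ge0.
Qed.

Lemma normal_sq_integrable : (law stdn).-integrable setT (fun z => (z ^+ 2)%:E).
Proof.
apply/integrableP; split.
  by apply/measurable_EFinP; exact: measurable_funX.
under eq_integral do rewrite abse_EFin ger0_norm ?sqr_ge0//.
by rewrite normal_sq ltry.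
Qed.

Lemma normal_integrable : (law stdn).-integrable setT (fun z => z%:E).
Proof. exact: (@sq_integrable _ (measurableTypeR R) R (law stdn) (fun z => z) (@measurable_id _ _ _) normal_sq_integrable). Qed.

Lemma normal_mean : \int[law stdn]_z z = 0 :> R.
Proof.
have : \int[law stdn]_z z = - \int[law stdn]_z z :> R.
  rewrite [LHS](Rintegral_pushes pushes_normalN)//.
  under eq_Rintegral do rewrite -mulN1r.
  by rewrite RintegralZl ?mulN1r//; exact: normal_integrable.
lra.
Qed.

End normal_laws.

Lemma ae_eq_measure disp (T : measurableType disp) (R : realType)
    (P : {measure set T -> \bar R}) (A B : set T) : measurable A -> measurable B ->
  {ae P, forall x, A x <-> B x} -> P A = P B.
Proof.
move=> mA mB AB; rewrite -[A]setIT -[B]setIT -!integral_indic//.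
apply: ae_eq_integral => //; [exact/measurable_EFinP..|].
apply: filterS AB => x AB _; rewrite !indicE.
by congr (_%:R%:E); congr nat_of_bool; apply/idP/idP; rewrite !inE => /AB.
Qed.

(** * The quantile map as an increasing transport *)

Section transport.
Context (R : realType).
Notation mu1 := (@lebesgue_measure R).
Notation stdn := (normal_density (0 : R) 1).
Notation pushes11 := (@pushes _ _ (measurableTypeR R) (measurableTypeR R) R).
Implicit Types (g : density mu1) (x y z : R) (r : R -> R) (I : set R).

(** [I] is an open interval of full mass on which [r] is nondecreasing and continuous; off [I], [r]
    is only measurable. The interface serves both the quantile map and, for normal laws, the
    standardization on the whole line. *)
Record transport g r I : Prop := Transport {
  tr_push : pushes11 r (law g) (law stdn);
  tr_ae : {ae law g, forall x, I x};
  tr_open : open I;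
  tr_itv : forall x y z, I x -> I z -> x <= y <= z -> I y;
  tr_nd : forall x y, I x -> I y -> x <= y -> r x <= r y;
  tr_cont : forall x, I x -> {for x, continuous r} }.

Definition cdf_range g : set R := [set x | 0 < cdfL g x < 1].

Definition quantile_map g : R -> R := (@Phiinv R \o cdfL g) \_ (cdf_range g).

Lemma quantile_mapE g x : cdf_range g x -> quantile_map g x = Phiinv (cdfL g x).
Proof. by move=> Ix; rewrite /quantile_map patchE mem_set. Qed.

Lemma cdf_range_open g : open (cdf_range g).
Proof.
have -> : cdf_range g = cdfL g @^-1` `]0, 1[%classic.
  by apply/seteqP; split=> x /=; rewrite in_itv.
by apply: open_comp => // x _; exact: cdfL_continuous.
Qed.

Lemma measurable_quantile_map g : measurable_fun setT (quantile_map g).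
Proof.
have mI : measurable (cdf_range g) by apply: open_measurable; exact: cdf_range_open.
apply/(measurable_restrictT _ mI).
apply: open_continuous_measurable_fun; first exact: cdf_range_open.
move=> x /[!inE] Ix; apply: continuous_comp; first exact: cdfL_continuous.
apply: differentiable_continuous; apply/derivable1_diffP.
by case: (is_derive_Phiinv Ix).
Qed.

Lemma quantile_map_le g x z : cdf_range g x ->
  (quantile_map g x <= z) = (cdfL g x <= Phi z).
Proof.
move=> Ix; rewrite quantile_mapE// -[z in LHS](PhiK z) !leNgt Phiinv_mono//.
exact: Phi01.
Qed.

(** The sets where the distribution function vanishes or equals 1 lie in sets of mass
    [Num.min e 2^-1] for every [e > 0]; the cap keeps the level inside []0, 1[]. *)
Lemma cdf_range_ae g : {ae law g, forall x, cdf_range g x}.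
Proof.
have mI : measurable (cdf_range g) by apply: open_measurable; exact: cdf_range_open.
exists (~` cdf_range g); split => //; first exact: measurableC.
have mG : measurable_fun setT (cdfL g) by exact: nondecreasing_measurable (@cdfL_nd R g).
have mle u : measurable [set x | cdfL g x <= u].
  have := mG measurableT _ (measurable_itv `]-oo, u]); rewrite setTI.
  by congr measurable; apply/seteqP; split=> y /=; rewrite in_itv.
have mge u : measurable [set x | u <= cdfL g x].
  have := mG measurableT _ (measurable_itv `[u, +oo[); rewrite setTI.
  by congr measurable; apply/seteqP; split=> y /=; rewrite in_itv/= andbT.
have h0 : law g [set x | cdfL g x <= 0] = 0%E.
  apply/eqP; rewrite eq_le measure_ge0 andbT; apply/lee_addgt0Pr => e e0.
  have m0 : 0 < Num.min e 2^-1 by rewrite lt_min e0/= invr_gt0 ltr0n.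
  have m1 : Num.min e 2^-1 < 1 by rewrite gt_min; apply/orP; right; lra.
  rewrite add0e (@le_trans _ _ (Num.min e 2^-1)%:E) ?lee_fin ?ge_min ?lexx//.
  rewrite -(law_cdf_le g (u := Num.min e 2^-1)) ?m0//.
  apply: le_measure; rewrite ?inE; [exact: mle|exact: mle|move=> x /= x0].
  by rewrite (le_trans x0)// ltW.
have h1 : law g [set x | 1 <= cdfL g x] = 0%E.
  apply/eqP; rewrite eq_le measure_ge0 andbT; apply/lee_addgt0Pr => e e0.
  have m0 : 0 < Num.min e 2^-1 by rewrite lt_min e0/= invr_gt0 ltr0n.
  have m1 : Num.min e 2^-1 < 1 by rewrite gt_min; apply/orP; right; lra.
  have u01 : 0 < 1 - Num.min e 2^-1 < 1 by rewrite subr_gt0 m1 ltrBlDr ltrDl.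
  rewrite add0e (@le_trans _ _ (Num.min e 2^-1)%:E) ?lee_fin ?ge_min ?lexx//.
  have -> : (Num.min e 2^-1)%:E = law g (~` [set x | cdfL g x <= 1 - Num.min e 2^-1]).
    have -> := probability_setC (law g) (mle (1 - Num.min e 2^-1)).
    rewrite -[X in (_ - X)%E]/(law g [set x | cdfL g x <= 1 - Num.min e 2^-1]).
    by rewrite (law_cdf_le g u01) -EFinB subKr.
  apply: le_measure; rewrite ?inE; [exact: mge|apply: measurableC; exact: mle|].
  by move=> x /= x1 x2; move: (le_trans x1 x2); lra.
apply/eqP; rewrite eq_le measure_ge0 andbT.
have -> : ~` cdf_range g = [set x | cdfL g x <= 0] `|` [set x | 1 <= cdfL g x].
  apply/seteqP; split=> x /=.
    by move/negP; rewrite negb_and -!leNgt => /orP.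
  by move=> h /andP[a b]; case: h => h; [move: a|move: b]; rewrite ltNge h.
have e := @measureU0 _ (measurableTypeR R) R (law g) _ _ (mle 0) (mge 1) h1.
by have := etrans e h0; move=> ->.
Qed.

(** Rays determine the image law: up to a null set [quantile_map g x <= z] means
    [cdfL g x <= Phi z], an event of mass [Phi z]. *)
Lemma quantile_transport g : transport g (quantile_map g) (cdf_range g).
Proof.
have mQ := measurable_quantile_map g.
split.
- split=> // B mB.
  apply: (@ray_measure_unique R (law stdn)
    (measure_function_pushforward__canonical__measure_function_Measure (law g)
       (mQ : measurable_fun setT (quantile_map g : _ -> measurableTypeR R)))) => //.
    by rewrite -ge0_fin_numE// fin_num_measure.
  move=> z; transitivity (Phi z)%:E; first exact/esym/cdfLE.
  rewrite -(law_cdf_le g (Phi01 z)); apply: ae_eq_measure.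
  - have := nondecreasing_measurable measurableT (@cdfL_nd R g).
    move=> /(_ measurableT _ (measurable_itv `]-oo, Phi z])); rewrite setTI.
    by congr measurable; apply/seteqP; split=> y /=; rewrite in_itv.
  - by have := mQ measurableT _ (measurable_itv `]-oo, z]); rewrite setTI.
  - have := cdf_range_ae g; apply: filterS; first exact: (ae_filter_ringOfSetsType (law g)).
    move=> x Ix.
    by rewrite /= in_itv/= quantile_map_le.
- exact: cdf_range_ae.
- exact: cdf_range_open.
- move=> x y z /andP[x0 _] /andP[_ z1] /andP[xy yz]; apply/andP; split.
    by rewrite (lt_le_trans x0)// cdfL_nd.
  by rewrite (le_lt_trans _ z1)// cdfL_nd.
- move=> x y Ix Iy xy; rewrite quantile_map_le// [in leRHS]quantile_mapE//.
  by rewrite PhiinvK// cdfL_nd.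
- move=> x Ix.
  have near_eq : \forall y \near x, (@Phiinv R \o cdfL g) y = quantile_map g y.
    have nI : \forall y \near x, cdf_range g y.
      by apply: open_nbhs_nbhs; split=> //; exact: cdf_range_open.
    by apply: filterS nI => y Iy; rewrite quantile_mapE.
  have cc : (@Phiinv R \o cdfL g) y @[y --> x] --> (@Phiinv R \o cdfL g) x.
    apply: continuous_comp; first exact: cdfL_continuous.
    apply: differentiable_continuous; apply/derivable1_diffP.
    by case: (is_derive_Phiinv Ix).
  suff : quantile_map g y @[y --> x] --> quantile_map g x by [].
  rewrite (quantile_mapE Ix).
  apply: cvg_trans cc; apply: near_eq_cvg.
  by apply: filterS near_eq => y ->.
Qed.

(** Serves the converse of the equality case: with an affine transport the score moment can be
    computed exactly. *)
Lemma normal_transport (m s : R) : 0 < s ->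
  transport (normal_density m s) (fun x => (x - m) / s) setT.
Proof.
move=> s0; split=> //.
- by apply: pushes_normalV; rewrite gt_eqF.
- exact: aeW.
- exact: openT.
- by move=> x y _ _ xy; rewrite ler_wpM2r ?invr_ge0 ?(ltW s0)// lerB.
- move=> x _; apply: cvgM; last exact: cvg_cst.
  by apply: cvgB; [exact: cvg_id|exact: cvg_cst].
Qed.

End transport.

Lemma is_derive_growth (R : realType) (H : R -> R) (x l : R) :
  is_derive x 1 H l ->
  n.+1%:R * (H (x + n.+1%:R^-1) - H x) @[n --> \oo] --> l.
Proof.
move=> [dH HE]; have lim : h^-1 *: (H (h *: 1 + x) - H x) @[h --> (0 : R)^'] --> l.
  by rewrite -HE; exact: dH.
have c : (fun n : nat => n.+1%:R^-1 : R) @ \oo --> (0 : R)^'.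
  move=> A; rewrite /dnbhs /within /= => A0.
  have h : \forall n \near \oo, (n.+1%:R^-1 : R) != 0 -> A n.+1%:R^-1.
    exact: (@cvg_harmonic R _ A0).
  suff : \forall n \near \oo, A (n.+1%:R^-1 : R) by [].
  by apply: filterS h => n; apply; rewrite invr_eq0 pnatr_eq0.
have := cvg_comp _ _ c lim; apply: cvg_trans.
apply: near_eq_cvg; near=> n => /=.
by rewrite invrK; congr (_ * (H _ - _)); rewrite /GRing.scale/= mulr1 addrC.
Unshelve. all: by end_near. Qed.

Lemma limn_einf_ge0 (R : realType) (u : (\bar R)^nat) :
  (forall n, (0 <= u n)%E) -> (0 <= limn_einf u)%E.
Proof.
move=> u0; rewrite limn_einf_lim; apply: lime_ge; first exact: is_cvg_einfs.
by apply: nearW => n; apply: le_ereal_inf_tmp => _ [m _ <-].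
Qed.

Lemma measurable_fun_limn_einf disp (T : measurableType disp) (R : realType)
    (f : (T -> \bar R)^nat) : (forall n, measurable_fun setT (f n)) ->
  measurable_fun setT (fun x => limn_einf (f ^~ x)).
Proof.
move=> mf; apply: measurableT_comp => //.
by apply: measurable_fun_limn_esup => n; exact: measurableT_comp.
Qed.

Lemma cvg_EFinT (R : realType) (u : nat -> R) (l : R) :
  u n @[n --> \oo] --> l -> (u n)%:E @[n --> \oo] --> l%:E.
Proof. by move=> ul; apply: cvg_EFin => //; exact: nearW. Qed.

(** * Truncated transports and Fatou's bound on their growth *)

Section truncation.
Context (R : realType).
Notation mu1 := (@lebesgue_measure R).
Notation stdn := (normal_density (0 : R) 1).
Variables (g : density mu1) (M : R).
Hypothesis M0 : 0 < M.
Implicit Types (x y z u : R).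

(** Clipping acts on the level, before [Phiinv]. The truncated map is then nondecreasing and bounded
    on the whole line, including where the level is 0 or 1 and [quantile_map] takes its default
    value. *)
Definition clip u : R := Num.max (Phi (- M)) (Num.min (Phi M) u).

Definition trunc_map x : R := Phiinv (clip (cdfL g x)).

Lemma Phi_le x y : (Phi x <= Phi y) = (x <= y).
Proof. by rewrite !leNgt Phi_mono. Qed.

Let NM : - M <= M. Proof. by rewrite (le_trans _ (ltW M0))// oppr_le0 ltW. Qed.

Lemma clip_itv u : Phi (- M) <= clip u <= Phi M.
Proof.
by rewrite /clip le_max lexx/= ge_max Phi_le NM/= ge_min lexx.
Qed.

Lemma clip01 u : 0 < clip u < 1.
Proof.
have /andP[h1 h2] := clip_itv u.
have /andP[k1 _] := Phi01 (- M); have /andP[_ k2] := Phi01 M.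
by rewrite (lt_le_trans k1)//= (le_lt_trans h2).
Qed.

Lemma Phiinv_le u v : 0 < u < 1 -> 0 < v < 1 -> (Phiinv u <= Phiinv v) = (u <= v).
Proof. by move=> u01 v01; rewrite !leNgt Phiinv_mono. Qed.

Lemma clip_nd u v : u <= v -> clip u <= clip v.
Proof.
move=> uv; rewrite /clip ge_max le_max lexx/= le_max.
apply/orP; right; rewrite le_min ge_min lexx/= ge_min uv orbT//.
Qed.

Lemma trunc_map_nd : {homo trunc_map : x y / x <= y}.
Proof. by move=> x y xy; rewrite Phiinv_le ?clip01// clip_nd// cdfL_nd. Qed.

Lemma measurable_trunc_map : measurable_fun setT trunc_map.
Proof. exact: nondecreasing_measurable trunc_map_nd. Qed.

Lemma trunc_map_bound x : `|trunc_map x| <= M.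
Proof.
have /andP[h1 h2] := clip_itv (cdfL g x).
rewrite ler_norml; apply/andP; split.
- by rewrite -[leLHS]PhiK Phiinv_le ?clip01 ?Phi01.
- by rewrite -[leRHS]PhiK Phiinv_le ?clip01 ?Phi01.
Qed.

Lemma clip_id u : Phi (- M) <= u <= Phi M -> clip u = u.
Proof. by move=> /andP[h1 h2]; rewrite /clip min_r// max_r. Qed.

Lemma trunc_mapE x : cdf_range g x -> `|quantile_map g x| <= M ->
  trunc_map x = quantile_map g x.
Proof.
move=> Ix; rewrite ler_norml quantile_mapE// => /andP[h1 h2].
by rewrite /trunc_map clip_id// -(PhiinvK Ix) !Phi_le h1.
Qed.

Lemma trunc_map_le x : cdf_range g x -> `|trunc_map x| <= `|quantile_map g x|.
Proof.
move=> Ix; have [rM|rM] := leP `|quantile_map g x| M; first by rewrite trunc_mapE.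
exact: le_trans (trunc_map_bound x) (ltW rM).
Qed.

Definition trunc_good : set R := [set x | cdf_range g x /\ `|quantile_map g x| < M].

(** The chain-rule derivative of [Phiinv \o cdfL g] strictly inside the truncation, and 0
    elsewhere. *)
Definition trunc_slope x : R :=
  (g x / phi (quantile_map g x)) * (\1_trunc_good x).

Lemma measurable_trunc_good : measurable trunc_good.
Proof.
have -> : trunc_good = cdf_range g `&` (quantile_map g @^-1` `]- M, M[%classic).
  apply/seteqP; split=> x /=; rewrite in_itv/= -ltr_norml// => -[? ?]//.
apply: measurableI; first by apply: open_measurable; exact: cdf_range_open.
have := measurable_quantile_map g measurableT (measurable_itv `]- M, M[).
by rewrite setTI.
Qed.

Lemma measurable_phi : measurable_fun setT (@phi R).
Proof. by apply: continuous_measurable_fun; exact: phi_continuous. Qed.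

Lemma measurable_trunc_slope : measurable_fun setT trunc_slope.
Proof.
apply: measurable_funM; last by apply: measurable_indic; exact: measurable_trunc_good.
apply: measurable_funM; first exact: measurable_pdf1.
have mV : measurable_fun setT (fun z : R => (phi z)^-1).
  apply: continuous_measurable_fun => z; apply: cvgV; last exact: phi_continuous.
  by rewrite gt_eqF// phi_gt0.
exact: (measurableT_comp mV (measurable_quantile_map g)).
Qed.

Lemma trunc_slope_ge0 x : 0 <= trunc_slope x.
Proof. by rewrite mulr_ge0// divr_ge0 ?pdf_ge0// ltW// phi_gt0. Qed.

Lemma cdfL_is_derive : {ae law g, forall x, is_derive x 1 (cdfL g) (g x)}.
Proof.
have ig y : mu1.-integrable `]-oo, y] (EFin \o g).
  by apply: integrableS (pdf_integrable g).
have lg : locally_integrable setT (g : R -> R).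
  have := integrable_locally measurableT (pdf_integrable g).
  by rewrite patch_setT.
have [N [mN N0 sub]] := FTC1Ny ig lg.
exists N; split=> //.
  by have /null_content_dominatesP := law_dominates g; apply.
move=> x Nx; apply: sub => /= -[h1 h2]; apply: Nx.
by apply: DeriveDef => //; rewrite -derive1E h2.
Qed.

Lemma trunc_growth : {ae law g, forall x, trunc_good x ->
  n.+1%:R * (trunc_map (x + n.+1%:R^-1) - trunc_map x) @[n --> \oo] --> trunc_slope x}.
Proof.
have := cdfL_is_derive; apply: filterS; first exact: (ae_filter_ringOfSetsType (law g)).
move=> x dG [Ix rx]; apply: is_derive_growth.
have dH := is_derive1_comp (is_derive_Phiinv Ix) dG.
(* Strictly inside the bounds, continuity of the distribution function keeps the truncation inactive
   near [x]. *)
have near_eq : \forall y \near x, (@Phiinv R \o cdfL g) y = trunc_map y.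
  have : \forall y \near x, Phi (- M) <= cdfL g y <= Phi M.
    move: rx; rewrite ltr_norml quantile_mapE// => /andP[r1 r2].
    near=> y; apply/andP; split; apply/ltW; near: y.
      apply: (cvgr_gt _ (@cdfL_continuous R g x)).
      by rewrite -(PhiinvK Ix) Phi_mono.
    apply: (cvgr_lt _ (@cdfL_continuous R g x)).
    by rewrite -(PhiinvK Ix) Phi_mono.
  by apply: filterS => y Gy; rewrite /trunc_map clip_id.
have := near_eq_is_derive near_eq dH; rewrite /trunc_slope indicE mem_set// mulr1.
by rewrite quantile_mapE// mulrC.
Unshelve. all: by end_near. Qed.

(** Monotonicity makes the growth quotients nonnegative, as Fatou requires. Their limit is known
    a.e. inside [trunc_good]; outside it the slope is 0, which nonnegativity already covers. *)
Lemma trunc_fatou (J : R) :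
  n.+1%:R * (\int[law g]_x trunc_map (x + n.+1%:R^-1) - \int[law g]_x trunc_map x)
    @[n --> \oo] --> J ->
  (\int[law g]_x (trunc_slope x)%:E <= J%:E)%E.
Proof.
move=> lim; pose D n x := n.+1%:R * (trunc_map (x + n.+1%:R^-1) - trunc_map x).
have mts n : measurable_fun setT (fun x : R => trunc_map (x + n.+1%:R^-1)).
  by apply: (measurableT_comp measurable_trunc_map); exact: measurable_funD.
have mD n : measurable_fun setT (fun x => (D n x)%:E).
  apply/measurable_EFinP/measurable_funM => //; apply: measurable_funB => //.
  exact: measurable_trunc_map.
have D0 n x : (0 <= (D n x)%:E)%E.
  by rewrite lee_fin mulr_ge0// subr_ge0 trunc_map_nd// lerDl invr_ge0.
have it n : (law g).-integrable setT (EFin \o (fun x => trunc_map (x + n.+1%:R^-1))).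
  exact: (@bounded_integrable R _ (measurableTypeR R) (law g) _ M (mts n) (fun x => trunc_map_bound _)).
have i0 : (law g).-integrable setT (EFin \o trunc_map).
  exact: (@bounded_integrable R _ (measurableTypeR R) (law g) _ M measurable_trunc_map trunc_map_bound).
have DE n : (\int[law g]_x (D n x)%:E = (n.+1%:R *
    (\int[law g]_x trunc_map (x + n.+1%:R^-1) - \int[law g]_x trunc_map x))%:E)%E.
  rewrite -RintegralB// -RintegralZl//.
    rewrite /Rintegral fineK//; apply: integrable_fin_num => //.
    exact: (integrableZl measurableT _ (integrableB measurableT (it n) i0)).
  exact: (integrableB measurableT (it n) i0).
have limE : (\int[law g]_x (D n x)%:E)%E @[n --> \oo] --> J%:E.
  by under eq_fun do rewrite DE; exact: cvg_EFinT lim.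
have JE : limn_einf (fun n => \int[law g]_x (D n x)%:E)%E = J%:E.
  rewrite is_cvg_limn_einfE; first exact/cvg_lim.
  by apply/cvg_ex; exists J%:E.
rewrite -JE; apply: le_trans (fatou (law g) measurableT mD (fun n x _ => D0 n x)).
apply: ae_ge0_le_integral => //.
- by move=> x _; rewrite lee_fin trunc_slope_ge0.
- by apply/measurable_EFinP; exact: measurable_trunc_slope.
- by move=> x _; apply: limn_einf_ge0 => n; exact: D0.
- exact: measurable_fun_limn_einf.
have := trunc_growth; apply: filterS; first exact: (ae_filter_ringOfSetsType (law g)).
move=> x gx _; have [Gx|nGx] := pselect (trunc_good x); last first.
  by rewrite /trunc_slope indicE memNset// mulr0 limn_einf_ge0.
have lx : (D n x)%:E @[n --> \oo] --> (trunc_slope x)%:E by exact: cvg_EFinT (gx Gx).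
rewrite is_cvg_limn_einfE; last by apply/cvg_ex; exists (trunc_slope x)%:E.
by have /cvg_lim -> := lx.
Qed.

End truncation.

Lemma mul_integrable disp (R : realType) (T : measurableType disp) (P : probability T R)
    (a b : T -> R) : measurable_fun setT a -> measurable_fun setT b ->
  P.-integrable setT (EFin \o (fun x => a x ^+ 2)) ->
  P.-integrable setT (EFin \o (fun x => b x ^+ 2)) ->
  P.-integrable setT (EFin \o (fun x => a x * b x)).
Proof.
move=> ma mb ia ib; apply: (le_integrable measurableT _ _ (integrableD measurableT ia ib)).
  by apply/measurable_EFinP; exact: measurable_funM.
move=> t _ /=; rewrite lee_fin [leRHS]ger0_norm ?addr_ge0 ?sqr_ge0//.
rewrite ler_norml; have := sqr_ge0 (a t - b t); have := sqr_ge0 (a t + b t).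
have := sqr_ge0 (a t); have := sqr_ge0 (b t).
rewrite sqrrD sqrrB; lra.
Qed.

(** * Covariance of a variable with its transport *)

Section transport_moments.
Context (R : realType).
Notation mu1 := (@lebesgue_measure R).
Notation stdn := (normal_density (0 : R) 1).
Variables (g : density mu1) (r : R -> R) (I : set R).
Hypothesis tr : transport g r I.
Implicit Types (x y z : R).

Lemma transport_measurable : measurable_fun setT r.
Proof. by case: (tr_push tr). Qed.

Lemma transport_integrable : (law g).-integrable setT (EFin \o r).
Proof.
have mid : measurable_fun setT (fun z : measurableTypeR R => (z : R)%:E).
  by apply/measurable_EFinP; exact: measurable_id.
exact: ((integrable_pushes (tr_push tr) mid).1 (@normal_integrable R)).
Qed.

Lemma transport_sq_integrable :
  (law g).-integrable setT (EFin \o (fun x => r x ^+ 2)).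
Proof.
have msq : measurable_fun setT (fun z : measurableTypeR R => ((z : R) ^+ 2)%:E).
  by apply/measurable_EFinP; apply: measurable_funX; exact: measurable_id.
exact: ((integrable_pushes (tr_push tr) msq).1 (@normal_sq_integrable R)).
Qed.

Lemma transport_mean : \int[law g]_x r x = 0.
Proof.
by rewrite -(normal_mean R) (Rintegral_pushes (tr_push tr) (F := fun z => z)).
Qed.

Lemma transport_sq : (\int[law g]_x (r x ^+ 2)%:E = 1)%E.
Proof.
rewrite -(normal_sq R) (integral_pushes (tr_push tr) (F := fun z => (z ^+ 2)%:E))//.
by apply/measurable_EFinP; exact: measurable_funX.
Qed.

Hypothesis sqg : (law g).-integrable setT (EFin \o (fun x : R => x ^+ 2)).

Lemma law_id_integrable : (law g).-integrable setT (EFin \o (fun x : R => x)).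
Proof. exact: (@sq_integrable _ (measurableTypeR R) R (law g) (fun z => z) (@measurable_id _ _ _) sqg). Qed.

Lemma transport_mul_integrable :
  (law g).-integrable setT (EFin \o (fun x => r x * x)).
Proof.
by apply: (@mul_integrable _ R (measurableTypeR R) (law g)) => //;
  [exact: transport_measurable|exact: transport_sq_integrable].
Qed.

(** A covariance, since [r] has mean 0 under [law g]. *)
Definition energy : R := \int[law g]_x (r x * x).

Variable m : R.
Hypothesis (Im : I m) (rm : r m = 0).

Let ae_g := ae_filter_ringOfSetsType (law g).

(** [phi (r x)] is the integral of |z| over the normal tail beyond [r x]; pulled back by [r], that
    tail lies a.e. inside the tail beyond [x]. It is only an inequality because [r] may be flat next
    to [x]. *)
Lemma transport_between x : I x ->
  ((phi (r x))%:E <= \int[law g]_y (`|r y| * \1_(between m) (x, y))%:E)%E.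
Proof.
move=> Ix; have mr := transport_measurable.
have mb : measurable_fun setT (fun y => (`|r y| * \1_(between m) (x, y))%:E).
  apply/measurable_EFinP/measurable_funM; first exact: measurableT_comp.
  apply: (measurableT_comp (f := fun p : R * R => \1_(between m) p : R)).
    by apply: measurable_indic; exact: measurable_between.
  exact: measurable_fun_pair.
have mabs : measurable_fun setT (fun y => `|r y|) by exact: measurableT_comp.
have [mx|xm] := leP m x.
- have r0 : 0 <= r x by rewrite -rm (tr_nd tr).
  have mt : measurable_fun setT (fun z : R => (`|z| * (r x < z)%R%:R)%:E).
    apply/measurable_EFinP/measurable_funM; first exact: normr_measurable.
    exact: measurable_ltr_ind.
  have mt' : measurable_fun setT (fun y : R => (`|r y| * (r x < r y)%R%:R)%:E).
    by apply/measurable_EFinP/measurable_funM => //; exact: measurable_ltr_ind.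
  rewrite -normal_tail_pos// (ge0_integral_pushes (tr_push tr) mt); last first.
    by move=> z; rewrite lee_fin mulr_ge0.
  apply: ae_ge0_le_integral; [by []|by move=> y _; rewrite lee_fin mulr_ge0|
    exact: mt'|by move=> y _; rewrite lee_fin mulr_ge0|exact: mb|].
  have := tr_ae tr; apply: filterS; first exact: ae_g.
  move=> y Iy _; rewrite lee_fin ler_wpM2l// indicE.
  case: (ltP (r x) (r y)) => rxy; last by case: (_ \in _).
  rewrite mem_set// /between/= mx/=; apply/orP; left.
  by rewrite ltNge; apply/negP => /(tr_nd tr Iy Ix); rewrite leNgt rxy.
- have r0 : r x <= 0 by rewrite -rm (tr_nd tr)// ltW.
  have mt : measurable_fun setT (fun z : R => (`|z| * (z < r x)%R%:R)%:E).
    apply/measurable_EFinP/measurable_funM; first exact: normr_measurable.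
    exact: measurable_ltr_ind.
  have mt' : measurable_fun setT (fun y : R => (`|r y| * (r y < r x)%R%:R)%:E).
    by apply/measurable_EFinP/measurable_funM => //; exact: measurable_ltr_ind.
  rewrite -normal_tail_neg// (ge0_integral_pushes (tr_push tr) mt); last first.
    by move=> z; rewrite lee_fin mulr_ge0.
  apply: ae_ge0_le_integral; [by []|by move=> y _; rewrite lee_fin mulr_ge0|
    exact: mt'|by move=> y _; rewrite lee_fin mulr_ge0|exact: mb|].
  have := tr_ae tr; apply: filterS; first exact: ae_g.
  move=> y Iy _; rewrite lee_fin ler_wpM2l// indicE.
  case: (ltP (r y) (r x)) => rxy; last by case: (_ \in _).
  rewrite mem_set// /between/= xm andbT; apply/orP; right.
  by rewrite ltNge; apply/negP => /(tr_nd tr Ix Iy); rewrite leNgt rxy.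
Qed.

Lemma measurable_phi_transport : measurable_fun setT (fun x => phi (r x) * \1_I x).
Proof.
apply: measurable_funM; last first.
  by apply: measurable_indic; apply: open_measurable; exact: tr_open tr.
exact: (measurableT_comp (@measurable_phi R) transport_measurable).
Qed.

(* phi (r x) is the mean of |r| over the tail beyond x; then Tonelli. *)
Lemma phi_energy : (\int[mu1]_x (phi (r x) * \1_I x)%:E <= energy%:E)%E.
Proof.
have mr := transport_measurable.
have mK : measurable_fun setT (fun p : R * R => (`|r p.2| * \1_(between m) p)%:E).
  apply/measurable_EFinP/measurable_funM.
    by apply: measurableT_comp => //; exact: (measurableT_comp mr).
  by apply: measurable_indic; exact: measurable_between.
apply: (@le_trans _ _ (\int[mu1]_x \int[law g]_y (`|r y| * \1_(between m) (x, y))%:E)%E).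
  apply: ge0_le_integral => //.
  - by move=> x _; rewrite lee_fin mulr_ge0// ltW// phi_gt0.
  - by apply/measurable_EFinP; exact: measurable_phi_transport.
  - exact: (@measurable_fun_fubini_tonelli_F _ _ (measurableTypeR R) (measurableTypeR R) R
      (law g) (fun p => (`|r p.2| * \1_(between m) p)%:E) mK
      (fun p => ltac:(rewrite lee_fin mulr_ge0//))).
  - move=> x _; have [Ix|nIx] := pselect (I x).
      by rewrite indicE mem_set// mulr1; exact: transport_between.
    by rewrite indicE memNset// mulr0 integral_ge0// => y _; rewrite lee_fin mulr_ge0.
rewrite tonelli_between//.
have i1 : (law g).-integrable setT (EFin \o (fun y => m * r y)).
  exact: (integrableZl measurableT m transport_integrable).
have i2 : (law g).-integrable setT (EFin \o (fun y => r y * y - m * r y)).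
  exact: (integrableB measurableT transport_mul_integrable i1).
(* Subtracting [m * r y], of mean 0, turns the integrand into [r y * (y - m)], nonnegative on [I]
   because [r] is nondecreasing and vanishes at [m]. *)
have -> : energy = \int[law g]_y (r y * y - m * r y).
  rewrite RintegralB//; last exact: transport_mul_integrable.
  rewrite RintegralZl//; last exact: transport_integrable.
  by rewrite transport_mean mulr0 subr0.
rewrite /Rintegral fineK; last by apply: integrable_fin_num.
rewrite le_eqVlt; apply/orP; left; apply/eqP; apply: ae_eq_integral => //.
- apply/measurable_EFinP/measurable_funM; first exact: measurableT_comp.
  by apply: measurableT_comp => //; exact: measurable_funB.
- exact: measurable_int i2.
have := tr_ae tr; apply: filterS; first exact: ae_g.
move=> y Iy _; congr EFin; rewrite -normrM ger0_norm; first by ring.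
have [ym|my] := leP y m.
  by rewrite mulr_le0 ?subr_le0// -rm (tr_nd tr).
by rewrite mulr_ge0 ?subr_ge0 ?(ltW my)// -rm (tr_nd tr)// ltW.
Qed.

End transport_moments.

Lemma integral_cst_indic disp (T : measurableType disp) (R : realType)
    (P : {measure set T -> \bar R}) (A : set T) : measurable A ->
  (\int[P]_x (\1_A x)%:E = P A)%E.
Proof. by move=> mA; rewrite integral_indic// setIT. Qed.

(** * Lower bound on the score moment of a transport *)

Section score_bound.
Context (R : realType).
Notation mu1 := (@lebesgue_measure R).
Variable g : density mu1.
Hypothesis sqg : (law g).-integrable setT (EFin \o (fun x : R => x ^+ 2)).
Let r := quantile_map g.
Let I := cdf_range g.
Let e := energy g r.

(** [2 * c * g] is bounded pointwise: by expanding [(g - c * phi r)^2 / phi r >= 0] where |r| < M,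
    and by [r^2 >= M^2] elsewhere. As [r] has second moment 1, truncation costs [2 * c / M ^+ 2]. *)
Lemma trunc_energy_bound (M c J : R) : 0 < M -> 0 < c ->
  n.+1%:R * (\int[law g]_x trunc_map g M (x + n.+1%:R^-1)
    - \int[law g]_x trunc_map g M x) @[n --> \oo] --> J ->
  2 * c <= J + c ^+ 2 * e + 2 * c / M ^+ 2.
Proof.
move=> M0 c0 /(trunc_fatou M0) sJ; have tr := quantile_transport g.
(* A median of [law g]: [r] sends it to 0, which is the base point that [phi_energy] asks for. *)
have [m mE] : exists m, cdfL g m = Phi 0 by apply: cdfL_surj; exact: Phi01.
have Im : I m by rewrite /I/cdf_range/= mE; exact: Phi01.
have rm : r m = 0 by rewrite /r quantile_mapE// mE PhiK.
have eb := phi_energy tr sqg Im rm.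
have mg := measurable_pdf1 g.
have mI : measurable I by apply: open_measurable; exact: tr_open tr.
have mI1 : measurable_fun setT (\1_I : R -> R) by exact: measurable_indic.
have ms := measurable_trunc_slope g M.
have mr := transport_measurable tr.
have mr2 : measurable_fun setT (fun x => r x ^+ 2) by exact: measurable_funX.
have mph := measurable_phi_transport tr.
have key : (\int[mu1]_x (2 * c * (g x * \1_I x))%:E <= \int[mu1]_x
   ((trunc_slope g M x * g x)%:E + ((c ^+ 2)%:E * (phi (r x) * \1_I x)%:E
     + (2 * c / M ^+ 2)%:E * (r x ^+ 2 * g x)%:E)))%E.
  apply: ge0_le_integral => //.
  - by move=> x _; rewrite lee_fin mulr_ge0 ?mulr_ge0 ?pdf_ge0// ltW.
  - by apply/measurable_EFinP/measurable_funM => //; exact: measurable_funM.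
  - apply: emeasurable_funD.
      by apply/measurable_EFinP; exact: measurable_funM.
    apply: emeasurable_funD; apply: emeasurable_funM => //; apply/measurable_EFinP => //.
    exact: measurable_funM.
  move=> x _; rewrite -!EFinM -!EFinD lee_fin.
  have g0 := pdf_ge0 g x; have f0 := phi_gt0 (r x).
  have c2 : 0 <= 2 * c / M ^+ 2 * (r x ^+ 2 * g x).
    apply: mulr_ge0; last by rewrite mulr_ge0 ?sqr_ge0.
    by rewrite divr_ge0 ?sqr_ge0// mulr_ge0// ltW.
  have [Ix|nIx] := pselect (I x); last first.
    rewrite indicE memNset// !mulr0 add0r addr_ge0// mulr_ge0 ?pdf_ge0//.
    exact: trunc_slope_ge0.
  rewrite indicE mem_set// !mulr1.
  have [rM|Mr] := ltP `|r x| M.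
    have -> : trunc_slope g M x = g x / phi (r x).
      by rewrite /trunc_slope indicE mem_set ?mulr1.
    have : 0 <= (g x - c * phi (r x)) ^+ 2 / phi (r x) by rewrite divr_ge0 ?sqr_ge0 ?ltW.
    have -> : (g x - c * phi (r x)) ^+ 2 / phi (r x) =
       g x / phi (r x) * g x + c ^+ 2 * phi (r x) - 2 * c * g x.
      by field; rewrite gt_eqF.
    move: c2; lra.
  have -> : trunc_slope g M x = 0.
    by rewrite /trunc_slope indicE memNset ?mulr0// => -[_]; rewrite ltNge Mr.
  rewrite mul0r add0r; apply: (@le_trans _ _ (2 * c / M ^+ 2 * (r x ^+ 2 * g x))); last first.
    by rewrite lerDr mulr_ge0 ?sqr_ge0// ltW.
  rewrite mulrA ler_wpM2r// -mulrA ler_peMr ?mulr_ge0 ?(ltW c0)//.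
  by rewrite mulrC ler_pdivlMr ?exprn_gt0// mul1r -[leRHS]real_normK ?num_real// lerXn2r ?nnegrE ?(ltW M0).
have gI : (\int[mu1]_x (2 * c * (g x * \1_I x))%:E = (2 * c)%:E)%E.
  under eq_integral do rewrite EFinM.
  rewrite ge0_integralZl//; last 3 first.
  - by apply/measurable_EFinP; exact: measurable_funM.
  - by move=> x _; rewrite lee_fin mulr_ge0// pdf_ge0.
  - by rewrite lee_fin mulr_ge0// ltW.
  rewrite -[RHS]mule1; congr (_ * _)%E.
  have lI : law g I = 1%E.
    rewrite -[RHS](@probability_setT _ (measurableTypeR R) R (law g)).
    apply: ae_eq_measure => //; have := tr_ae tr; apply: filterS.
      exact: (ae_filter_ringOfSetsType (law g)).
    by move=> x Ix; split.
  have mIE : measurable_fun setT (fun x : measurableTypeR R => ((\1_I x : R))%:E).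
    exact/measurable_EFinP.
  rewrite -lI -[RHS](@integral_cst_indic _ (measurableTypeR R) R (law g) I)//.
  rewrite (integral_law g mIE); apply: eq_integral => x _.
  by rewrite -EFinM mulrC.
have p1 x : (0 <= (trunc_slope g M x * g x)%:E)%E.
  by rewrite lee_fin mulr_ge0 ?pdf_ge0// trunc_slope_ge0.
have p2 x : (0 <= (phi (r x) * \1_I x)%:E)%E.
  by rewrite lee_fin mulr_ge0// ltW// phi_gt0.
have p3 x : (0 <= (r x ^+ 2 * g x)%:E)%E by rewrite lee_fin mulr_ge0 ?sqr_ge0 ?pdf_ge0.
have m1 : measurable_fun setT (fun x => (trunc_slope g M x * g x)%:E).
  by apply/measurable_EFinP; exact: measurable_funM.
have m2 : measurable_fun setT (fun x => (phi (r x) * \1_I x)%:E) by exact/measurable_EFinP.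
have m3 : measurable_fun setT (fun x => (r x ^+ 2 * g x)%:E).
  by apply/measurable_EFinP; exact: measurable_funM.
have k2 : (0 <= (c ^+ 2)%:E)%E by rewrite lee_fin sqr_ge0.
have k3 : (0 <= (2 * c / M ^+ 2)%:E)%E.
  by rewrite lee_fin divr_ge0 ?sqr_ge0// mulr_ge0// ltW.
have m2' : measurable_fun setT (fun x => (c ^+ 2)%:E * (phi (r x) * \1_I x)%:E)%E.
  exact: emeasurable_funM.
have m3' : measurable_fun setT (fun x => (2 * c / M ^+ 2)%:E * (r x ^+ 2 * g x)%:E)%E.
  exact: emeasurable_funM.
have m23 := emeasurable_funD m2' m3'.
move: key; rewrite gI ge0_integralD//; last by move=> x _; rewrite adde_ge0// mule_ge0.
rewrite ge0_integralD//; [|by move=> x _; rewrite mule_ge0..].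
rewrite ge0_integralZl// ge0_integralZl//.
have s1 : (\int[mu1]_x (trunc_slope g M x * g x)%:E <= J%:E)%E.
  apply: le_trans sJ; rewrite (integral_law g (F := fun x => (trunc_slope g M x)%:E))//.
  exact/measurable_EFinP.
have s3 : (\int[mu1]_x (r x ^+ 2 * g x)%:E = 1)%E.
  rewrite -(transport_sq tr) (integral_law g (F := fun x => (r x ^+ 2)%:E))//.
  exact/measurable_EFinP.
rewrite s3 mule1 => key.
rewrite -lee_fin (le_trans key)// !EFinD addeA leeD2r// leeD//.
by rewrite (EFinM (c ^+ 2)) lee_wpmul2l.
Qed.

(** As the truncation level tends to infinity, [2 * c <= J + c ^+ 2 * e] for every [c > 0]. A
    nonpositive [e] is refuted by c = |J| + 1, and for positive [e] the best choice is
    [c = e^-1]. *)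
Lemma score_lower_bound (J : R) (Jn : nat -> R) : Jn k @[k --> \oo] --> J ->
  (forall k, n.+1%:R * (\int[law g]_x trunc_map g k.+1%:R (x + n.+1%:R^-1)
    - \int[law g]_x trunc_map g k.+1%:R x) @[n --> \oo] --> Jn k) ->
  0 < e /\ e^-1 <= J.
Proof.
move=> JnJ lim.
have h c : 0 < c -> 2 * c <= J + c ^+ 2 * e.
  move=> c0; have b k := trunc_energy_bound (ltr0Sn R k) c0 (lim k).
  have cv : (Jn k + c ^+ 2 * e + 2 * c / k.+1%:R ^+ 2) @[k --> \oo] --> J + c ^+ 2 * e + 2 * c * 0 ^+ 2.
    apply: cvgD; first by apply: cvgD => //; exact: cvg_cst.
    apply: cvgM; first exact: cvg_cst.
    by under eq_fun do rewrite -exprVn expr2; rewrite expr2; apply: cvgM; exact: cvg_harmonic.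
  rewrite expr0n/= mulr0 addr0 in cv.
  by apply: (cvgr_to_ge cv); apply: nearW => k; exact: b.
have e0 : 0 < e.
  rewrite ltNge; apply/negP => e0; have c0 : 0 < `|J| + 1 by rewrite ltr_wpDl.
  have := h _ c0; have : (`|J| + 1) ^+ 2 * e <= 0 by rewrite mulr_ge0_le0 ?sqr_ge0.
  have := ler_norm J; have := normr_ge0 J; lra.
split=> //; have ei : 0 < e^-1 by rewrite invr_gt0.
have := h _ ei; rewrite expr2 -mulrA mulVf ?gt_eqF// mulr1; lra.
Qed.

End score_bound.

(** * Existence of the rank map *)

Section potential.
Context (R : realType).
Notation mu1 := (@lebesgue_measure R).

(** [V] is the signed integral of [r] from a base point. On [[a, b[] a nondecreasing [r] lies
    between its endpoint values; integrating this gives the subgradient inequality, whichever of [x]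
    and [y] is larger. *)
Lemma monotone_potential (r : R -> R) (I : set R) : measurable_fun setT r ->
  (forall x y z, I x -> I z -> x <= y <= z -> I y) ->
  (forall x y, I x -> I y -> x <= y -> r x <= r y) ->
  exists V : R -> R, forall x y, I x -> I y -> V x + r x * (y - x) <= V y.
Proof.
move=> mr Iitv rnd; have [[m Im]|I0] := pselect (exists m, I m); last first.
  by exists (cst 0) => x y Ix; case: I0; exists x.
have itvE a b : a <= b -> mu1 `[a, b[%classic = (b - a)%:E.
  move=> ab; rewrite [LHS](lebesgue_measure_itv `[a, b[)/= lte_fin.
  by case: ltgtP ab => // -> _; rewrite subrr.
have itv_fin a b : (mu1 `[a, b[%classic < +oo)%E.
  rewrite [X in (X < _)%E](lebesgue_measure_itv `[a, b[)/= lte_fin.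
  by case: ifP => // _; rewrite -EFinB ltry.
have ir a b : I a -> I b -> mu1.-integrable `[a, b[ (EFin \o r).
  move=> Ia Ib; apply: measurable_bounded_integrable => //.
  - exact: itv_fin.
  - exact: measurable_funTS.
  - exists (`|r a| + `|r b|); split; first exact: num_real.
    move=> M rM x /=; rewrite in_itv/= => /andP[ax xb].
    have Ix : I x by apply: (Iitv _ _ _ Ia Ib); rewrite ax ltW.
    have := rnd _ _ Ia Ix ax; have := rnd _ _ Ix Ib (ltW xb).
    have := ler_norm (r b); have := ler_norm (- r a); rewrite normrN.
    have := normr_ge0 (r a); have := normr_ge0 (r b).
    rewrite ler_norml; lra.
pose A a b := \int[mu1]_(t in `[a, b[) r t.
have AD a b c : I a -> I c -> a <= b <= c -> A a c = A a b + A b c.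
  move=> Ia Ic /andP[ab bc].
  have E : `[a, c[%classic = `[a, b[%classic `|` `[b, c[%classic.
    rewrite -itv_bndbnd_setU ?bnd_simp//.
  rewrite {1}/A E Rintegral_setU//.
  - by rewrite -E; exact: ir.
  - rewrite disj_set2E; apply/eqP/seteqP; split=> // x [].
    by rewrite /= !in_itv/= => /andP[_ xb] /andP[]; rewrite leNgt xb.
have Age a b : I a -> I b -> a <= b -> r a * (b - a) <= A a b <= r b * (b - a).
  move=> Ia Ib ab.
  have cstA k : \int[mu1]_(t in `[a, b[) cst k t = k * (b - a).
    by rewrite Rintegral_cst// [X in fine X]itvE.
  have icst k : mu1.-integrable `[a, b[ (EFin \o cst k).
    apply: measurable_bounded_integrable => //.
    - exact: itv_fin.
    - exists `|k|; split; first exact: num_real.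
      by move=> M kM x _; apply: ltW.
  rewrite -!cstA; apply/andP; split; apply: le_Rintegral => //; try exact: ir;
    move=> x /=; rewrite in_itv/= => /andP[ax xb];
    (have Ix : I x by apply: (Iitv _ _ _ Ia Ib); rewrite ax ltW).
  - exact: rnd.
  - by apply: rnd => //; exact: ltW.
(* Half-open intervals make adjacent pieces disjoint, so the increment of [V] is the integral over
   [[x, y[] wherever [m] lies. *)
pose V x := if m <= x then A m x else - A x m.
have VA x y : I x -> I y -> x <= y -> V y - V x = A x y.
  move=> Ix Iy xy; rewrite /V; case: (leP m x) => mx; last case: (leP m y) => my.
  - by rewrite (le_trans mx xy) (AD m x y)// ?mx// addrAC subrr add0r.
  - by rewrite opprK addrC -(AD x m y)// (ltW mx) my.
  - by rewrite opprK addrC (AD x y m)// ?xy ?(ltW my)// addrK.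
exists V => x y Ix Iy; case: (leP x y) => xy.
  by rewrite addrC -lerBrDr VA//; case/andP: (Age _ _ Ix Iy xy).
rewrite -lerBrDl -[V y - V x]opprB lerNr VA// ?(ltW xy)//.
have /andP[_] := Age _ _ Iy Ix (ltW xy).
by move/le_trans; apply; rewrite -mulrN opprB.
Qed.

End potential.

Section gradient.
Context (R : realType) (d : nat).
Implicit Types (x g v w : 'cV[R]_d) (phi : 'cV[R]_d -> \bar R).

Lemma normr_coord_le v i : `|v i ord0| <= `|v|.
Proof.
rewrite {2}/Num.norm/= mx_normrE.
exact: (@le_bigmax _ R _ 0 (fun k : 'I_d * 'I_1 => `|v k.1 k.2|) (i, ord0)).
Qed.

Lemma continuous_dotv g : continuous (dotv g).
Proof.
have -> : dotv g = (fun y : 'cV[R]_d => \sum_i g i ord0 * y i ord0).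
  by apply/funext => y; rewrite dotvE.
apply: continuous_big => [|i _]; first exact: add_continuous.
move=> x; have c := @coord_continuous R d 1 i ord0.
exact: (@continuous_comp 'cV[R]_d R R (fun M : 'cV[R]_d => M i ord0) _ x (c x)
  (@mulrl_continuous R (g i ord0) _)).
Qed.

Lemma gradient_littleo phi x g : (\forall y \near x, phi y \is a fin_num) ->
  (forall e, 0 < e -> \forall v \near (0 : 'cV[R]_d),
     `|fine (phi (v + x)) - fine (phi x) - dotv g v| <= e * `|v|) ->
  is_gradient phi x g.
Proof.
move=> nx hx.
have lin : linear (dotv g) by move=> a u v; rewrite dotvDr dotvZr.
pose lg := GRing.isLinear.Build R 'cV[R]_d R^o *%R (dotv g) lin.
pose L : {linear 'cV[R]_d -> R^o} := HB.pack (dotv g) lg.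
have cL : continuous L by exact: continuous_dotv.
have E : ((fine \o phi : 'cV[R]_d -> R^o) \o shift x) = cst ((fine \o phi) x : R^o) + (L : 'cV[R]_d -> R^o) +o_ (0 : 'cV[R]_d) id.
  apply/eqaddoP => e e0; near=> v.
  have : `|fine (phi (v + x)) - fine (phi x) - dotv g v| <= e * `|v|.
    by near: v; exact: hx.
  congr (`|_| <= _); rewrite -addrA -opprD.
  by rewrite /=.
have dE := diff_unique cL E.
split=> //; last by move=> v; rewrite dE.
by apply/diff_locallyP; rewrite dE.
Unshelve. all: by end_near. Qed.

End gradient.

Section adjoint.
Context (R : realType) (d : nat).
Implicit Types (A : 'M[R]_d) (u v : 'cV[R]_d).

Lemma dotv_mulmxl A u v : dotv (A *m u) v = dotv u (A^T *m v).
Proof. by rewrite /dotv trmx_mul mulmxA. Qed.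

Lemma dotv_delta i v : dotv (delta_mx i ord0) v = v i ord0.
Proof. by rewrite /dotv trmx_delta -rowE mxE. Qed.

End adjoint.

Section separable.
Context (R : realType) (d : nat).
Variables (A : 'M[R]_d) (r V : 'I_d -> R -> R) (I : 'I_d -> set R).
Hypothesis oI : forall i, open (I i).
Hypothesis Iitv : forall i x y z, I i x -> I i z -> x <= y <= z -> I i y.
Hypothesis rc : forall i x, I i x -> {for x, continuous (r i)}.
Hypothesis rV : forall i x y, I i x -> I i y -> V i x + r i x * (y - x) <= V i y.
Implicit Types (x y : 'cV[R]_d).

Local Notation co x i := ((A^T *m x) i ord0).

(** The final rotation by [A] makes this the gradient of a sum of functions of the rotated
    coordinates; it leaves N(0, I) invariant and so does not disturb the image law. *)
Definition separable_map x : 'cV[R]_d := A *m map_cV r (A^T *m x).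

Definition separable_dom : set 'cV[R]_d := [set x | forall i, I i (co x i)].

Definition separable_potential x : \bar R :=
  if x \in separable_dom then (\sum_i V i (co x i))%:E else +oo%E.

Lemma separable_potentialE x : separable_dom x ->
  separable_potential x = (\sum_i V i (co x i))%:E.
Proof. by move=> Dx; rewrite /separable_potential mem_set. Qed.

Lemma continuous_rotated_coord i : continuous (fun x => co x i).
Proof.
have -> : (fun x => co x i) = dotv (A *m delta_mx i ord0).
  by apply/funext => x; rewrite dotv_mulmxl dotv_delta.
exact: continuous_dotv.
Qed.

Lemma separable_dom_near x : separable_dom x -> \forall y \near x, separable_dom y.
Proof.
move=> Dx; apply: (@filter_forall 'cV[R]_d 'I_d _ (nbhs x) (nbhs_filter x)) => i.
have : nbhs (co x i) (I i) by apply: open_nbhs_nbhs.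
exact: continuous_rotated_coord.
Qed.

(** [r] gives a subgradient at the combined point; the inequalities from there to [x] and to [y],
    weighted by [t] and [1 - t], add up with the linear terms cancelling. *)
Lemma separable_potential_convex : econvex separable_potential.
Proof.
split=> [x|x y t /andP[t0 t1]]; first by rewrite /separable_potential; case: ifP.
(* The end values are treated apart because [0 * +oo = 0], whereas a positive weight keeps an
   infinite value infinite. *)
have [->|tn0] := eqVneq t 0.
  by rewrite scale0r subr0 scale1r add0r mul0e add0e mul1e.
have [->|tn1] := eqVneq t 1.
  by rewrite scale1r subrr scale0r addr0 mul1e mul0e adde0.
have {t0}t0 : 0 < t by rewrite lt_neqAle eq_sym tn0.
have {t1}t1 : 0 < 1 - t by rewrite subr_gt0 lt_neqAle tn1.
have infy z : ~ separable_dom z -> separable_potential z = +oo%E.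
  by move=> nD; rewrite /separable_potential memNset.
have nNy (a : R) z : 0 < a -> (a%:E * separable_potential z != -oo)%E.
  move=> a0; rewrite /separable_potential; case: ifP => _ //.
  by rewrite gt0_muley ?lte_fin.
have [Dx|/infy ->] := pselect (separable_dom x); last first.
  by rewrite gt0_muley ?lte_fin// addye ?leey// nNy.
have [Dy|/infy ->] := pselect (separable_dom y); last first.
  by rewrite (gt0_muley (x := (1 - t)%:E)) ?lte_fin// addey ?leey// nNy.
have cz i : co (t *: x + (1 - t) *: y) i = t * co x i + (1 - t) * co y i.
  by rewrite mulmxDr -!scalemxAr !mxE.
have Dz : separable_dom (t *: x + (1 - t) *: y).
  move=> i; rewrite cz; have [xy|yx] := leP (co x i) (co y i).
    by apply: (Iitv (Dx i) (Dy i)); nra.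
  by apply: (Iitv (Dy i) (Dx i)); nra.
rewrite !separable_potentialE// -!EFinM -EFinD lee_fin !mulr_sumr -big_split/=.
apply: ler_sum => i _; have := rV (Dz i) (Dx i); have := rV (Dz i) (Dy i).
rewrite cz; set X := co x i; set Y := co y i; set Z := V i _; set rz := r i _.
nra.
Qed.

(** The subgradient inequality at [x] makes the first-order remainder nonnegative; the one at
    [v + x] bounds it by the increments of [r] times those of the coordinates, and continuity of [r]
    makes this small compared with the norm of [v]. *)
Lemma separable_gradient x : separable_dom x ->
  is_gradient separable_potential x (separable_map x).
Proof.
move=> Dx; have nD := separable_dom_near Dx.
apply: gradient_littleo.
  by apply: filterS nD => y Dy; rewrite separable_potentialE.
move=> e e0.
pose S := \sum_i \sum_j `|A j i|.
have S0 : 0 <= S by apply: sumr_ge0 => i _; apply: sumr_ge0.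
pose e' := e / (S + 1).
have e'0 : 0 < e' by rewrite divr_gt0// ltr_wpDl.
have cov (v : 'cV[R]_d) i : `|co v i| <= (\sum_j `|A j i|) * `|v|.
  rewrite mxE (le_trans (ler_norm_sum _ _ _))// mulr_suml ler_sum// => j _.
  by rewrite normrM mxE ler_wpM2l// normr_coord_le.
have near_r : \forall y \near x, forall i, `|r i (co y i) - r i (co x i)| <= e'.
  apply: (@filter_forall 'cV[R]_d 'I_d _ (nbhs x) (nbhs_filter x)) => i.
  have c : {for x, continuous (r i \o (fun y => co y i))}.
    by apply: continuous_comp; [exact: continuous_rotated_coord|exact: rc].
  have := @cvgr_distC_le _ _ _ _ (nbhs_filter x) _ _ c e' e'0.
  by apply: filterS => y; rewrite distrC.
have near_both : \forall y \near x, separable_dom y /\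
    forall i, `|r i (co y i) - r i (co x i)| <= e'.
  exact: (@filterI _ (nbhs x) (nbhs_filter x) _ _ nD near_r).
move/nbhs0P : near_both; apply: (@filterS _ (nbhs (0 : 'cV[R]_d)) (nbhs_filter _)).
move=> v; rewrite addrC => -[Dv rv].
rewrite !separable_potentialE//= dotv_mulmxl dotvE -sumrB -sumrB.
have coD i : co (v + x) i = co v i + co x i by rewrite mulmxDr mxE.
have mE i : map_cV r (A^T *m x) i ord0 = r i (co x i) by rewrite mxE.
under eq_bigr do rewrite mE.
rewrite ger0_norm; last first.
  apply: sumr_ge0 => i _; have := rV (Dx i) (Dv i).
  have -> : co (v + x) i - co x i = co v i by rewrite coD addrK.
  lra.
have -> : e = e' * (S + 1) by rewrite divfK// gt_eqF// ltr_wpDl.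
rewrite (@le_trans _ _ (e' * S * `|v|))//; last first.
  by rewrite ler_wpM2r// ler_wpM2l ?(ltW e'0)// lerDl.
rewrite -mulrA mulr_suml mulr_sumr; apply: ler_sum => i _.
rewrite (@le_trans _ _ (`|r i (co (v + x) i) - r i (co x i)| * `|co v i|))//; last first.
  by rewrite ler_pM.
rewrite -normrM (le_trans _ (ler_norm _))//.
have := rV (Dv i) (Dx i).
have -> : co x i - co (v + x) i = - co v i by rewrite coD; ring.
lra.
Qed.

End separable.

Section pushes_algebra.
Context (R : realType) d1 d2 d3 (X : measurableType d1) (Y : measurableType d2)
  (Z : measurableType d3).

Lemma pushes_comp (phi : X -> Y) (psi : Y -> Z) (Q : {measure set X -> \bar R})
    (P : {measure set Y -> \bar R}) (S : {measure set Z -> \bar R}) :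
  pushes phi Q P -> pushes psi P S -> pushes (psi \o phi) Q S.
Proof.
move=> [mphi PQ] [mpsi SP]; split=> [|B mB]; first exact: measurableT_comp.
rewrite SP// PQ// -[X in measurable X]setTI; exact: mpsi.
Qed.

Lemma pushes_can (phi : X -> Y) (psi : Y -> X) (Q : {measure set X -> \bar R})
    (P : {measure set Y -> \bar R}) : cancel phi psi -> measurable_fun setT psi ->
  pushes phi Q P -> pushes psi P Q.
Proof.
move=> pK mpsi [mphi PQ]; split=> // B mB; rewrite PQ; last first.
  by rewrite -[X in measurable X]setTI; exact: mpsi.
by congr (Q _); apply/seteqP; split=> x /=; rewrite pK.
Qed.

End pushes_algebra.

Section normal_product.
Context (R : realType) (d : nat).
Implicit Types (A S : 'M[R]_d) (theta x : 'cV[R]_d).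

Lemma sqnorm_orthogonal A x : orthogonal_mx A -> sqnorm (A *m x) = sqnorm x.
Proof. by move=> oA; rewrite /sqnorm dotv_mulmxl mulmxA oA mul1mx. Qed.

Lemma orthogonal_mx_tr A : orthogonal_mx A -> orthogonal_mx A^T.
Proof. by move=> oA; rewrite /orthogonal_mx trmxK orthogonal_mxC. Qed.

Lemma invmx_diag S : is_diag_mx S -> (forall i, 0 < S i i) ->
  invmx S = diag_mx (\row_i (S i i)^-1).
Proof.
move=> /is_diag_mxP dS S0.
have E : S *m diag_mx (\row_i (S i i)^-1) = 1%:M.
  apply/matrixP => i j; rewrite mul_mx_diag !mxE.
  have [->|ij] := eqVneq i j; first by rewrite divff// gt_eqF.
  by rewrite dS ?mul0r// neq_ltn; move: ij; rewrite neq_ltn.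
have Su : S \in unitmx by case/mulmx1_unit: E.
by rewrite -[LHS]mulmx1 -E mulmxA mulVmx// mul1mx.
Qed.

Lemma mvnormal_pdf_prod theta S x : is_diag_mx S -> (forall i, 0 < S i i) ->
  mvnormal_pdf theta S x =
  \prod_i normal_pdf (theta i ord0) (Num.sqrt (S i i)) (x i ord0).
Proof.
move=> dS S0; have s0 i : Num.sqrt (S i i) != 0 by rewrite gt_eqF// sqrtr_gt0.
have nE i : normal_pdf (theta i ord0) (Num.sqrt (S i i)) (x i ord0) =
    (Num.sqrt (2 * pi * S i i))^-1 *
    expR (- (x i ord0 - theta i ord0) ^+ 2 * (S i i)^-1 / 2).
  rewrite /normal_pdf (negbTE (s0 i)) /normal_peak /normal_fun sqr_sqrtr ?(ltW (S0 i))//.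
  congr (_^-1 * expR _); first by congr Num.sqrt; ring.
  by field; rewrite gt_eqF.
under eq_bigr do rewrite nE.
rewrite big_split/= [RHS]mulrC /mvnormal_pdf -expR_sum; congr (expR _ * _); last first.
  rewrite prodfV; congr _^-1.
  have -> : (2 * pi) ^+ d * \det S = \prod_i (2 * pi * S i i) :> R.
    by rewrite big_split/= prodr_const card_ord det_trig// is_diag_mx_is_trig.
  have pS i : 0 <= 2 * pi * S i i :> R by rewrite !mulr_ge0 ?pi_ge0 ?(ltW (S0 i)).
  have : 0 <= \prod_i (2 * pi * S i i) /\
      Num.sqrt (\prod_i (2 * pi * S i i)) = \prod_i Num.sqrt (2 * pi * S i i).
    elim/big_rec2 : _ => [|i a b _ [b0 <-]]; first by rewrite sqrtr1.
    by rewrite sqrtrM// mulr_ge0.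
  by case.
rewrite invmx_diag// dotvE mulrC mulrN mulr_sumr -sumrN; apply: eq_bigr => i _.
by rewrite mul_diag_mx !mxE; ring.
Qed.

Definition stdn_cV : density (lebesgue_cV R d) :=
  prod_density (fun _ : 'I_d => normal_density 0 1).

Lemma mvnormal_law theta S (P : probability 'cV[R]_d R) : is_diag_mx S ->
  (forall i, 0 < S i i) ->
  is_mvnormal theta S P <-> forall B, measurable B -> P B =
    law (prod_density (fun i => normal_density (theta i ord0) (Num.sqrt (S i i)))) B.
Proof.
move=> dS S0; have E B : (\int[lebesgue_cV R d]_(x in B) (mvnormal_pdf theta S x)%:E)%E =
    law (prod_density (fun i => normal_density (theta i ord0) (Num.sqrt (S i i)))) B.
  by apply: eq_integral => x _; rewrite mvnormal_pdf_prod.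
by split=> h B mB; have := h B mB; rewrite E.
Qed.

Lemma stdn_cV_pdf x : stdn_cV x = mvnormal_pdf 0 1%:M x.
Proof.
rewrite mvnormal_pdf_prod ?scalar_mx_is_diag//; last by move=> i; rewrite mxE eqxx.
by apply: eq_bigr => i _; rewrite !mxE eqxx sqrtr1.
Qed.

Lemma stdn_cV_law (nu : probability 'cV[R]_d R) : is_mvnormal 0 1%:M nu ->
  forall B, measurable B -> nu B = law stdn_cV B.
Proof.
move=> h B mB; rewrite h//; apply: eq_integral => x _; by rewrite stdn_cV_pdf.
Qed.

(** The standard normal density depends on [x] only through [sqnorm x]. *)
Lemma stdn_cV_orthogonal A : orthogonal_mx A ->
  pushes (mulmx A) (law stdn_cV) (law stdn_cV).
Proof.
move=> oA; apply: bss_law => // x.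
have -> : bss_pdf A (fun=> normal_density 0 1) x = stdn_cV (A^T *m x).
  by apply: eq_bigr => i _; congr (_ _); rewrite mxE; apply: eq_bigr => j _; rewrite mxE.
rewrite !stdn_cV_pdf /mvnormal_pdf !subr0 invmx1 !mul1mx.
by rewrite -/(sqnorm (A^T *m x)) sqnorm_orthogonal//; exact: orthogonal_mx_tr.
Qed.

End normal_product.

Section rank_map_exists.
Context (R : realType) (d : nat).
Variables (f : density (lebesgue_cV R d)) (A : 'M[R]_d)
  (g : 'I_d -> density (@lebesgue_measure R)) (r : 'I_d -> R -> R)
  (I : 'I_d -> set R).
Hypothesis oA : orthogonal_mx A.
Hypothesis fA : pushes (mulmx A) (law (prod_density g)) (law f).
Hypothesis tr : forall i, transport (g i) (r i) (I i).

Lemma separable_map_pushes : pushes (separable_map A r) (law f) (law (stdn_cV R d)).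
Proof.
have AK : cancel (mulmx A : 'cV[R]_d -> 'cV[R]_d) (mulmx A^T).
  by move=> x; rewrite mulmxA oA mul1mx.
have h1 := pushes_can AK (measurable_mulmx _) fA.
have h2 : pushes (map_cV r) (law (prod_density g)) (law (stdn_cV R d)).
  by apply: pushes_map_cV => i; exact: tr_push (tr i).
exact: (pushes_comp (pushes_comp h1 h2) (stdn_cV_orthogonal oA)).
Qed.

Lemma separable_dom_ae : {ae law f, forall x, separable_dom A I x}.
Proof.
apply: (@filter_forall _ _ _ _ (ae_filter_ringOfSetsType (law f))) => i.
by have := ae_pushes (bss_coord i oA fA) (tr_ae (tr i)); apply.
Qed.

Lemma separable_rank_map (nu : probability 'cV[R]_d R) : is_mvnormal 0 1%:M nu ->
  is_rank_map (law f) nu (separable_map A r).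
Proof.
move=> hnu; have [mT fT] := separable_map_pushes.
split=> //; first by move=> B mB; rewrite (stdn_cV_law hnu mB) fT.
have V_ i : exists V : R -> R, forall x y, I i x -> I i y ->
    V x + r i x * (y - x) <= V y.
  apply: monotone_potential; [exact: (tr_push (tr i)).1|exact: tr_itv (tr i)|].
  exact: tr_nd (tr i).
have {V_}/choice[V rV] := V_.
exists (separable_potential A V I).
  by apply: separable_potential_convex rV => i; exact: tr_itv (tr i).
apply: filterS separable_dom_ae.
move=> x Dx; apply: separable_gradient rV _ Dx => i; first exact: tr_open (tr i).
by move=> y; exact: tr_cont (tr i) y.
Qed.

End rank_map_exists.

(** * Moments of the score *)

Section truncated_limits.
Context disp (T : measurableType disp) (R : realType) (P : probability T R).

(** The common passage to the limit for truncations: almost every point is eventually unaffected and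
    absolute values never grow, so the untruncated product dominates. *)
Lemma dominated_mul_cvg (a_ : nat -> T -> R) (a w : T -> R) :
  (forall n, measurable_fun setT (a_ n)) -> measurable_fun setT a ->
  measurable_fun setT w ->
  {ae P, forall x, (forall n, `|a_ n x| <= `|a x|) /\
     \forall n \near \oo, a_ n x = a x} ->
  P.-integrable setT (EFin \o (fun x => a x * w x)) ->
  \int[P]_x (a_ n x * w x) @[n --> \oo] --> \int[P]_x (a x * w x).
Proof.
move=> ma_ ma mw H iaw.
pose F n x := a_ n x * w x; pose F_ x := a x * w x.
have m_ n : measurable_fun setT (EFin \o F n).
  by apply/measurable_EFinP; exact: measurable_funM.
have m : measurable_fun setT (EFin \o F_) by exact: measurable_int iaw.
have lim_ : {ae P, forall x, [set: T] x -> (EFin \o F n) x @[n --> \oo] --> (EFin \o F_) x}.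
  apply: filterS H => x [_ ax] _; apply: cvg_near_cst.
  by apply: filterS ax => n; rewrite /= /F => ->.
have dom : {ae P, forall x n, [set: T] x ->
    (`|(EFin \o F n) x| <= `|(EFin \o F_) x|)%E}.
  by apply: filterS H => x [ax _] n _; rewrite /= lee_fin !normrM ler_wpM2r.
have [_ _ h] := dominated_convergence measurableT m_ m lim_ (integrable_abse iaw) dom.
suff : fine (\int[P]_x (EFin \o F n) x)%E @[n --> \oo] --> fine (\int[P]_x (EFin \o F_) x)%E by [].
by apply: fine_cvg; rewrite fineK//; apply: integrable_fin_num.
Qed.

End truncated_limits.

Section clip.
Context (R : realType).
Implicit Types (M t : R).

Definition clamp M t : R := Num.max (- M) (Num.min M t).

Lemma clamp_bound M t : 0 <= M -> `|clamp M t| <= M.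
Proof.
move=> M0; rewrite /clamp ler_norml le_max lexx/= ge_max ge_min lexx/= andbT; lra.
Qed.

Lemma clamp_id M t : `|t| <= M -> clamp M t = t.
Proof.
rewrite ler_norml => /andP[t1 t2].
by rewrite /clamp (min_idPr t2) (max_idPr t1).
Qed.

Lemma clamp_le M t : 0 <= M -> `|clamp M t| <= `|t|.
Proof.
move=> M0; have [tM|tM] := leP `|t| M; first by rewrite clamp_id.
exact: le_trans (clamp_bound t M0) (ltW tM).
Qed.

Lemma measurable_clamp M : measurable_fun setT (clamp M).
Proof. by apply: measurable_maxr => //; exact: measurable_minr. Qed.

Lemma clamp_growth M t s : 0 <= M -> 0 <= s -> 0 <= clamp M (t + s) - clamp M t <= s.
Proof.
rewrite /clamp => M0 s0.
case: (leP M (t + s)) => h1; case: (leP M t) => h2; try case: (leP (- M) (t + s)) => h3;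
  try case: (leP (- M) t) => h4; try case: (leP (- M) M) => h5; lra.
Qed.

End clip.

Section score_moments.
Context (R : realType) (d : nat).
Variables (f : density (lebesgue_cV R d)) (A : 'M[R]_d)
  (g : 'I_d -> density (@lebesgue_measure R)).
Hypothesis qf : qmd f.
Hypothesis ms : measurable_fun setT (score f 0).
Hypothesis is_ : (law f).-integrable setT (fun x => (sqnorm (score f 0 x))%:E).
Hypothesis oA : orthogonal_mx A.
Hypothesis fA : pushes (mulmx A) (law (prod_density g)) (law f).

Local Notation co x i := ((A^T *m x) i ord0).

Definition score_along i (x : 'cV[R]_d) : R :=
  dotv (A *m delta_mx i ord0) (score f 0 x).

(** For bounded [c] this is the derivative at t = 0 of the mean of [c] at coordinate [j] when the
    law is shifted by t along the rotated axis [i]. The I_j of the overview is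
    [score_mean j j (quantile_map (g j))]. *)
Definition score_mean i j (c : R -> R) : R :=
  \int[law f]_x (c (co x j) * score_along i x).

Let axis_neq0 i : A *m delta_mx i ord0 != 0 :> 'cV[R]_d.
Proof.
apply/eqP => /(congr1 (mulmx A^T)); rewrite mulmxA oA mul1mx mulmx0.
by move=> /matrixP/(_ i ord0); rewrite !mxE !eqxx => /eqP; rewrite oner_eq0.
Qed.

Lemma measurable_score_along i : measurable_fun setT (score_along i).
Proof. by apply: measurable_dotv => //; exact: measurable_cst. Qed.

Lemma integrable_coord j (c : R -> R) : measurable_fun setT c ->
  (law (g j)).-integrable setT (EFin \o c) ->
  (law f).-integrable setT (EFin \o (fun x : 'cV[R]_d => c (co x j))).
Proof.
move=> mc ic.
have mc' : measurable_fun setT (EFin \o c : measurableTypeR R -> _) by exact/measurable_EFinP.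
exact: ((integrable_pushes (bss_coord j oA fA) mc').1 ic).
Qed.

(** [A^T] turns a shift along the rotated axis [i] into a shift of coordinate [i] alone; the factor
    [(i == j)%:R] records whether coordinate [j] moves. *)
Lemma score_coord i j (c : R -> R) M : measurable_fun setT c ->
  (forall t, `|c t| <= M) ->
  n.+1%:R * (\int[law (g j)]_t c (t + (i == j)%:R * n.+1%:R^-1)
    - \int[law (g j)]_t c t) @[n --> \oo] --> score_mean i j c.
Proof.
move=> mc cM.
have mco : measurable_fun setT (fun x : 'cV[R]_d => co x j).
  exact: measurable_coord (measurable_mulmx _).
have mb : measurable_fun setT (fun x : 'cV[R]_d => c (co x j)).
  exact: (measurableT_comp mc mco).
have h := @score_identity R d f qf ms is_ (A *m delta_mx i ord0)
  (fun x => c (co x j)) M (axis_neq0 i) mb (fun x => cM _).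
apply: cvg_trans h; apply: near_eq_cvg; apply: nearW => n; apply/esym; congr (_ * (_ - _)).
- rewrite (Rintegral_pushes (bss_coord j oA fA) (F := fun t => c (t + (i == j)%:R * n.+1%:R^-1))).
    apply: eq_Rintegral => x _; congr c.
    rewrite mulmxDr -scalemxAr mulmxA oA mul1mx !mxE eqxx andbT eq_sym; congr (_ + _).
    exact: mulrC.
  apply: (measurableT_comp mc); exact: measurable_funD.
- by rewrite (Rintegral_pushes (bss_coord j oA fA) (F := c)).
Qed.

Lemma mul_score_integrable i j (c : R -> R) : measurable_fun setT c ->
  (law (g j)).-integrable setT (EFin \o (fun t => c t ^+ 2)) ->
  (law f).-integrable setT (EFin \o (fun x : 'cV[R]_d => c (co x j) * score_along i x)).
Proof.
move=> mc ic.
have mco : measurable_fun setT (fun x : 'cV[R]_d => co x j).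
  exact: measurable_coord (measurable_mulmx _).
apply: mul_integrable.
- exact: (measurableT_comp mc mco).
- exact: measurable_score_along.
- by apply: (integrable_coord (c := fun t => c t ^+ 2)) => //; exact: measurable_funX.
- exact: score_sq_integrable.
Qed.

(* The law of the j-th coordinate does not see a shift along another axis. *)
Lemma score_mean_off i j (c : R -> R) : i != j -> measurable_fun setT c ->
  (law (g j)).-integrable setT (EFin \o (fun t => c t ^+ 2)) ->
  score_mean i j c = 0.
Proof.
move=> ij mc ic.
have mco : measurable_fun setT (fun x : 'cV[R]_d => co x j).
  exact: measurable_coord (measurable_mulmx _).
have bdd n : score_mean i j (clamp n%:R \o c) = 0.
  have mcc : measurable_fun setT (clamp n%:R \o c).
    by apply: measurableT_comp => //; exact: measurable_clamp.
  have h := @score_coord i j _ n%:R mcc (fun t => clamp_bound _ (ler0n _ _)).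
  apply/esym; apply: (cvg_unique _ _ h); first exact: Rhausdorff.
  have -> : (fun k => k.+1%:R * (\int[law (g j)]_t (clamp n%:R \o c) (t + (i == j)%:R * k.+1%:R^-1)
    - \int[law (g j)]_t (clamp n%:R \o c) t)) = cst 0.
    apply/funext => k; rewrite (negPf ij) mul0r.
    by under eq_Rintegral do rewrite addr0; rewrite subrr mulr0.
  exact: cvg_cst.
have h := @dominated_mul_cvg _ _ R (law f) (fun n x => clamp n%:R (c (co x j)))
  (fun x => c (co x j)) (score_along i).
apply/esym; apply: (cvg_unique _ _ (h _ _ _ _ _)); first exact: Rhausdorff.
- have -> : (fun n => \int[law f]_x (clamp n%:R (c (co x j)) * score_along i x)) = cst 0.
    by apply/funext => n; exact: bdd.
  exact: cvg_cst.
- move=> n; apply: (measurableT_comp (measurable_clamp _)); exact: measurableT_comp mc mco.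
- exact: measurableT_comp mc mco.
- exact: measurable_score_along.
- apply: aeW => x; split=> [n|]; first exact: clamp_le.
  by near=> n; apply: clamp_id; near: n; exact: nbhs_infty_ger.
- exact: mul_score_integrable.
Unshelve. all: by end_near. Qed.

Lemma score_mean_cst i k : score_mean i i (cst k) = 0.
Proof.
have h := @score_coord i i (cst k) `|k| (@measurable_cst _ _ _ _ _ _) (fun=> lexx _).
apply/esym; apply: (cvg_unique _ _ h); first exact: Rhausdorff.
have -> : (fun n => n.+1%:R * (\int[law (g i)]_t cst k (t + (i == i)%:R * n.+1%:R^-1)
    - \int[law (g i)]_t cst k t)) = cst 0.
  by apply/funext => n; rewrite /= subrr mulr0.
exact: cvg_cst.
Qed.

Lemma score_mean_diag_clamp j (c : R -> R) : measurable_fun setT c ->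
  (law (g j)).-integrable setT (EFin \o (fun t => c t ^+ 2)) ->
  score_mean j j (clamp n.+1%:R \o c) @[n --> \oo] --> score_mean j j c.
Proof.
move=> mc ic.
have mco : measurable_fun setT (fun x : 'cV[R]_d => co x j).
  exact: measurable_coord (measurable_mulmx _).
apply: (@dominated_mul_cvg _ _ R (law f) (fun n x => clamp n.+1%:R (c (co x j)))
  (fun x => c (co x j)) (score_along j)).
- move=> n; apply: (measurableT_comp (measurable_clamp _)); exact: measurableT_comp mc mco.
- exact: measurableT_comp mc mco.
- exact: measurable_score_along.
- apply: aeW => x; split=> [n|]; first exact: clamp_le.
  near=> n; apply: clamp_id; rewrite (@le_trans _ _ n%:R)// ?ler_nat//.
  by near: n; exact: nbhs_infty_ger.
- exact: mul_score_integrable.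
Unshelve. all: by end_near. Qed.

Variable j : 'I_d.
Hypothesis sqg : (law (g j)).-integrable setT (EFin \o (fun t : R => t ^+ 2)).

(** The mean of W_j + t has slope 1, but the identity is unbounded. For the clamped identity the
    growth quotients lie between the indicator of [[-n, n]] and 1, whose means both tend to 1. *)
Lemma score_mean_id : score_mean j j id = 1.
Proof.
have mid : measurable_fun setT (@id R) by exact: measurable_id.
have cv := score_mean_diag_clamp mid sqg.
(* Clamping at [n.+1] leaves a margin of 1 around [[-n, n]], so a step of at most 1 from a point
   there meets no clamp. *)
pose B n : set R := `[- n%:R, n%:R]%classic.
have mB n : measurable (B n) by exact: measurable_itv.
have mcl n : measurable_fun setT (clamp (n.+1%:R : R)) by exact: measurable_clamp.
have icl n : (law (g j)).-integrable setT (EFin \o clamp (n.+1%:R : R)).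
  exact: (@bounded_integrable R _ (measurableTypeR R) (law (g j)) _ n.+1%:R (mcl n)
    (fun t => clamp_bound t (ler0n _ _))).
have mcs n s : measurable_fun setT (fun t : R => clamp (n.+1%:R : R) (t + s)).
  by apply: (measurableT_comp (mcl n)); exact: measurable_funD.
have ics n s : (law (g j)).-integrable setT (EFin \o (fun t => clamp (n.+1%:R : R) (t + s))).
  exact: (@bounded_integrable R _ (measurableTypeR R) (law (g j)) _ n.+1%:R (mcs n s)
    (fun t => clamp_bound (t + s) (ler0n _ _))).
have one : \int[law (g j)]_t (1 : R) = 1.
  by rewrite Rintegral_cst// mul1r; exact: (congr1 fine (integral_pdf (g j))).
have h n := @score_coord j j _ n.+1%:R (mcl n) (fun t => clamp_bound _ (ler0n _ _)).
have mi n : measurable_fun setT (\1_(B n) : R -> R) by exact: measurable_indic.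
have iB n : (law (g j)).-integrable setT (EFin \o (\1_(B n) : R -> R)).
  apply: (@bounded_integrable R _ (measurableTypeR R) (law (g j)) _ 1 (mi n)) => z.
  by rewrite indicE; case: (_ \in _); rewrite ?normr1 ?normr0.
have i1 : (law (g j)).-integrable setT (EFin \o (cst 1 : R -> R)).
  by apply: (@bounded_integrable R _ (measurableTypeR R) (law (g j)) _ 1) => // z; rewrite normr1.
have s0 (k : nat) : 0 <= k.+1%:R^-1 :> R by rewrite invr_ge0.
have inv1 (k : nat) : k.+1%:R^-1 <= 1 :> R by rewrite invf_le1// ler1n.
have growth n k (t : R) : \1_(B n) t <=
    k.+1%:R * (clamp n.+1%:R (t + k.+1%:R^-1) - clamp n.+1%:R t) <= 1.
  have /andP[h1 h2] := clamp_growth t (ler0n R n.+1) (s0 k).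
  apply/andP; split; last by rewrite mulrC -ler_pdivlMr// div1r.
  rewrite mulrC -ler_pdivrMr// indicE.
  have [/[!inE] Bt|_] := boolP (t \in B n); last by rewrite mul0r.
  rewrite mul1r; move: Bt; rewrite /B/= in_itv/= => /andP[t1 t2].
  have n1 : n.+1%:R = n%:R + 1 :> R by rewrite -natr1.
  rewrite !clamp_id ?ler_norml ?n1; have := s0 k; have := inv1 k; set s := _^-1; lra.
have idk n k : (law (g j)).-integrable setT
    (EFin \o (fun t => k.+1%:R * (clamp n.+1%:R (t + k.+1%:R^-1) - clamp n.+1%:R t))).
  apply: (@bounded_integrable R _ (measurableTypeR R) (law (g j)) _ 1).
    have m := measurable_funB (mcs n k.+1%:R^-1) (mcl n).
    exact: (measurable_funM (measurable_cst (k.+1%:R : R)) m).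
  move=> t; have /andP[h1 h2] := growth n k t; rewrite ger0_norm//.
  by apply: le_trans h1; rewrite indicE.
have E n k : k.+1%:R * (\int[law (g j)]_t clamp n.+1%:R (t + k.+1%:R^-1)
      - \int[law (g j)]_t clamp n.+1%:R t) =
    \int[law (g j)]_t (k.+1%:R * (clamp n.+1%:R (t + k.+1%:R^-1) - clamp n.+1%:R t)).
  rewrite -RintegralB// RintegralZl//.
  exact: (integrableB measurableT (ics n k.+1%:R^-1) (icl n)).
have bd n : \int[law (g j)]_t \1_(B n) t <= score_mean j j (clamp n.+1%:R) <= 1.
  apply/andP; split; [apply: (cvgr_to_ge (h n))|apply: (cvgr_to_le (h n))];
    apply: nearW => k; rewrite eqxx mul1r E.
  - by apply: le_Rintegral => // t _; case/andP: (growth n k t).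
  - rewrite -[leRHS]one; apply: le_Rintegral => //.
    by move=> t _; case/andP: (growth n k t).
have cvB : \int[law (g j)]_t \1_(B n) t @[n --> \oo] --> (1 : R).
  have E1 : \int[law (g j)]_t (cst 1 t * cst 1 t) = 1 :> R.
    by rewrite -[RHS]one; apply: eq_Rintegral => t _; rewrite mulr1.
  have -> : (fun n => \int[law (g j)]_t \1_(B n) t) =
      (fun n => \int[law (g j)]_t (\1_(B n) t * cst 1 t)).
    by apply/funext => n; apply: eq_Rintegral => t _; rewrite mulr1.
  rewrite -{2}E1.
  apply: (@dominated_mul_cvg _ (measurableTypeR R) R (law (g j)) (fun n => \1_(B n))
    (cst 1) (cst 1)) => //; last first.
    apply: (@bounded_integrable R _ (measurableTypeR R) (law (g j)) _ 1).
      exact: (measurable_cst (1 * 1 : R)).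
    by move=> t; rewrite mulr1 normr1.
  apply: aeW => t; split=> [n|]; first by rewrite indicE normr1; case: (_ \in _); rewrite ?normr1 ?normr0.
  near=> n; rewrite indicE mem_set// /B/= in_itv/= -ler_norml.
  by near: n; exact: nbhs_infty_ger.
by apply: (cvg_unique _ cv (squeeze_cvgr _ cvB (cvg_cst _))); [exact: Rhausdorff|exact: nearW].
Unshelve. all: by end_near. Qed.

Lemma score_mean_quantile :
  0 < energy (g j) (quantile_map (g j)) /\
  (energy (g j) (quantile_map (g j)))^-1 <= score_mean j j (quantile_map (g j)).
Proof.
pose Jn k := score_mean j j (trunc_map (g j) k.+1%:R).
apply: (@score_lower_bound R (g j) sqg _ Jn).
- have mco : measurable_fun setT (fun x : 'cV[R]_d => co x j).
    exact: measurable_coord (measurable_mulmx _).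
  have mq := @measurable_quantile_map R (g j).
  apply: (@dominated_mul_cvg _ _ R (law f) (fun n x => trunc_map (g j) n.+1%:R (co x j))
    (fun x => quantile_map (g j) (co x j)) (score_along j)).
  + move=> n; exact: measurableT_comp (measurable_trunc_map _ _) mco.
  + exact: measurableT_comp mq mco.
  + exact: measurable_score_along.
  + have aI := ae_pushes (bss_coord j oA fA) (cdf_range_ae (g j)).
    apply: filterS aI => x Ix; split=> [n|]; first exact: trunc_map_le.
    near=> n; apply: trunc_mapE => //; rewrite (@le_trans _ _ n%:R)// ?ler_nat//.
    by near: n; exact: nbhs_infty_ger.
  + apply: (mul_score_integrable j mq).
    exact: transport_sq_integrable (quantile_transport (g j)).
- move=> k; have h := @score_coord j j _ k.+1%:R (measurable_trunc_map (g j) (ltr0Sn R k))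
    (fun t => trunc_map_bound (g j) (ltr0Sn R k) t).
  apply: cvg_trans h; apply: near_eq_cvg; apply: nearW => n; apply/esym.
  by rewrite eqxx mul1r.
Unshelve. all: by end_near. Qed.

End score_moments.

(** * Asymptotic relative efficiency *)

Section energy_variance.
Context (R : realType).
Notation mu1 := (@lebesgue_measure R).
Variable g : density mu1.
Hypothesis sqg : (law g).-integrable setT (EFin \o (fun x : R => x ^+ 2)).

Definition law_mean : R := \int[law g]_x x.
Definition law_var : R := \int[law g]_x (x - law_mean) ^+ 2.

Lemma law_mean_centered : \int[law g]_x (x - law_mean) = 0.
Proof.
have i1 := law_id_integrable sqg.
have i2 : (law g).-integrable setT (EFin \o (cst law_mean : R -> R)).
  exact: finite_measure_integrable_cst.
rewrite RintegralB// Rintegral_cst// (_ : fine _ = 1) ?mulr1 ?subrr//.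
exact: (congr1 fine (integral_pdf g)).
Qed.

Lemma law_centered_sq_integrable :
  (law g).-integrable setT (EFin \o (fun x : R => (x - law_mean) ^+ 2)).
Proof.
have i1 := law_id_integrable sqg.
have i2 : (law g).-integrable setT (EFin \o (fun x : R => (- 2 * law_mean) * x)).
  exact: (integrableZl measurableT _ i1).
have i3 : (law g).-integrable setT (EFin \o (cst (law_mean ^+ 2) : R -> R)).
  exact: finite_measure_integrable_cst.
have -> : (fun x : R => (x - law_mean) ^+ 2) =
    (fun x => x ^+ 2 + ((- 2 * law_mean) * x + law_mean ^+ 2)).
  by apply/funext => x; ring.
exact: (integrableD measurableT sqg (integrableD measurableT i2 i3)).
Qed.

Variables (r : R -> R) (I : set R).
Hypothesis tr : transport g r I.

(** Regression of the centred variable on [r], which has mean 0 and second moment 1. At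
    [s = energy g r] its nonnegativity is Cauchy-Schwarz and its vanishing is the equality case. *)
Lemma transport_residual (s : R) :
  (law g).-integrable setT (EFin \o (fun x : R => (x - law_mean - s * r x) ^+ 2)) /\
  \int[law g]_x (x - law_mean - s * r x) ^+ 2 =
    law_var - 2 * s * energy g r + s ^+ 2.
Proof.
have i1 := law_centered_sq_integrable.
have ir2 : (law g).-integrable setT (EFin \o (fun x : R => s ^+ 2 * r x ^+ 2)).
  exact: (integrableZl measurableT _ (transport_sq_integrable tr)).
have irx : (law g).-integrable setT (EFin \o (fun x : R => (2 * s) * (r x * x))).
  exact: (integrableZl measurableT _ (transport_mul_integrable tr sqg)).
have ir : (law g).-integrable setT (EFin \o (fun x : R => (2 * s * law_mean) * r x)).
  exact: (integrableZl measurableT _ (transport_integrable tr)).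
have i2 : (law g).-integrable setT (EFin \o (fun x : R => (x - law_mean) ^+ 2 - (2 * s) * (r x * x))).
  exact: (integrableB measurableT i1 irx).
have i3 : (law g).-integrable setT (EFin \o (fun x : R => s ^+ 2 * r x ^+ 2 + (2 * s * law_mean) * r x)).
  exact: (integrableD measurableT ir2 ir).
have E : (fun x => (x - law_mean - s * r x) ^+ 2) = (fun x => (x - law_mean) ^+ 2 - (2 * s) * (r x * x) +
    (s ^+ 2 * r x ^+ 2 + (2 * s * law_mean) * r x)).
  by apply/funext => x; ring.
rewrite E; split; first exact: (integrableD measurableT i2 i3).
rewrite RintegralD// RintegralB// RintegralD//.
rewrite RintegralZl//; last exact: transport_mul_integrable tr sqg.
rewrite RintegralZl//; last exact: transport_sq_integrable tr.
rewrite RintegralZl//; last exact: transport_integrable tr.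
rewrite (transport_mean tr) mulr0 addr0.
have -> : \int[law g]_x r x ^+ 2 = 1 by rewrite /Rintegral (transport_sq tr).
by rewrite mulr1.
Qed.

Lemma energy_le_var : energy g r ^+ 2 <= law_var.
Proof.
have [_] := transport_residual (energy g r).
have : 0 <= \int[law g]_x (x - law_mean - energy g r * r x) ^+ 2.
  by apply: Rintegral_ge0 => x _; exact: sqr_ge0.
move=> h e; move: h; rewrite e; lra.
Qed.

Lemma energy_eq_var : law_var <= energy g r ^+ 2 ->
  {ae law g, forall x, x = energy g r * r x + law_mean}.
Proof.
move=> le; have [i e] := transport_residual (energy g r).
have : \int[law g]_x (x - law_mean - energy g r * r x) ^+ 2 = 0.
  by apply/eqP; rewrite eq_le Rintegral_ge0 ?andbT => [|x _]; [rewrite e; lra|exact: sqr_ge0].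
pose F := EFin \o (fun x => (x - law_mean - energy g r * r x) ^+ 2).
move=> h0; have := congr1 EFin h0; rewrite /Rintegral fineK; last exact: integrable_fin_num.
have mF : measurable_fun setT F by exact: measurable_int i.
move=> F0; have iF0 : (\int[law g]_x `|F x| = 0)%E.
  by rewrite -[RHS]F0; apply: eq_integral => x _; rewrite gee0_abs// lee_fin sqr_ge0.
have ae0 := (ae_eq_integral_abs (law g) measurableT mF).1 iF0.
apply: filterS ae0 => x /(_ Logic.I)[] /eqP; rewrite sqrf_eq0 => /eqP h.
by move: h; set y := _ * _; lra.
Qed.

End energy_variance.

Section normal_rigidity.
Context (R : realType).
Notation mu1 := (@lebesgue_measure R).
Notation pushes11 := (@pushes _ _ (measurableTypeR R) (measurableTypeR R) R).

Lemma ae_eq_pushes (g q : density mu1) (r : R -> R) :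
  pushes11 r (law g) (law q) -> {ae law g, forall x, x = r x} ->
  pushes11 (fun x => x) (law g) (law q).
Proof.
move=> [mr rq] ae; split; first exact: measurable_id.
move=> B mB; rewrite rq//; apply: ae_eq_measure => //.
  by rewrite -[X in measurable X]setTI; exact: mr.
have := ae; apply: filterS; first exact: (ae_filter_ringOfSetsType (law g)).
by move=> x xr; rewrite /= -xr.
Qed.

Lemma normal_rigidity (g : density mu1) (r : R -> R) I :
  (law g).-integrable setT (EFin \o (fun x : R => x ^+ 2)) -> transport g r I ->
  0 < energy g r -> law_var g <= energy g r ^+ 2 ->
  pushes11 (fun x => x) (law g) (law (normal_density (law_mean g) (energy g r))).
Proof.
move=> sqg tr e0 le.
have h := pushes_comp (tr_push tr) (pushes_normal (law_mean g) (lt0r_neq0 e0)).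
exact: (ae_eq_pushes h (energy_eq_var sqg tr le)).
Qed.

End normal_rigidity.

Section Rintegral_sum.
Context disp (T : measurableType disp) (R : realType) (P : {measure set T -> \bar R}).

Lemma integrable_Rsum J (s : seq J) (F : J -> T -> R) :
  (forall i, P.-integrable setT (EFin \o F i)) ->
  P.-integrable setT (EFin \o (fun x => \sum_(i <- s) F i x)).
Proof.
move=> iF; rewrite (_ : _ \o _ = fun x => (\sum_(i <- s) (F i x)%:E)%E).
  exact: (@integrable_sum _ _ _ P setT measurableT _ s xpredT (fun i => EFin \o F i)).
by apply/funext => x /=; rewrite sumEFin.
Qed.

Lemma Rintegral_sum J (s : seq J) (F : J -> T -> R) :
  (forall i, P.-integrable setT (EFin \o F i)) ->
  \int[P]_x (\sum_(i <- s) F i x) = \sum_(i <- s) \int[P]_x F i x.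
Proof.
move=> iF; elim: s => [|i s IH].
  by under eq_Rintegral do rewrite big_nil; rewrite big_nil /Rintegral integral0.
under eq_Rintegral do rewrite big_cons.
by rewrite RintegralD// ?IH ?big_cons//; exact: integrable_Rsum.
Qed.

End Rintegral_sum.

(** * Covariance of the rotated components and whitening *)

Section covariance.
Context (R : realType) (d : nat).
Variables (P : probability 'cV[R]_d R) (A : 'M[R]_d)
  (g : 'I_d -> density (@lebesgue_measure R)).
Hypothesis PA : pushes (mulmx A) (law (prod_density g)) P.
Hypothesis sqg : forall j, (law (g j)).-integrable setT (EFin \o (fun x : R => x ^+ 2)).
Local Notation PW := (law (prod_density g)).
Local Notation c := (fun j (t : R) => t - law_mean (g j)).

Lemma coord_pushed_integrable j (a : R -> R) : measurable_fun setT a ->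
  (law (g j)).-integrable setT (EFin \o a) ->
  PW.-integrable setT (EFin \o (fun w : 'cV[R]_d => a (w j ord0))) /\
  \int[PW]_w a (w j ord0) = \int[law (g j)]_t a t.
Proof.
move=> ma ia; have pj := pushes_coord g j.
have ma' : measurable_fun setT (EFin \o a : measurableTypeR R -> _) by exact/measurable_EFinP.
by split; [exact: (integrable_pushes pj ma').1|rewrite (Rintegral_pushes pj)].
Qed.

Lemma coord_cov i j :
  PW.-integrable setT (EFin \o (fun w : 'cV[R]_d => c i (w i ord0) * c j (w j ord0))) /\
  \int[PW]_w (c i (w i ord0) * c j (w j ord0)) = law_var (g i) *+ (i == j).
Proof.
have [<-|ij] := eqVneq i j.
  have [h1 h2] := coord_pushed_integrable (measurable_funX 2
    (measurable_funB (@measurable_id _ _ setT) (measurable_cst (law_mean (g i)))))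
    (law_centered_sq_integrable (sqg i)).
  by split; [exact: h1|exact: h2].
have ic k : (law (g k)).-integrable setT (EFin \o c k).
  have i1 : (law (g k)).-integrable setT (EFin \o (cst (law_mean (g k)) : R -> R)).
    exact: finite_measure_integrable_cst.
  exact: (integrableB measurableT (law_id_integrable (sqg k)) i1).
have [h1 h2] := prod_density_mean_pair ij (ic i) (ic j).
by split; [exact: h1|rewrite h2 !law_mean_centered// mul0r].
Qed.

Lemma coord_mean i :
  PW.-integrable setT (EFin \o (fun w : 'cV[R]_d => w i ord0)) /\
  \int[PW]_w w i ord0 = law_mean (g i).
Proof.
exact: (coord_pushed_integrable (@measurable_id _ _ setT) (law_id_integrable (sqg i))).
Qed.

Lemma mean_bss : mean P id = A *m \col_i law_mean (g i).
Proof.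
apply/matrixP => l m; rewrite ord1 !mxE.
rewrite (Rintegral_pushes PA (F := fun x : 'cV[R]_d => x l ord0)); last exact: measurable_mx_coord.
under eq_Rintegral do rewrite mxE.
rewrite Rintegral_sum => [|i]; last first.
  exact: (integrableZl measurableT (A l i) (coord_mean i).1).
by apply: eq_bigr => i _; rewrite mxE RintegralZl// ?(coord_mean i).2//; exact: (coord_mean i).1.
Qed.

Lemma covmx_bss : covmx P id = A *m diag_mx (\row_i law_var (g i)) *m A^T.
Proof.
apply/matrixP => l m; rewrite mxE mean_bss.
rewrite (Rintegral_pushes PA (F := fun x : 'cV[R]_d =>
  (x l ord0 - (A *m \col_i law_mean (g i)) l ord0) *
  (x m ord0 - (A *m \col_i law_mean (g i)) m ord0))); last first.
  by apply: measurable_funM; apply: measurable_funB => //; exact: measurable_mx_coord.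
have cE (w : 'cV[R]_d) k : (A *m w) k ord0 - (A *m \col_i law_mean (g i)) k ord0 =
    \sum_i A k i * c i (w i ord0).
  by rewrite !mxE -sumrB; apply: eq_bigr => i _; rewrite mxE mulrBr.
under eq_Rintegral do rewrite !cE.
have E (w : 'cV[R]_d) : (\sum_i A l i * c i (w i ord0)) * (\sum_j A m j * c j (w j ord0)) =
    \sum_i \sum_j (A l i * A m j) * (c i (w i ord0) * c j (w j ord0)).
  rewrite mulr_suml; apply: eq_bigr => i _; rewrite mulr_sumr; apply: eq_bigr => j _.
  by rewrite mulrACA.
under eq_Rintegral do rewrite E.
have iij i j : PW.-integrable setT (EFin \o (fun w : 'cV[R]_d =>
    (A l i * A m j) * (c i (w i ord0) * c j (w j ord0)))).
  exact: (integrableZl measurableT _ (coord_cov i j).1).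
rewrite Rintegral_sum => [|i]; last exact: integrable_Rsum.
rewrite mxE; apply: eq_bigr => i _; rewrite Rintegral_sum//.
rewrite (bigD1 i)//= big1 => [|j ji].
  rewrite RintegralZl//; last exact: (coord_cov i i).1.
  rewrite (coord_cov i i).2 eqxx addr0 mulr1n.
  by rewrite mul_mx_diag !mxE; ring.
rewrite RintegralZl//; last exact: (coord_cov i j).1.
by rewrite (coord_cov i j).2 eq_sym (negPf ji) mulr0.
Qed.

End covariance.

Section whitening.
Context (R : realType) (d : nat).
Implicit Types (A : 'M[R]_d) (u : 'cV[R]_d) (v : 'I_d -> R).

(* Only the existence of a square root matters: the norm of S^(-1/2) x is the
   same for every symmetric B with B * B = S. *)
Lemma sqnorm_sqrtmx_diag A v u : orthogonal_mx A -> (forall i, 0 < v i) ->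
  sqnorm (invmx (sqrtmx (A *m diag_mx (\row_i v i) *m A^T)) *m (A *m u)) =
  \sum_i u i ord0 ^+ 2 / v i.
Proof.
move=> oA v0; set S := A *m _ *m _.
have conj (a b : 'rV[R]_d) : (A *m diag_mx a *m A^T) *m (A *m diag_mx b *m A^T) =
    A *m diag_mx (\row_i (a ord0 i * b ord0 i)) *m A^T.
  rewrite -!mulmxA (mulmxA A^T A) oA mul1mx (mulmxA (diag_mx a)); congr (_ *m (_ *m _)).
  by rewrite mulmx_diag.
pose W := A *m diag_mx (\row_i (v i)^-1) *m A^T.
have SW : S *m W = 1%:M.
  rewrite conj (_ : \row__ _ = const_mx 1) ?diag_const_mx ?mulmx1 ?orthogonal_mxC//.
  by apply/rowP => i; rewrite !mxE divff// gt_eqF.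
have : exists B : 'M[R]_d, [/\ B^T = B, forall x, 0 <= dotv x (B *m x) & B *m B = S].
  exists (A *m diag_mx (\row_i Num.sqrt (v i)) *m A^T); split.
  - by rewrite !trmx_mul trmxK tr_diag_mx mulmxA.
  - move=> x; rewrite -[dotv _ _]dotvC -!mulmxA dotv_mulmxl dotvC dotvE.
    apply: sumr_ge0 => i _; rewrite mul_diag_mx !mxE mulrCA mulr_ge0// ?sqrtr_ge0//.
    by rewrite -expr2 sqr_ge0.
  - rewrite conj /S; congr (_ *m diag_mx _ *m _); apply/rowP => i.
    by rewrite !mxE -expr2 sqr_sqrtr// ltW.
move=> /xgetPex/= /(_ 0) [BT _]; rewrite -/(sqrtmx S); set B := sqrtmx S => BB.
have Bu : B \in unitmx.
  have : B *m (B *m W) = 1%:M by rewrite mulmxA BB.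
  by case/mulmx1_unit.
have BVE : invmx B *m invmx B = W.
  by rewrite -[LHS]mulmx1 -SW -BB !mulmxA mulmxKV// mulVmx// mul1mx.
rewrite /sqnorm dotv_mulmxl trmx_inv BT mulmxA BVE dotv_mulmxl /W -!mulmxA.
rewrite (mulmxA A^T A u) oA mul1mx (mulmxA A^T A) oA mul1mx dotvE.
by apply: eq_bigr => i _; rewrite mul_diag_mx !mxE; ring.
Qed.

End whitening.

(** * Score moments and the efficiency formula *)

Section score_vector.
Context (R : realType) (d : nat).
Variables (f : density (lebesgue_cV R d)) (A : 'M[R]_d)
  (g : 'I_d -> density (@lebesgue_measure R)).
Hypothesis ms : measurable_fun setT (score f 0).
Hypothesis qf : qmd f.
Hypothesis is_ : (law f).-integrable setT (fun x => (sqnorm (score f 0 x))%:E).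
Hypothesis oA : orthogonal_mx A.
Hypothesis fA : pushes (mulmx A) (law (prod_density g)) (law f).

Lemma dotv_score h x : dotv h (score f 0 x) =
  \sum_i (A^T *m h) i ord0 * score_along f A i x.
Proof.
have -> : dotv h (score f 0 x) = dotv (A^T *m h) (A^T *m score f 0 x).
  by rewrite -dotv_mulmxl mulmxA orthogonal_mxC// mul1mx.
by rewrite dotvE; apply: eq_bigr => i _; rewrite /score_along dotv_mulmxl dotv_delta.
Qed.

Variable r : 'I_d -> R -> R.
Hypothesis mr : forall j, measurable_fun setT (r j).
Hypothesis ir : forall j, (law (g j)).-integrable setT (EFin \o (fun t => r j t ^+ 2)).

(** Expanding both factors in the frame of [A] gives a double sum, of which [score_mean_off] leaves
    the diagonal. *)
Lemma mean_score_separable h :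
  mean (law f) (fun x => dotv h (score f 0 x) *: separable_map A r x) =
  A *m \col_j ((A^T *m h) j ord0 * score_mean f A j j (r j)).
Proof.
apply/matrixP => l m; rewrite ord1 !mxE.
set k := A^T *m h.
have E x : (dotv h (score f 0 x) *: separable_map A r x) l ord0 =
    \sum_j \sum_i (A l j * k i ord0) * (r j ((A^T *m x) j ord0) * score_along f A i x).
  rewrite mxE dotv_score /separable_map mulrC [X in X * _]mxE mulr_suml.
  apply: eq_bigr => j _; rewrite mulr_sumr; apply: eq_bigr => i _.
  by rewrite -/k [map_cV _ _ _ _]mxE; ring.
under eq_Rintegral do rewrite E.
have i_ j i := mul_score_integrable ms is_ oA fA i (mr j) (ir j).
have iZ j i : (law f).-integrable setT (EFin \o (fun x =>
   (A l j * k i ord0) * (r j ((A^T *m x) j ord0) * score_along f A i x))).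
  exact: (integrableZl measurableT _ (i_ j i)).
rewrite Rintegral_sum => [|j]; last exact: integrable_Rsum.
apply: eq_bigr => j _; rewrite Rintegral_sum// (bigD1 j)//= big1 => [|i ij].
  rewrite addr0 RintegralZl//.
  by rewrite -/(score_mean f A j j (r j)) !mxE mulrA.
rewrite RintegralZl//.
by rewrite -/(score_mean f A i j (r j)) (score_mean_off qf ms is_ oA fA ij (mr j) (ir j)) mulr0.
Qed.

End score_vector.

Section std_normal.
Context (R : realType) (d : nat).
Variable nu : probability 'cV[R]_d R.
Hypothesis hnu : is_mvnormal 0 1%:M nu.

Lemma law_var_stdn : law_var (normal_density (0 : R) 1) = 1.
Proof.
rewrite /law_var; have -> : law_mean (normal_density (0 : R) 1) = 0 by exact: normal_mean.
under eq_Rintegral do rewrite subr0.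
by rewrite /Rintegral normal_sq.
Qed.

Lemma mvnormal_pushes : pushes (mulmx 1%:M) (law (stdn_cV R d)) nu.
Proof.
split; first exact: measurable_mulmx.
move=> B mB; apply: (etrans (stdn_cV_law hnu mB)); congr (law _ _).
by apply/seteqP; split=> x /=; rewrite mul1mx.
Qed.

Lemma covmx_mvnormal : covmx nu id = 1%:M.
Proof.
rewrite (covmx_bss mvnormal_pushes) => [|j]; last exact: normal_sq_integrable.
rewrite trmx1 mulmx1 mul1mx (_ : \row__ _ = const_mx 1) ?diag_const_mx//.
by apply/rowP => i; rewrite !mxE law_var_stdn.
Qed.

Lemma sqnorm_integrable_bss (P : probability 'cV[R]_d R) (A : 'M[R]_d)
    (g : 'I_d -> density (@lebesgue_measure R)) : orthogonal_mx A ->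
  pushes (mulmx A) (law (prod_density g)) P ->
  (forall j, (law (g j)).-integrable setT (EFin \o (fun x : R => x ^+ 2))) ->
  P.-integrable setT (fun x => (sqnorm x)%:E).
Proof.
move=> oA PA sqg.
have mS : measurable_fun setT (fun x : 'cV[R]_d => (sqnorm x)%:E).
  by apply/measurable_EFinP; exact: measurable_sqnorm.
apply/(integrable_pushes PA mS).
have -> : (fun x : 'cV[R]_d => (sqnorm x)%:E) \o mulmx A =
    EFin \o (fun w : 'cV[R]_d => \sum_i w i ord0 ^+ 2).
  apply/funext => w /=; rewrite sqnorm_orthogonal// /sqnorm dotvE.
  by congr EFin; apply: eq_bigr => i _; rewrite expr2.
apply: integrable_Rsum => i.
have m2 : measurable_fun setT (fun x : R => x ^+ 2).
  by apply: measurable_funX; exact: measurable_id.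
have [h _] := coord_pushed_integrable m2 (sqg i).
exact: h.
Qed.

Lemma mvnormal_sqnorm_integrable : nu.-integrable setT (fun x => (sqnorm x)%:E).
Proof.
apply: (sqnorm_integrable_bss _ mvnormal_pushes); first by rewrite /orthogonal_mx trmx1 mulmx1.
by move=> j; exact: normal_sq_integrable.
Qed.

End std_normal.

Section efficiency.
Context (R : realType) (d : nat).
Variables (f : density (lebesgue_cV R d)) (A : 'M[R]_d)
  (g : 'I_d -> density (@lebesgue_measure R)).
Hypothesis ms : measurable_fun setT (score f 0).
Hypothesis qf : qmd f.
Hypothesis is_ : (law f).-integrable setT (fun x => (sqnorm (score f 0 x))%:E).
Hypothesis oA : orthogonal_mx A.
Hypothesis fA : pushes (mulmx A) (law (prod_density g)) (law f).
Hypothesis sqf : (law f).-integrable setT (fun x => (sqnorm x)%:E).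

Lemma coord_sq_integrable j : (law (g j)).-integrable setT (EFin \o (fun x : R => x ^+ 2)).
Proof.
have m2 : measurable_fun setT (EFin \o (fun x : R => x ^+ 2) : measurableTypeR R -> _).
  by apply/measurable_EFinP; apply: measurable_funX; exact: measurable_id.
apply: (integrable_pushes (bss_coord j oA fA) m2).2.
apply: le_integrable sqf => //.
  apply/measurable_EFinP; apply: measurable_funX.
  exact: measurable_coord (measurable_mulmx _).
move=> x _; rewrite /= lee_fin !ger0_norm ?sqnorm_ge0 ?sqr_ge0//.
rewrite -(sqnorm_orthogonal x (orthogonal_mx_tr oA)) /sqnorm dotvE (bigD1 j)//= -expr2.
by rewrite lerDl sumr_ge0// => i _; rewrite -expr2 sqr_ge0.
Qed.

(** The identity is the separable map with all components [id], and each of these has score moment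
    1. *)
Lemma mean_score_id h :
  mean (law f) (fun x => dotv h (score f 0 x) *: x) = h.
Proof.
have E x : separable_map A (fun=> id) x = x.
  rewrite /separable_map (_ : map_cV _ _ = A^T *m x) ?mulmxA ?orthogonal_mxC ?mul1mx//.
  by apply/matrixP => i j; rewrite ord1 mxE.
have -> : (fun x : 'cV[R]_d => dotv h (score f 0 x) *: x) =
    (fun x => dotv h (score f 0 x) *: separable_map A (fun=> id) x).
  by apply/funext => x; rewrite E.
rewrite (mean_score_separable ms qf is_ oA fA) => [|j|j].
- rewrite (_ : \col__ _ = A^T *m h) ?mulmxA ?orthogonal_mxC ?mul1mx//.
  apply/matrixP => i k; rewrite [k]ord1 mxE (score_mean_id qf ms is_ oA fA) ?mulr1//.
  exact: coord_sq_integrable.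
- exact: measurable_id.
- exact: coord_sq_integrable.
Qed.

Variables (r : 'I_d -> R -> R) (I : 'I_d -> set R).
Hypothesis tr : forall i, transport (g i) (r i) (I i).
Variable nu : probability 'cV[R]_d R.
Hypothesis hnu : is_mvnormal 0 1%:M nu.
Hypothesis v0 : forall j, 0 < law_var (g j).

(** [rank_map] is a choice among all rank maps. Uniqueness a.e., available since both laws have
    second moments, replaces it by the separable map under the integral. *)
Lemma mean_score_rank_map h :
  mean (law f) (fun x => dotv h (score f 0 x) *: rank_map (law f) nu x) =
  A *m \col_j ((A^T *m h) j ord0 * score_mean f A j j (r j)).
Proof.
have rT := separable_rank_map oA fA tr hnu.
have rS : is_rank_map (law f) nu (rank_map (law f) nu).
  by apply: (xgetPex (cst 0)); exists (separable_map A r).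
have ST := rank_map_unique sqf (mvnormal_sqnorm_integrable hnu) rT rS.
rewrite -(mean_score_separable ms qf is_ oA fA); last first.
- by move=> j; exact: transport_sq_integrable (tr j).
- by move=> j; exact: transport_measurable (tr j).
have mh : measurable_fun setT (fun x => dotv h (score f 0 x)).
  by apply: measurable_dotv => //; exact: measurable_cst.
have mhT T l : is_rank_map (law f) nu T ->
    measurable_fun setT (EFin \o (fun x => (dotv h (score f 0 x) *: T x) l ord0)).
  move=> [mT _ _]; apply/measurable_EFinP.
  have -> : (fun x => (dotv h (score f 0 x) *: T x) l ord0) =
      (fun x => dotv h (score f 0 x) * T x l ord0) by apply/funext => x; rewrite mxE.
  by apply: measurable_funM => //; exact: measurable_coord.
apply/matrixP => l m; rewrite ord1 !mxE /Rintegral; congr fine.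
apply: ae_eq_integral => //; [exact: mhT|exact: mhT|].
by apply: filterS ST => x -> _.
Qed.

(** Any family of transports may be inserted: quantile maps give the lower bound, affine maps the
    value at normal laws. *)
Lemma ARE_bss h : ARE nu id h f =
  ((\sum_j ((A^T *m h) j ord0 * score_mean f A j j (r j)) ^+ 2) /
   (\sum_j (A^T *m h) j ord0 ^+ 2 / law_var (g j)))%:E.
Proof.
rewrite /ARE sqf mean_score_id mean_score_rank_map (covmx_mvnormal hnu).
rewrite (covmx_bss fA coord_sq_integrable); congr (_ / _)%:E.
(* The identity matrix is written in the frame of [A] with unit variances, so that the whitening
   lemma evaluates the numerator too. *)
- have -> : 1%:M = A *m diag_mx (\row_(i < d) (1 : R)) *m A^T.
    rewrite (_ : \row__ _ = const_mx 1) ?diag_const_mx ?mulmx1 ?orthogonal_mxC//.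
    by apply/rowP => i; rewrite !mxE.
  by rewrite sqnorm_sqrtmx_diag//; apply: eq_bigr => j _; rewrite mxE divr1.
- rewrite -(sqnorm_sqrtmx_diag (A^T *m h) oA v0).
  by congr (sqnorm (_ *m _)); rewrite mulmxA orthogonal_mxC// mul1mx.
Qed.

End efficiency.

(** * Lower bound and equality case *)

Section efficiency_bound.
Context (R : realType) (d : nat).
Variables (f : density (lebesgue_cV R d)) (A : 'M[R]_d)
  (g : 'I_d -> density (@lebesgue_measure R)).
Hypothesis rf : regular f.
Hypothesis oA : orthogonal_mx A.
Hypothesis fA : pushes (mulmx A) (law (prod_density g)) (law f).
Hypothesis sqf : (law f).-integrable setT (fun x => (sqnorm x)%:E).
Variable nu : probability 'cV[R]_d R.
Hypothesis hnu : is_mvnormal 0 1%:M nu.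
Implicit Types h : 'cV[R]_d.

Local Notation q := (fun j => quantile_map (g j)).
Local Notation e := (fun j => energy (g j) (q j)).
Local Notation S := (fun j => score_mean f A j j (q j)).
Local Notation v := (fun j => law_var (g j)).

Let qf : qmd f. Proof. by case: rf. Qed.
Let ms : measurable_fun setT (score f 0). Proof. by case: rf. Qed.
Let is_ : (law f).-integrable setT (fun x => (sqnorm (score f 0 x))%:E).
Proof. by case: rf. Qed.
Let sqg := coord_sq_integrable oA fA sqf.

Lemma axis_bound j : [/\ 0 < e j, 0 < v j, e j ^+ 2 <= v j & (e j)^-1 <= S j].
Proof.
have [e0 eS] := score_mean_quantile qf ms is_ oA fA (sqg j).
have ev := energy_le_var (sqg j) (quantile_transport (g j)).
by split=> //; apply: lt_le_trans ev; rewrite exprn_gt0.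
Qed.

Lemma axis_sq_bound j : (v j)^-1 <= S j ^+ 2.
Proof.
have [e0 v0 ev eS] := axis_bound j.
rewrite (@le_trans _ _ ((e j)^-1 ^+ 2))//.
  by rewrite exprVn lef_pV2 ?posrE// exprn_gt0.
by rewrite ler_sqr// nnegrE ?invr_ge0 ?(le_trans _ eS) ?invr_ge0// ltW.
Qed.

(** In the chain 1/v_j <= 1/e_j^2 <= S_j^2 equality of the two ends closes the first gap, which is
    the equality case of Cauchy-Schwarz. *)
Lemma axis_sq_eq j : S j ^+ 2 = (v j)^-1 -> v j <= e j ^+ 2.
Proof.
have [e0 v0 ev eS] := axis_bound j.
move=> Sv; rewrite -lef_pV2 ?posrE ?exprn_gt0// -Sv -exprVn.
by rewrite ler_sqr// nnegrE ?invr_ge0 ?(le_trans _ eS) ?invr_ge0// ltW.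
Qed.

Lemma ARE_quantile h : ARE nu id h f =
  ((\sum_j ((A^T *m h) j ord0 * S j) ^+ 2) /
   (\sum_j (A^T *m h) j ord0 ^+ 2 / v j))%:E.
Proof.
apply: (ARE_bss ms qf is_ oA fA sqf (fun j => quantile_transport (g j)) hnu) => j.
by have [] := axis_bound j.
Qed.

Lemma ARE_denominator_gt0 h : h != 0 -> 0 < \sum_j (A^T *m h) j ord0 ^+ 2 / v j.
Proof.
move=> h0; have v0 j : 0 < v j by have [] := axis_bound j.
rewrite lt_neqAle sumr_ge0 ?andbT => [|j _]; last first.
  by rewrite divr_ge0 ?sqr_ge0// ltW.
apply: contraNneq h0 => /esym/eqP; rewrite psumr_eq0 => [|j _]; last first.
  by rewrite divr_ge0 ?sqr_ge0// ltW.
move=> /allP s0; rewrite -[h](mul1mx h) -(orthogonal_mxC oA) -mulmxA.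
rewrite (_ : A^T *m h = 0) ?mulmx0//; apply/matrixP => j k; rewrite [k]ord1 [RHS]mxE.
have := s0 j (mem_index_enum _); rewrite mulf_eq0 sqrf_eq0 invr_eq0.
by rewrite [_ == 0 in X in _ || X]gt_eqF// orbF => /eqP.
Qed.

Lemma ARE_ge1 h : h != 0 -> (1 <= ARE nu id h f)%E.
Proof.
move=> h0; rewrite ARE_quantile lee_fin ler_pdivlMr ?ARE_denominator_gt0// mul1r.
by apply: ler_sum => j _; rewrite exprMn ler_wpM2l ?sqr_ge0// axis_sq_bound.
Qed.

(** Numerator minus denominator is a sum of nonnegative terms weighted by [(A^T *m h) j ord0 ^+ 2].
    Nonzero weights make each term vanish, so every component attains the Cauchy-Schwarz bound and
    is normal. *)
Lemma ARE_eq1 h : (forall j, (A^T *m h) j ord0 != 0) ->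
  ARE nu id h f = 1%E -> rotated_normal f.
Proof.
move=> k0; rewrite ARE_quantile => -[] /divr1_eq E.
have ve j : v j <= e j ^+ 2.
  apply: axis_sq_eq.
  have ge0 i : 0 <= (A^T *m h) i ord0 ^+ 2 * (S i ^+ 2 - (v i)^-1).
    by rewrite mulr_ge0 ?sqr_ge0// subr_ge0 axis_sq_bound.
  have : \sum_i (A^T *m h) i ord0 ^+ 2 * (S i ^+ 2 - (v i)^-1) == 0.
    apply/eqP; under eq_bigr do rewrite mulrBr -exprMn.
    by rewrite sumrB E subrr.
  rewrite psumr_eq0// => /allP/(_ j (mem_index_enum _)).
  by rewrite mulf_eq0 sqrf_eq0 (negPf (k0 j)) subr_eq0 => /eqP.
have e0 j : 0 < e j by have [] := axis_bound j.
pose N j := normal_density (law_mean (g j)) (e j).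
pose D : 'M[R]_d := diag_mx (\row_j e j ^+ 2).
have DE j : D j j = e j ^+ 2 by rewrite !mxE eqxx.
have D0 j : 0 < D j j by rewrite DE exprn_gt0.
exists A, (\col_j law_mean (g j)), D, (law (prod_density N)); split=> //.
- exact: diag_mx_is_diag.
- apply/(mvnormal_law _ _ (diag_mx_is_diag _) D0) => B mB.
  congr (law (prod_density _) B); apply/funext => j.
  by rewrite mxE DE sqrtr_sqr gtr0_norm.
- have pN : pushes (map_cV (fun _ x => x)) (law (prod_density g)) (law (prod_density N)).
    by apply: pushes_map_cV => j; apply: normal_rigidity (quantile_transport (g j)) (e0 j) (ve j).
  move=> B mB; rewrite fA.2//.
  have mAB : measurable [set w : 'cV[R]_d | B (A *m w)].
    by rewrite -[X in measurable X]setTI; apply: measurable_mulmx.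
  rewrite pN.2//; congr (law _ _); apply/seteqP; split=> w /=;
    by rewrite (_ : map_cV _ w = w)//; apply/matrixP => j k; rewrite [k]ord1 mxE.
Qed.

End efficiency_bound.

Section normal_efficiency.
Context (R : realType) (d : nat).
Variables (f : density (lebesgue_cV R d)).
Hypothesis rf : regular f.
Hypothesis nf : rotated_normal f.
Variable nu : probability 'cV[R]_d R.
Hypothesis hnu : is_mvnormal 0 1%:M nu.

(** The rotation is taken from the normal representation of [f]. Its transports are affine, so their
    score moments are [(s j)^-1] by [score_mean_id] and [score_mean_cst], and numerator and
    denominator agree term by term. *)
Lemma ARE_normal (h : 'cV[R]_d) : h != 0 -> ARE nu id h f = 1%E.
Proof.
have [A [theta [S [PW [oA dS S0 nPW fPW]]]]] := nf.
pose s j := Num.sqrt (S j j); pose g j := normal_density (theta j ord0) (s j).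
have s0 j : 0 < s j by rewrite sqrtr_gt0.
have gPW := (mvnormal_law theta PW dS S0).1 nPW.
have fA : pushes (mulmx A) (law (prod_density g)) (law f).
  split; first exact: measurable_mulmx.
  move=> B mB; apply: (etrans (fPW B mB)); apply: gPW.
  by rewrite -[X in measurable X]setTI; apply: measurable_mulmx.
have tr j := normal_transport (theta j ord0) (s0 j).
have xE j (x : R) : x = s j * ((x - theta j ord0) / s j) + theta j ord0.
  by rewrite mulrC divfK ?subrK// gt_eqF.
have ir j := transport_integrable (tr j).
have ir2 j := transport_sq_integrable (tr j).
have ic j k : (law (g j)).-integrable setT (EFin \o (cst k : R -> R)).
  exact: finite_measure_integrable_cst.
have sqg j : (law (g j)).-integrable setT (EFin \o (fun x : R => x ^+ 2)).
  have -> : (fun x : R => x ^+ 2) = (fun x => s j ^+ 2 * ((x - theta j ord0) / s j) ^+ 2 +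
      ((2 * s j * theta j ord0) * ((x - theta j ord0) / s j) + theta j ord0 ^+ 2)).
    by apply/funext => x; rewrite {1}(xE j x); ring.
  have i1 := integrableZl measurableT (s j ^+ 2) (ir2 j).
  have i2 := integrableZl measurableT (2 * s j * theta j ord0) (ir j).
  exact: (integrableD measurableT i1 (integrableD measurableT i2 (ic j _))).
have sqf := sqnorm_integrable_bss oA fA sqg.
have [_ ms qf is_ _] := rf.
have one j : \int[law (g j)]_x (1 : R) = 1.
  by rewrite Rintegral_cst// mul1r; exact: (congr1 fine (integral_pdf (g j))).
have mE j : law_mean (g j) = theta j ord0.
  rewrite /law_mean.
  have -> : \int[law (g j)]_x x =
      \int[law (g j)]_x (s j * ((x - theta j ord0) / s j) + theta j ord0).
    by apply: eq_Rintegral => x _; exact: xE.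
  have i1 : (law (g j)).-integrable setT
      (EFin \o (fun x => s j * ((x - theta j ord0) / s j))).
    exact: (integrableZl measurableT (s j) (ir j)).
  have := ic j (theta j ord0); have := ir j => i0 i2.
  rewrite RintegralD// RintegralZl//.
  rewrite (transport_mean (tr j)) mulr0 add0r Rintegral_cst//.
  by rewrite [fine _](congr1 fine (integral_pdf (g j))) mulr1.
have vE j : law_var (g j) = s j ^+ 2.
  have E (x : R) : (x - theta j ord0) ^+ 2 = s j ^+ 2 * ((x - theta j ord0) / s j) ^+ 2.
    by rewrite -exprMn mulrC divfK// gt_eqF.
  rewrite /law_var mE; under eq_Rintegral do rewrite E.
  have := ir2 j => i2; rewrite RintegralZl//.
  by rewrite /Rintegral (transport_sq (tr j)) mulr1.
have SE j : score_mean f A j j (fun x => (x - theta j ord0) / s j) = (s j)^-1.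
  have mid : measurable_fun setT (@id R) by exact: measurable_id.
  have i1 := mul_score_integrable ms is_ oA fA j mid (sqg j).
  have i2 := mul_score_integrable ms is_ oA fA j
    (measurable_cst (theta j ord0 : R)) (ic j (theta j ord0 ^+ 2)).
  have E (x : 'cV[R]_d) : ((A^T *m x) j ord0 - theta j ord0) / s j * score_along f A j x =
      (s j)^-1 * ((A^T *m x) j ord0 * score_along f A j x - theta j ord0 * score_along f A j x).
    by ring.
  rewrite /score_mean; under eq_Rintegral do rewrite E.
  have i3 := integrableB measurableT i1 i2; rewrite RintegralZl//.
  rewrite RintegralB// -/(score_mean f A j j id) -/(score_mean f A j j (cst (theta j ord0))).
  rewrite (score_mean_id qf ms is_ oA fA (sqg j)) (score_mean_cst qf ms is_ oA fA).
  by rewrite subr0 mulr1.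
move=> h0.
rewrite (ARE_bss ms qf is_ oA fA sqf tr hnu) => [|j]; last by rewrite vE exprn_gt0.
congr EFin.
have -> : \sum_j ((A^T *m h) j ord0 * score_mean f A j j (fun x => (x - theta j ord0) / s j)) ^+ 2 =
   \sum_j (A^T *m h) j ord0 ^+ 2 / law_var (g j).
  by apply: eq_bigr => j _; rewrite SE vE exprMn exprVn.
by rewrite divff// gt_eqF// (ARE_denominator_gt0 rf oA fA sqf).
Qed.

End normal_efficiency.

Theorem theoremB1 (R : realType) (d : nat) (h : 'cV[R]_d) (hn0 : h != 0)
  (m n : nat -> nat) (hmn : forall N, (m N + n N)%N = N)
  (lambda : R) (hlambda : 0 < lambda < 1)
  (hm : ((m N)%:R / N%:R : R) @[N --> \oo] --> lambda)
  (J : 'cV[R]_d -> 'cV[R]_d) (hJ : forall x, J x = x)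
  (nu : probability 'cV[R]_d R) (hnu : is_mvnormal 0 1%:M nu)
  (hd : forall N, 'I_N -> 'cV[R]_d)
  (hd_cvg : empirical_weak_cvg hd nu)
  (hd_sup : (limn_esup (fun N =>
                (N%:R^-1 * \sum_(i < N) sqnorm (J (hd N i)))%:E)
             <= \int[nu]_z (sqnorm (J z))%:E)%E) :
  [/\ (1 <= ereal_inf [set ARE nu J h f | f in @Fgen R d])%E,
      forall f, Fgen f ->
        ((forall k, k != 0 -> ARE nu J k f = 1%E) <-> rotated_normal f) &
      forall f A g, Fgen f -> orthogonal_mx A -> f =1 bss_pdf A g ->
        (forall i, (A^T *m h) i ord0 != 0) ->
        (ARE nu J h f = 1%E <-> rotated_normal f)].
Proof.
have {hd_sup} -> : J = id by apply/funext.
have ge1 f : Fgen f -> (1 <= ARE nu id h f)%E.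
  move=> [rf [A [g [oA fE]]]]; have fA := bss_law oA fE.
  have [sqf|/negbTE nsqf] := boolP ((law f).-integrable setT (fun x => (sqnorm x)%:E)).
    exact: (ARE_ge1 rf oA fA sqf hnu hn0).
  by rewrite /ARE nsqf leey.
have eq1 f A g k : Fgen f -> orthogonal_mx A -> f =1 bss_pdf A g ->
    (forall i, (A^T *m k) i ord0 != 0) -> ARE nu id k f = 1%E -> rotated_normal f.
  move=> [rf _] oA fE k0 k1; have fA := bss_law oA fE.
  (* An efficiency of 1 is finite, which excludes an infinite second moment. *)
  have sqf : (law f).-integrable setT (fun x => (sqnorm x)%:E).
    by apply: contraT => /negbTE nsqf; move: k1; rewrite /ARE nsqf.
  exact: (ARE_eq1 rf oA fA sqf hnu k0 k1).
split.
- by apply: le_ereal_inf_tmp => _ [f Ff <-]; exact: ge1.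
- move=> f Ff; split=> [ARE1|nf k k0]; last exact: (ARE_normal Ff.1 nf hnu k0).
  have [rf [A [g [oA fE]]]] := Ff.
  (* The direction whose coordinates in the frame [A] are all 1, so that no component escapes the
     equality case. *)
  have AE : A^T *m (A *m const_mx 1) = const_mx 1 :> 'cV[R]_d by rewrite mulmxA oA mul1mx.
  have k1 i : (A^T *m (A *m const_mx 1 : 'cV[R]_d)) i ord0 != 0.
    by rewrite AE mxE oner_neq0.
  apply: (eq1 f A g _ Ff oA fE k1); apply: ARE1.
  (* [h != 0] provides an index, hence [d > 0]; in dimension 0 the chosen direction would be
     zero. *)
  apply: contraNneq hn0 => A0; apply/eqP/matrixP => i j; exfalso.
  by move: (k1 i); rewrite A0 mulmx0 mxE eqxx.
- move=> f A g Ff oA fE k0; split; first exact: eq1 Ff oA fE k0.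
  by move=> nf; exact: (ARE_normal Ff.1 nf hnu hn0).
Qed.
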